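(* Let $d\ge1$, let $A$ be a real symmetric positive definite $d\times d$ matrix, and put $v_j=A^{-1/2}e_j$, $w_j=A^{1/2}e_j$ for $1\le j\le d$. Let $a>0$. If $f\in L^2(\mathbb{R}^d)$ is such that, for $j\in\{1,\dots,d\}$, $$|f(x)|\lesssim e^{-\frac12|\langle Ax,v_j\rangle|^2+\lambda\log_+^{1+a}(|\langle Ax,v_j\rangle|)}\quad\text{and}\quad|\widehat f(\xi)|\lesssim e^{-\frac12|\langle A^{-1}\xi,w_j\rangle|^2+\lambda\log_+^{1+a}(|\langle A^{-1}\xi,w_j\rangle|)},$$ for some $\lambda>0$, then $$|H_A(f,\alpha)|\lesssim e^{-\left(\frac{r|\alpha|}{d}\right)^{\frac{a+1}{a}}},\qquad 0<r<\frac{a^{\frac a{1+a}}}{1+a}\lambda^{-\frac1{1+a}}.$$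
   Context: $\log_+=\max\{0,\log\}$ and $\log_+^{1+a}(t)=(\log_+t)^{1+a}$. $\langle\cdot,\cdot\rangle$ is the Euclidean inner product and $\{e_j\}$ the standard basis of $\mathbb{R}^d$. $\widehat f(\xi)=(2\pi)^{-d/2}\int_{\mathbb{R}^d}f(x)e^{-i\langle x,\xi\rangle}dx$. For $\alpha\in\mathbb{N}^d$ ($0\in\mathbb{N}$), $|\alpha|=\alpha_1+\dots+\alpha_d$. Hermite functions: $h_\alpha(x)=(-1)^{|\alpha|}\pi^{-d/4}(2^{|\alpha|}\alpha!)^{-1/2}e^{\frac12|x|^2}\partial^\alpha[e^{-|x|^2}]$; $A$-skewed Hermite functions $h_{A,\alpha}(x)=(\det A)^{1/4}h_\alpha(A^{1/2}x)$ (an orthonormal basis of $L^2(\mathbb{R}^d)$); $H_A(f,\alpha)=(f,h_{A,\alpha})_{L^2}$. $\lesssim$ means $\le$ up to a positive multiplicative constant independent of $x,\xi,\alpha$ (it may depend on $r$). Pointwise bounds are understood almost everywhere. *)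

(* Defs.v *)
From HB Require Import structures.
From mathcomp Require Import all_boot all_order all_algebra.
From mathcomp Require Import all_classical all_reals all_analysis.
From mathcomp Require Import complex.

Set Implicit Arguments.
Unset Strict Implicit.
Unset Printing Implicit Defensive.

Import Order.TTheory GRing.Theory Num.Theory.
Import numFieldNormedType.Exports.

Local Open Scope classical_set_scope.
Local Open Scope ring_scope.

Section sqrtmx.
Variable R : rcfType.

Definition dotv n (x y : 'cV[R]_n) : R := \sum_i x i 0 * y i 0.

Definition posdefmx n (A : 'M[R]_n) : Prop :=
  A^T = A /\ forall x : 'cV[R]_n, x != 0 -> 0 < dotv x (A *m x).

Lemma dotvE n (x y : 'cV[R]_n) : (dotv x y)%:M = x^T *m y :> 'M[R]_1.
Proof.
apply/matrixP => i j; rewrite !ord1 !mxE eqxx mulr1n.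
by apply: eq_bigr => k _; rewrite mxE.
Qed.

Lemma dotvv_gt0 n (x : 'cV[R]_n) : x != 0 -> 0 < dotv x x.
Proof.
move=> x0; rewrite lt_neqAle sumr_ge0 ?andbT => [|i _]; last exact: sqr_ge0.
apply: contraNneq x0 => /esym/eqP; rewrite psumr_eq0 => [/allP x0|i _]; last first.
  exact: sqr_ge0.
apply/eqP/colP => i; rewrite mxE; apply/eqP.
by have := x0 i (mem_index_enum i); rewrite /= mulf_eq0 orbb.
Qed.

Lemma dotv_mulmx n (S : 'M[R]_n) (x y : 'cV[R]_n) :
  dotv x (S *m y) = dotv (S^T *m x) y.
Proof.
have := dotvE x (S *m y); rewrite mulmxA -[x^T *m S]trmxK trmx_mul trmxK -dotvE.
by move=> /matrixP/(_ 0 0); rewrite !mxE eqxx !mulr1n.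
Qed.

Lemma interpolation (s : seq R) (g : R -> R) :
  exists p : {poly R}, {in s, forall x, p.[x] = g x}.
Proof.
elim: s => [|x s [p ps]]; first by exists 0.
have [xs|xs] := boolP (x \in s).
  by exists p => y; rewrite inE => /orP[/eqP ->|]; apply: ps.
pose q := \prod_(z <- s) ('X - z%:P).
have qx : q.[x] != 0 by rewrite -[_ == 0]/(root q x) root_prod_XsubC.
exists (p + ((g x - p.[x]) / q.[x]) *: q) => y.
rewrite inE hornerD hornerZ => /orP[/eqP ->|ys].
  by rewrite divfK// addrC subrK.
have /eqP -> : q.[y] == 0 by rewrite -[_ == 0]/(root q y) root_prod_XsubC.
by rewrite mulr0 addr0 ps.
Qed.

Let toC m n : 'M[R]_(m, n) -> 'M[R[i]]_(m, n) := map_mx (real_complex R).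

Lemma posdef_spectral n (A : 'M[R]_n) : posdefmx A ->
  exists P : 'M[R[i]]_n, exists D : 'rV[R]_n, [/\ P \in unitmx,
    toC A = invmx P *m diag_mx (toC D) *m P & forall i, 0 < D 0 i].
Proof.
case=> Asym Apos.
have Ah : toC A \is hermsymmx.
  apply: realsym_hermsym.
    by apply/is_hermitianmxP; rewrite expr0 scale1r map_mx_id// /toC map_trmx Asym.
  by apply/mxOverP => i j; rewrite mxE complex_real.
pose P := spectralmx (toC A); pose sp := spectral_diag (toC A).
have Pu : P \in unitmx by exact: spectral_unit.
have Ae : toC A = invmx P *m diag_mx sp *m P.
  exact/orthomx_spectralP/hermitian_normalmx.
have spr : sp \is a realmx by exact: hermitian_spectral_diag_real.
pose D : 'rV[R]_n := map_mx (@complex.Re R) sp.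
have spE : sp = toC D.
  by apply/rowP => i; rewrite !mxE RRe_real//; exact: (mxOverP spr).
exists P, D; split; rewrite -?spE// => i.
have : eigenvalue (toC A) (D 0 i)%:C%C.
  apply/eigenvalueP; exists (row i P).
    rewrite -row_mul Ae -!mulmxA mulKVmx// mul_diag_mx; apply/rowP => j.
    by rewrite !mxE spE mxE.
  apply: contraTneq Pu => P0; rewrite unitmxE (expand_det_row _ i) big1 ?unitr0// => j _.
  by have /rowP/(_ j) := P0; rewrite !mxE => ->; rewrite mul0r.
rewrite eigenvalue_root_char /toC -map_char_poly fmorph_root.
rewrite -eigenvalue_root_char => /eigenvalueP[v vA v0].
have vT0 : v^T != 0 by rewrite -(inj_eq (@trmx_inj _ _ _)) trmxK trmx0.
have := Apos _ vT0; rewrite -{1}Asym -trmx_mul vA linearZ/=.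
have -> : dotv v^T (D 0 i *: v^T) = D 0 i * dotv v^T v^T.
  rewrite /dotv mulr_sumr; apply: eq_bigr => k _.
  by rewrite !mxE mulrCA.
by rewrite pmulr_lgt0// dotvv_gt0.
Qed.

(* A square root that is moreover a polynomial in A. *)
Lemma exists_sqrtmx n (A : 'M[R]_n) : posdefmx A ->
  exists S : 'M[R]_n, [/\ posdefmx S, S *m S = A &
    forall T, T *m A = A *m T -> T *m S = S *m T].
Proof.
case: n A => [|n] A Apd.
  exists A; split=> //; first by apply/matrixP => -[].
have [Asym Apos] := Apd; have [P [D [Pu AE Dpos]]] := posdef_spectral Apd.
have [p pE] := interpolation [seq D 0 i | i : 'I_n.+1]
  (fun x => Num.sqrt (Num.sqrt x)).
have pD i : p.[D 0 i] ^+ 4 = D 0 i.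
  rewrite pE; last by apply/mapP; exists i; rewrite ?mem_enum.
  by rewrite (exprM _ 2 2) !sqr_sqrtr ?sqrtr_ge0// ltW.
pose S0 := horner_mx A p.
have S04 : S0 ^+ 4 = A.
  rewrite /S0 -rmorphXn; apply: (@map_mx_inj _ _ (real_complex R)).
  rewrite map_horner_mx -[map_mx _ A]/(toC A) AE horner_mx_uconjC// horner_mx_diag.
  congr (_ *m diag_mx _ *m _); apply/rowP => i.
  by rewrite !mxE horner_map /= horner_exp pD.
have S0sym : S0^T = S0.
  rewrite /S0; elim/poly_ind: (p) => [|q c IHq]; first by rewrite rmorph0 trmx0.
  rewrite rmorphD rmorphM /= horner_mx_X horner_mx_C linearD /= tr_scalar_mx.
  by rewrite trmx_mul IHq Asym; congr (_ + _); exact/esym/comm_horner_mx.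
have S0C (T : 'M[R]_n.+1) : T *m A = A *m T -> T *m S0 = S0 *m T.
  exact: comm_mx_horner.
clearbody S0.
have SS : S0 *m S0 *m (S0 *m S0) = A.
  by rewrite -[RHS]S04 !exprS expr0 mulr1; exact/esym/mulmxA.
have S0inj (x : 'cV[R]_n.+1) : x != 0 -> S0 *m x != 0.
  move=> x0; apply: contraTneq (Apos _ x0) => S0x.
  by rewrite -SS -!mulmxA S0x !mulmx0 /dotv big1 ?ltxx// => i _; rewrite mxE mulr0.
exists (S0 *m S0); split.
- split; first by rewrite trmx_mul S0sym.
  by move=> x x0; rewrite -mulmxA dotv_mulmx S0sym dotvv_gt0// S0inj.
- exact: SS.
- move=> T /S0C TS.
  by rewrite mulmxA TS -mulmxA TS mulmxA.
Qed.

Lemma posdef_sqrt_uniq n (A S T : 'M[R]_n) : posdefmx A ->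
  posdefmx S -> S *m S = A -> posdefmx T -> T *m T = A -> S = T.
Proof.
move=> /exists_sqrtmx[U [[_ Upos] UA UC]].
suff UE X : posdefmx X -> X *m X = A -> X = U.
  by move=> Spd SA Tpd TA; rewrite (UE _ Spd SA) (UE _ Tpd TA).
case=> _ Xpos XA; have XU : X *m U = U *m X by apply: UC; rewrite -XA mulmxA.
apply/eqP; rewrite -subr_eq0; apply/eqP/matrixP => i j.
suff : col j (X - U) = 0 by move=> /colP/(_ i); rewrite !mxE.
apply/eqP/contraT => y0; have := addr_gt0 (Xpos _ y0) (Upos _ y0).
set y := col _ _; have -> : dotv y (X *m y) + dotv y (U *m y) = dotv y ((X + U) *m y).
  rewrite mulmxDl /dotv -big_split /=; apply: eq_bigr => k _.
  by rewrite -mulrDr; congr (_ * _); rewrite [RHS]mxE.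
rewrite /y colE mulmxA.
have -> : (X + U) *m (X - U) = 0.
  by rewrite mulmxBr !mulmxDl XA UA XU [A + _]addrC subrr.
by rewrite mul0mx /dotv big1 ?ltxx// => k _; rewrite [X in _ * X]mxE mulr0.
Qed.

End sqrtmx.

(* A^(1/2) is well defined for a symmetric positive definite matrix A, by
   sqrtmxP and posdef_sqrt_uniq. *)
Definition sqrtmx (R : rcfType) (n : nat) (A : 'M[R]_n) : 'M[R]_n :=
  xget 0 [set S | posdefmx S /\ S *m S = A].

Lemma sqrtmxP (R : rcfType) (n : nat) (A : 'M[R]_n) : posdefmx A ->
  posdefmx (sqrtmx A) /\ sqrtmx A *m sqrtmx A = A.
Proof.
move=> /exists_sqrtmx[S [Spd SA _]].
by rewrite /sqrtmx; case: xgetP => [T _ //|/(_ S)]; case.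
Qed.

(* The Borel sigma-algebra of R^n, generated by the coordinate maps. *)
Definition cV_display : measure_display.
Proof. exact. Qed.

Section measurable_cV.
Context {R : realType} {n : nat}.

Let coor (i : 'I_n) (x : 'cV[R]_n) : measurableTypeR R := x i 0.

Definition measurable_cV : set (set 'cV[R]_n) := g_sigma_preimage coor.

Let measurable_cV0 : measurable_cV set0.
Proof. exact: sigma_algebra0. Qed.

Let measurable_cVC A : measurable_cV A -> measurable_cV (~` A).
Proof. exact: sigma_algebraC. Qed.

Let measurable_cV_bigcup (F : _^nat) :
  (forall i, measurable_cV (F i)) -> measurable_cV (\bigcup_i (F i)).
Proof. exact: sigma_algebra_bigcup. Qed.

HB.instance Definition _ := @isMeasurable.Build cV_display 'cV[R]_n
  measurable_cV measurable_cV0 measurable_cVC measurable_cV_bigcup.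

Lemma measurable_coord (i : 'I_n) :
  measurable_fun [set: 'cV[R]_n] (fun x : 'cV[R]_n => x i 0 : measurableTypeR R).
Proof.
move=> _ Y mY; rewrite setTI; apply: sub_sigma_algebra => /=.
rewrite -bigcup_seq/=; exists i => /=; first by rewrite mem_index_enum.
by exists Y => //; rewrite setTI.
Qed.

Lemma measurable_fun_cVP d (T : measurableType d) (f : T -> 'cV[R]_n) :
  (forall i, measurable_fun [set: T] (fun t => f t i 0 : measurableTypeR R)) ->
  measurable_fun [set: T] f.
Proof.
move=> mf _ A mA; rewrite setTI.
suff : g_sigma_preimage (fun i => coor i \o f) `<=` measurable.
  rewrite g_sigma_preimage_comp; apply; exists A => //.
  by rewrite setTI.
apply: smallest_sub; first exact: sigma_algebra_measurable.
rewrite -bigcup_seq/=; apply: bigcup_sub => i _.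
by move=> B [C mC <-]; exact: mf.
Qed.

End measurable_cV.

(* (t, x) |-> (t, x_1, ..., x_n) *)
Definition cons_cV (R : realType) (n : nat)
    (p : measurableTypeR R * 'cV[R]_n) : 'cV[R]_n.+1 :=
  \col_i oapp (fun j => p.2 j 0) p.1 (unlift ord0 i).

Section lebesgue_step.
Context {R : realType} {n : nat}.

Let uncons_cV (x : 'cV[R]_n.+1) : measurableTypeR R * 'cV[R]_n :=
  (x ord0 0, \col_j x (lift ord0 j) 0).

Let cons_cVK : cancel (@cons_cV R n) uncons_cV.
Proof.
case=> t x; rewrite /uncons_cV /cons_cV; congr (_, _).
  by rewrite mxE unlift_none.
by apply/colP => j; rewrite !mxE liftK.
Qed.

Let uncons_cVK : cancel uncons_cV (@cons_cV R n).
Proof.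
by move=> x; apply/colP => i; rewrite !mxE; case: unliftP => [j ->|->] //=;
  rewrite mxE.
Qed.

Lemma measurable_cons_cV : measurable_fun [set: _] (@cons_cV R n).
Proof.
apply: measurable_fun_cVP => i; case: (unliftP ord0 i) => [j ->|->].
  rewrite (_ : (fun t => _) = (fun x : 'cV[R]_n => x j 0) \o snd).
    exact: (measurableT_comp (measurable_coord j)).
  by apply/funext => p /=; rewrite mxE liftK.
rewrite (_ : (fun t => _) = fst); first exact: measurable_fst.
by apply/funext => p; rewrite mxE unlift_none.
Qed.

Let measurable_uncons_cV : measurable_fun [set: _] uncons_cV.
Proof.
apply/measurable_fun_pairP; split; first exact: measurable_coord.
apply: measurable_fun_cVP => i.
rewrite (_ : (fun t => _) = fun x : 'cV[R]_n.+1 => x (lift ord0 i) 0).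
  exact: measurable_coord.
by apply/funext => p; rewrite mxE.
Qed.

Variable m : {sigma_finite_measure set 'cV[R]_n -> \bar R}.
Let mu1 : {sigma_finite_measure set (measurableTypeR R) -> \bar R} :=
  @lebesgue_measure R.

Definition lebesgue_step : set 'cV[R]_n.+1 -> \bar R :=
  pushforward (mu1 \x m)%E (@cons_cV R n).

Let lebesgue_step0 : lebesgue_step set0 = 0%E.
Proof. by rewrite /lebesgue_step /pushforward preimage_set0 measure0. Qed.

Let lebesgue_step_ge0 A : (0 <= lebesgue_step A)%E.
Proof. exact: (measure_ge0 (mu1 \x m)%E). Qed.

Let lebesgue_step_sigma_additive : semi_sigma_additive lebesgue_step.
Proof.
pose p := measure_function_pushforward__canonical__measure_function_Measure
  (mu1 \x m)%E measurable_cons_cV.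
exact: (@measure_semi_sigma_additive _ _ _ p).
Qed.

HB.instance Definition _ := isMeasure.Build _ _ _ lebesgue_step
  lebesgue_step0 lebesgue_step_ge0 lebesgue_step_sigma_additive.

Let lebesgue_step_sigma_finite : sigma_finite [set: 'cV[R]_n.+1] lebesgue_step.
Proof.
have /sigma_finiteP[F [TF ndF Foo]] := sigma_finiteT mu1.
have /sigma_finiteP[G [TG ndG Goo]] := sigma_finiteT m.
exists (fun k => uncons_cV @^-1` (F k `*` G k)).
  rewrite -preimage_bigcup (_ : \bigcup_k _ = setT) ?preimage_setT//.
  apply/seteqP; split=> // -[t x] _.
  have [i _ Fit] : (\bigcup_i F i) t by rewrite -TF.
  have [j _ Gjx] : (\bigcup_i G i) x by rewrite -TG.
  exists (maxn i j) => //; split => /=.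
    by move: t Fit; exact/subsetPset/ndF/leq_maxl.
  by move: x Gjx; exact/subsetPset/ndG/leq_maxr.
move=> k; have [mF Fk] := Foo k; have [mG Gk] := Goo k.
have mFG : measurable (F k `*` G k) by exact: measurableX.
split; first by rewrite -[X in measurable X]setTI; exact: measurable_uncons_cV.
rewrite /lebesgue_step /pushforward -comp_preimage.
rewrite (_ : _ \o _ = id) ?preimage_id; last first.
  by apply/funext => p; exact: cons_cVK.
by rewrite product_measure1E// lte_mul_pinfty// ge0_fin_numE.
Qed.

HB.instance Definition _ := @Measure_isSigmaFinite.Build _ _ _ lebesgue_step
  lebesgue_step_sigma_finite.
End lebesgue_step.

(* Lebesgue measure on R^n, as an iterated product measure. *)
Fixpoint lebesgue_cV (R : realType) (n : nat) :
    {sigma_finite_measure set 'cV[R]_n -> \bar R} :=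
  if n is k.+1 then lebesgue_step (lebesgue_cV R k) else dirac (0 : 'cV[R]_0).

Section hermite.
Context {R : realType} {d : nat}.
Implicit Types (x xi : 'cV[R]_d) (f g : 'cV[R]_d -> R[i]).
Implicit Types (alpha : 'I_d -> nat) (A : 'M[R]_d).

Let mu := lebesgue_cV R d.

Definition logp (t : R) : R := Num.max 0 (ln t).

Definition basis_cV (j : 'I_d) : 'cV[R]_d := delta_mx j 0.

Definition midx_norm alpha : nat := \sum_j alpha j.

Definition midx_fact alpha : nat := \prod_j (alpha j)`!.

Definition partial (j : 'I_d) (u : 'cV[R]_d -> R) : 'cV[R]_d -> R :=
  'D_(basis_cV j) u.

Definition mpartial alpha (u : 'cV[R]_d -> R) : 'cV[R]_d -> R :=
  foldr (fun j => iter (alpha j) (partial j)) u (enum 'I_d).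

Definition hermite alpha x : R :=
  (-1) ^+ midx_norm alpha * pi `^ (- (d%:R / 4))
  * (2 ^+ midx_norm alpha * (midx_fact alpha)%:R) `^ (- 2^-1)
  * expR (2^-1 * dotv x x)
  * mpartial alpha (fun y => expR (- dotv y y)) x.

Definition skew_hermite A alpha x : R :=
  \det A `^ 4^-1 * hermite alpha (sqrtmx A *m x).

(* Every element of L^2 has a Borel representative. *)
Definition L2 f : Prop :=
  [/\ measurable_fun [set: 'cV[R]_d] (fun x => complex.Re (f x)),
      measurable_fun [set: 'cV[R]_d] (fun x => complex.Im (f x)) &
      (\int[mu]_x ((Normc.normc (f x)) ^+ 2)%:E < +oo)%E].

Definition cintegral f : R[i] :=
  Complex (\int[mu]_x complex.Re (f x)) (\int[mu]_x complex.Im (f x)).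

Definition inner_L2 f g : R[i] := cintegral (fun x => f x * conjc (g x)).

Definition hermite_coef A f alpha : R[i] :=
  inner_L2 f (fun x => (skew_hermite A alpha x)%:C%C).

(* Meaningful for f in L^1: Rintegral has a junk value otherwise. *)
Definition fourier f xi : R[i] :=
  ((2 * pi) `^ (- (d%:R / 2)))%:C%C *
  cintegral (fun x => f x * Complex (cos (dotv x xi)) (- sin (dotv x xi))).

End hermite.

(* Main.v *)
Require Import Defs.
From HB Require Import structures.
From mathcomp Require Import all_boot all_order all_algebra.
From mathcomp Require Import all_classical all_reals all_analysis.
From mathcomp Require Import measurable_realfun complex.
From mathcomp Require Import ring lra.

Set Implicit Arguments.
Unset Strict Implicit.
Unset Printing Implicit Defensive.

Import Order.TTheory GRing.Theory Num.Theory.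
Import numFieldNormedType.Exports.

Local Open Scope classical_set_scope.
Local Open Scope ring_scope.

(** Write [S] for the square root of [A], [y = S *m x] and [N t = lambda * logp t `^ (1 + a)].
  The hypotheses say that [f] at [x] is at most a constant times
  [exp(- y_j ^ 2 / 2 + N |y_j|)], and that the Fourier transform of [f] at [S *m eta]
  satisfies the same bound in terms of [eta_j], for every [j].

  The proof reads the Hermite coefficients off the Bargmann transform
  [F(z) = \int f(x) \prod_i exp(2 y_i z_i - z_i ^ 2 - y_i ^ 2 / 2) dx], [z] in [C^d].
  By the generating function of the Hermite polynomials, the Taylor coefficient of [F] at
  [z ^ alpha] is the Hermite coefficient of index [alpha] times an explicit constant
  ([bargmann_expansion], [hermite_coef_le]), so that Cauchy estimates for [F] on a torus
  [|z_j| = rho], [|z_i| = 1] for [i <> j] are what is needed ([torus_cauchy]).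

  Let [z_j = p + i q]. The modulus of the [j]-th factor of the kernel is
  [exp(- (y_j - p) ^ 2 + q ^ 2 + y_j ^ 2 / 2)], so the decay of [f] controls [F] by
  [exp(q ^ 2)] times a moderate factor. The Fourier transform of the kernel at [z] is,
  up to a constant, the kernel at [i z] ([hgauss_fourier]); hence [F(z)] is also a multiple
  of the same integral for the Fourier transform of [f], taken at [i z]
  ([bargmann_fourier]), and the decay of the Fourier transform controls [F] by
  [exp(p ^ 2)]. To make the moderate factor explicit, [N] is replaced by an affine
  majorant [N(t) <= N(rho) + c t]; as [N] grows slower than every power, [c rho] can be taken
  to be [o(N(rho))] ([log_majorant]). The outcome ([bargmann_growth]) is
  [|F| <= K exp(N(rho) + c (|p| + |q|) + min(p ^ 2, q ^ 2))].

  A Phragmen-Lindelof argument in each quadrant removes [min(p ^ 2, q ^ 2)]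
  ([phragmen_lindelof]): on the sides of the sector [k p <= q], [k q <= p], with [k]
  small, this minimum is the harmonic function [k p q], and a superharmonic barrier of
  order [e p q ln(1 + p ^ 2 + q ^ 2)] takes care of infinity; [e] and [k] then tend to 0.
  The functions involved are locally uniform limits of polynomials, and for these the
  maximum principle follows from the second derivative test alone.

  The Cauchy estimate now says that the coefficient of [z ^ alpha] times [rho ^ alpha_j] is
  at most [K exp((1 + o(1)) N(rho))] ([bargmann_coef_le]). With [s = ln rho], minimising
  [lambda' s ^ (1 + a) - s alpha_j] over [s] produces the power [(1 + a) / a] of [alpha_j]
  with the stated threshold for [r] ([legendre_optimum]). The passage from [lambda] to a
  slightly larger [lambda'], and the normalisation of Hermite functions, which costs at
  most [alpha!], are absorbed by the strict inequality on [r] ([rate_gap],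
  [midx_fact_le]). Finally [j] is chosen to maximise [alpha_j], which is then at least
  [|alpha| / d]. *)

(** * Calculus on the line *)

(* Differentiation rules for functions given by explicit lambda terms, so that the
  derivative of a formula is obtained by composing them along its syntax. *)
Section pointwise_derivatives.
Variable R : realType.
Implicit Types f g : R -> R.

Lemma derC (c x : R) : is_derive x 1 (fun=> c) 0.
Proof. exact: is_derive_cst. Qed.

Lemma derI (x : R) : is_derive x 1 (fun t => t) 1.
Proof. exact: is_derive_id. Qed.

Lemma derD f g (x a b : R) : is_derive x 1 f a -> is_derive x 1 g b ->
  is_derive x 1 (fun t => f t + g t) (a + b).
Proof. exact: is_deriveD. Qed.

Lemma derN f (x a : R) : is_derive x 1 f a -> is_derive x 1 (fun t => - f t) (- a).
Proof. exact: is_deriveN. Qed.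

Lemma derB f g (x a b : R) : is_derive x 1 f a -> is_derive x 1 g b ->
  is_derive x 1 (fun t => f t - g t) (a - b).
Proof. by move=> df dg; apply: derD => //; exact: derN. Qed.

Lemma derM f g (x a b : R) : is_derive x 1 f a -> is_derive x 1 g b ->
  is_derive x 1 (fun t => f t * g t) (f x * b + g x * a).
Proof. exact: is_deriveM. Qed.

Lemma derZ f (c x a : R) : is_derive x 1 f a ->
  is_derive x 1 (fun t => c * f t) (c * a).
Proof. exact: is_deriveZ. Qed.

Lemma derexp f (x a : R) : is_derive x 1 f a ->
  is_derive x 1 (fun t => expR (f t)) (expR (f x) * a).
Proof. exact: is_derive1_comp. Qed.

Lemma dercos f (x a : R) : is_derive x 1 f a ->
  is_derive x 1 (fun t => cos (f t)) (- sin (f x) * a).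
Proof. exact: is_derive1_comp. Qed.

Lemma dersin f (x a : R) : is_derive x 1 f a ->
  is_derive x 1 (fun t => sin (f t)) (cos (f x) * a).
Proof. exact: is_derive1_comp. Qed.

Lemma derln f (x a : R) : 0 < f x -> is_derive x 1 f a ->
  is_derive x 1 (fun t => ln (f t)) ((f x)^-1 * a).
Proof. by move=> f0 df; apply: (@is_derive1_comp _ (@ln R)) => //; exact: is_derive1_ln. Qed.

Lemma derV f (x a : R) : f x != 0 -> is_derive x 1 f a ->
  is_derive x 1 (fun t => (f t)^-1) (- (f x) ^- 2 * a).
Proof. by move=> f0 df; exact: is_deriveV. Qed.

End pointwise_derivatives.

Section second_derivative.
Variable R : realType.

Lemma second_derivative_test (g g1 : R -> R) (t0 g2 dl : R) :
  (forall t : R, is_derive t 1 g (g1 t)) -> is_derive t0 1 g1 g2 -> 0 < dl ->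
  (forall t, t0 - dl < t < t0 + dl -> g t <= g t0) ->
  g1 t0 = 0 /\ g2 <= 0.
Proof.
move=> dg dg1 dl0 gmax.
have g10 : g1 t0 = 0.
  have := @derive1_at_max _ g (t0 - dl) (t0 + dl) t0.
  move=> /(_ _ _ _ _)[].
  - lra.
  - by move=> t _; exact: ex_derive.
  - by rewrite in_itv /=; apply/andP; split; lra.
  - by move=> t; rewrite in_itv /=; exact: gmax.
  - by move=> _ <-; have [_ ->] := dg t0.
split => //.
rewrite leNgt; apply/negP => g2_gt0.
have [dv Dg1] := dg1.
(* if g2 > 0 then g1 > 0 just right of t0, so g increases strictly there *)
have : (fun h : R => h^-1 *: (g1 (h *: 1 + t0) - g1 t0)) @ 0^' --> g2.
  by rewrite -Dg1; exact: dv.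
move=> /cvgrPdist_lt/(_ _ g2_gt0).
rewrite near_withinE => /nbhs_ballP[e /= e0 eP].
pose m := Num.min e dl / 2.
have m0 : 0 < m by rewrite divr_gt0// lt_min e0.
have me : m < e.
  have h : Num.min e dl <= e by rewrite ge_min lexx.
  have : 0 < Num.min e dl by rewrite lt_min e0.
  by rewrite /m; lra.
have mdl : m < dl.
  have h : Num.min e dl <= dl by rewrite ge_min lexx orbT.
  have : 0 < Num.min e dl by rewrite lt_min e0.
  by rewrite /m; lra.
have g1pos t : t0 < t <= t0 + m -> 0 < g1 t.
  move=> /andP[t1 t2]; have := eP (t - t0); rewrite /ball /= sub0r normrN.
  rewrite gtr0_norm ?subr_gt0//.
  have h0 : t - t0 != 0 by rewrite subr_eq0 gt_eqF.
  move=> /(_ _ h0); rewrite g10 subr0.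
  rewrite [X in g1 X](_ : _ = t); last by rewrite /GRing.scale /=; ring.
  move=> /(_ _)/wrap[]; first by lra.
  move=> H; have := le_lt_trans (ler_norm _) H.
  rewrite ltrBlDr ltrDl => H'; move: H'.
  by rewrite /GRing.scale /= pmulr_rgt0// invr_gt0 subr_gt0.
have cg : {within `[t0, t0 + m], continuous g}.
  apply: continuous_subspaceT => x.
  apply: differentiable_continuous; apply/derivable1_diffP; exact: ex_derive.
have [|c cI E] := @MVT _ g g1 t0 (t0 + m) _ (fun x _ => dg x) cg; first by lra.
have := gmax (t0 + m); rewrite leNgt => /(_ _)/negP; apply.
  by apply/andP; split; lra.
rewrite -subr_gt0 E pmulr_lgt0; last by lra.
by apply: g1pos; move: cI; rewrite in_itv /= => /andP[? ?]; apply/andP; split=> //; lra.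
Qed.

End second_derivative.

(** * The Phragmen-Lindelof principle *)

Section subharmonic.
Variable R : realType.
Local Notation C := R[i].
Local Notation Re := (@complex.Re R).
Local Notation Im := (@complex.Im R).
Implicit Types T : {poly C}.

Lemma ReM (a b : C) : Re (a * b) = Re a * Re b - Im a * Im b.
Proof. by case: a b => [? ?] [? ?]. Qed.

Lemma ImM (a b : C) : Im (a * b) = Re a * Im b + Im a * Re b.
Proof. by case: a b => [? ?] [? ?]. Qed.

Lemma ReD (a b : C) : Re (a + b) = Re a + Re b.
Proof. by case: a b => [? ?] [? ?]. Qed.

Lemma ImD (a b : C) : Im (a + b) = Im a + Im b.
Proof. by case: a b => [? ?] [? ?]. Qed.

(** The derivatives of the two components along a horizontal line; together with those
  along a vertical line they contain the Cauchy-Riemann equations. *)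
Lemma is_derive_horner_Re T (x y : R) :
  is_derive x 1 (fun t : R => Re T.[Complex t y]) (Re T^`().[Complex x y]) /\
  is_derive x 1 (fun t : R => Im T.[Complex t y]) (Im T^`().[Complex x y]).
Proof.
elim/poly_ind: T => [|T c [IH1 IH2]].
  rewrite deriv0 horner0.
  split.
    rewrite (_ : (fun _ => _) = cst 0); first exact: is_derive_cst.
    by apply/funext => t; rewrite horner0.
  rewrite (_ : (fun _ => _) = cst 0); first exact: is_derive_cst.
  by apply/funext => t; rewrite horner0.
rewrite derivD derivM derivX derivC mulr1 addr0.
split; apply: is_derive_eq.
- rewrite (_ : (fun t => _) = fun t => Re T.[Complex t y] * t
      - Im T.[Complex t y] * y + Re c); last first.
    by apply/funext => t; rewrite !(hornerD, hornerM, hornerX, hornerC) ReD ReM.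
  exact: (derD (derB (derM IH1 (derI x)) (derM IH2 (derC y x))) (derC (Re c) x)).
- rewrite !(hornerD, hornerM, hornerX) !ReD !ReM /=.
  by move: (Re T.[_]) (Im T.[_]) (Re T^`().[_]) (Im T^`().[_]) => a1 a2 a3 a4; ring.
- rewrite (_ : (fun t => _) = fun t => Re T.[Complex t y] * y
      + Im T.[Complex t y] * t + Im c); last first.
    by apply/funext => t; rewrite !(hornerD, hornerM, hornerX, hornerC) ImD ImM.
  exact: (derD (derD (derM IH1 (derC y x)) (derM IH2 (derI x))) (derC (Im c) x)).
- rewrite !(hornerD, hornerM, hornerX) !ImD !ImM /=.
  by move: (Re T.[_]) (Im T.[_]) (Re T^`().[_]) (Im T^`().[_]) => a1 a2 a3 a4; ring.
Qed.

Lemma is_derive_horner_Im T (x y : R) :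
  is_derive y 1 (fun t : R => Re T.[Complex x t]) (- Im T^`().[Complex x y]) /\
  is_derive y 1 (fun t : R => Im T.[Complex x t]) (Re T^`().[Complex x y]).
Proof.
elim/poly_ind: T => [|T c [IH1 IH2]].
  rewrite deriv0 horner0 /= oppr0.
  split.
    rewrite (_ : (fun _ => _) = cst 0); first exact: is_derive_cst.
    by apply/funext => t; rewrite horner0.
  rewrite (_ : (fun _ => _) = cst 0); first exact: is_derive_cst.
  by apply/funext => t; rewrite horner0.
rewrite derivD derivM derivX derivC mulr1 addr0.
split; apply: is_derive_eq.
- rewrite (_ : (fun t => _) = fun t => Re T.[Complex x t] * x
      - Im T.[Complex x t] * t + Re c); last first.
    by apply/funext => t; rewrite !(hornerD, hornerM, hornerX, hornerC) ReD ReM.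
  exact: (derD (derB (derM IH1 (derC x y)) (derM IH2 (derI y))) (derC (Re c) y)).
- rewrite !(hornerD, hornerM, hornerX) !ImD !ImM /=.
  by move: (Re T.[_]) (Im T.[_]) (Re T^`().[_]) (Im T^`().[_]) => a1 a2 a3 a4; ring.
- rewrite (_ : (fun t => _) = fun t => Re T.[Complex x t] * t
      + Im T.[Complex x t] * x + Im c); last first.
    by apply/funext => t; rewrite !(hornerD, hornerM, hornerX, hornerC) ImD ImM.
  exact: (derD (derD (derM IH1 (derI y)) (derM IH2 (derC x y))) (derC (Im c) y)).
- rewrite !(hornerD, hornerM, hornerX) !ReD !ReM /=.
  by move: (Re T.[_]) (Im T.[_]) (Re T^`().[_]) (Im T^`().[_]) => a1 a2 a3 a4; ring.
Qed.

(** The conditions of order one and two at a maximum of [|T| ^ 2 exp(- 2 u)] along a line,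
  where [p] and [q] are the components of [T], up to positive factors. *)
Lemma weighted_max (p q p1 q1 u u1 : R -> R) (t0 p2 q2 u2 dl : R) :
  (forall t : R, is_derive t 1 p (p1 t)) -> (forall t : R, is_derive t 1 q (q1 t)) ->
  (forall t : R, is_derive t 1 u (u1 t)) ->
  is_derive t0 1 p1 p2 -> is_derive t0 1 q1 q2 -> is_derive t0 1 u1 u2 ->
  0 < dl ->
  (forall t, t0 - dl < t < t0 + dl ->
    (p t ^+ 2 + q t ^+ 2) * expR (- (2 * u t))
      <= (p t0 ^+ 2 + q t0 ^+ 2) * expR (- (2 * u t0))) ->
  let m := p t0 ^+ 2 + q t0 ^+ 2 in
  p t0 * p1 t0 + q t0 * q1 t0 = m * u1 t0 /\
  p1 t0 ^+ 2 + q1 t0 ^+ 2 + p t0 * p2 + q t0 * q2 - 2 * m * u1 t0 ^+ 2 <= m * u2.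
Proof.
move=> dp dq du dp1 dq1 du1 dl0 gmax m.
pose m1 t := 2 * (p t * p1 t + q t * q1 t) - 2 * (p t ^+ 2 + q t ^+ 2) * u1 t.
have dE (t : R) := derexp (derN (derZ 2 (du t))).
pose g1 t := m1 t * expR (- (2 * u t)).
have dg (t : R) : is_derive t 1 (fun t => (p t ^+ 2 + q t ^+ 2) * expR (- (2 * u t))) (g1 t).
  apply: (is_derive_eq (derM (derD (derM (dp t) (dp t)) (derM (dq t) (dq t))) (dE t))).
  by rewrite /g1 /m1; ring.
pose g2 := (2 * (p1 t0 * p1 t0 + p t0 * p2 + q1 t0 * q1 t0 + q t0 * q2)
  - 2 * (2 * (p t0 * p1 t0 + q t0 * q1 t0)) * u1 t0
  - 2 * (p t0 ^+ 2 + q t0 ^+ 2) * u2) * expR (- (2 * u t0))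
  + m1 t0 * (- 2 * u1 t0 * expR (- (2 * u t0))).
have dg1 : is_derive t0 1 g1 g2.
  apply: (is_derive_eq
    (derM (derB (derZ 2 (derD (derM (dp t0) dp1) (derM (dq t0) dq1)))
      (derM (derZ 2 (derD (derM (dp t0) (dp t0)) (derM (dq t0) (dq t0)))) du1)) (dE t0))).
  by rewrite /g2 /m1; ring.
have [g10 g20] := second_derivative_test dg dg1 dl0 gmax.
have m10 : m1 t0 = 0.
  by move/eqP: g10; rewrite mulf_eq0 [X in _ || X]gt_eqF ?expR_gt0// orbF => /eqP.
have e : p t0 * p1 t0 + q t0 * q1 t0 = m * u1 t0.
  by move: m10; rewrite /m1 /m => h; lra.
split => //.
move: g20; rewrite /g2 m10 mul0r addr0 pmulr_lle0 ?expR_gt0// e -/m => h.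
rewrite -subr_ge0; rewrite -oppr_le0 in h *.
rewrite !expr2; nra.
Qed.

(** Where [T] does not vanish [ln |T|] is harmonic, so [ln |T| - u] has positive Laplacian
  and no local maximum. Adding the second order conditions in the two directions gives
  this without logarithms: by the Cauchy-Riemann equations the terms with [T''] cancel, and
  those with [T'] cancel against the gradient of [u]. *)
Lemma weighted_interior_max T (u ux uy : R -> R -> R) (x y uxx uyy dl : R) :
  (forall s t : R, is_derive s 1 (fun s => u s t) (ux s t)) ->
  (forall s t : R, is_derive t 1 (fun t => u s t) (uy s t)) ->
  is_derive x 1 (fun s => ux s y) uxx -> is_derive y 1 (fun t => uy x t) uyy ->
  uxx + uyy < 0 -> 0 < dl ->
  (let g s t := (Re T.[Complex s t] ^+ 2 + Im T.[Complex s t] ^+ 2)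
       * expR (- (2 * u s t)) in
   forall s t, x - dl < s < x + dl -> y - dl < t < y + dl -> g s t <= g x y) ->
  T.[Complex x y] = 0.
Proof.
move=> dux duy duxx duyy lap dl0 /= gmax.
have hx := is_derive_horner_Re; have hy := is_derive_horner_Im.
have [ex Hx] := @weighted_max
  (fun s => Re T.[Complex s y]) (fun s => Im T.[Complex s y])
  (fun s => Re T^`().[Complex s y]) (fun s => Im T^`().[Complex s y])
  (fun s => u s y) (fun s => ux s y) x _ _ _ dl
  (fun t => (hx T t y).1) (fun t => (hx T t y).2) (fun s => dux s y)
  (hx T^`() x y).1 (hx T^`() x y).2 duxx dl0
  (fun s hs => gmax s y hs ltac:(by apply/andP; split; lra)).
have dN : is_derive y 1 (fun t => - Im T^`().[Complex x t]) (- Re T^`()^`().[Complex x y]).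
  have := (hy T^`() x y).2; exact: is_deriveN.
have [ey Hy] := @weighted_max
  (fun t => Re T.[Complex x t]) (fun t => Im T.[Complex x t])
  (fun t => - Im T^`().[Complex x t]) (fun t => Re T^`().[Complex x t])
  (fun t => u x t) (fun t => uy x t) y _ _ _ dl
  (fun t => (hy T x t).1) (fun t => (hy T x t).2) (fun t => duy x t)
  dN (hy T^`() x y).1 duyy dl0
  (fun t ht => gmax x t ltac:(by apply/andP; split; lra) ht).
have m0 : Re T.[Complex x y] ^+ 2 + Im T.[Complex x y] ^+ 2 = 0.
  move: ex Hx ey Hy.
  set p := Re T.[_]; set q := Im T.[_].
  set p1 := Re _.[_]; set q1 := Im _.[_]; set p2 := Re _.[_]; set q2 := Im _.[_].
  set a := ux x y; set b := uy x y.
  move=> ex Hx ey Hy.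
  have mge0 : 0 <= p ^+ 2 + q ^+ 2 by rewrite addr_ge0// sqr_ge0.
  apply/eqP; rewrite eq_le mge0 andbT leNgt; apply/negP => mgt0.
  (* |grad u|^2 m^2 = m |T'|^2 by the Cauchy-Riemann equations *)
  have key : (p ^+ 2 + q ^+ 2) * (a ^+ 2 + b ^+ 2) = p1 ^+ 2 + q1 ^+ 2.
    apply: (mulfI (lt0r_neq0 mgt0)).
    transitivity (((p ^+ 2 + q ^+ 2) * a) ^+ 2 + ((p ^+ 2 + q ^+ 2) * b) ^+ 2); first by ring.
    by rewrite -ex -ey; ring.
  have : 0 <= (p ^+ 2 + q ^+ 2) * (uxx + uyy).
    apply: le_trans (_ : 2 * (p1 ^+ 2 + q1 ^+ 2) -
      2 * ((p ^+ 2 + q ^+ 2) * (a ^+ 2 + b ^+ 2)) <= _); first by rewrite key subrr.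
    rewrite [X in _ <= X]mulrDr; apply: le_trans (lerD Hx Hy).
    by rewrite le_eqVlt; apply/orP; left; apply/eqP; ring.
  by rewrite pmulr_rge0// leNgt lap.
move/eqP: m0; rewrite paddr_eq0 ?sqr_ge0// !sqrf_eq0 => /andP[/eqP a /eqP b].
by case: (T.[_]) a b => a b /= -> ->.
Qed.

End subharmonic.

Section phragmen_lindelof.
Variable R : realType.
Local Notation C := R[i].
Local Notation Re := (@complex.Re R).
Local Notation Im := (@complex.Im R).
Local Notation nc := (@Normc.normc R).
Implicit Types T : {poly C}.

Lemma nc_ge0 (z : C) : 0 <= nc z.
Proof. by case: z => a b; exact: sqrtr_ge0. Qed.

Lemma sqr_nc (z : C) : nc z ^+ 2 = Re z ^+ 2 + Im z ^+ 2.
Proof. by case: z => a b /=; rewrite sqr_sqrtr// addr_ge0// sqr_ge0. Qed.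

Lemma horner_continuous T :
  continuous (fun p : R * R => Re T.[Complex p.1 p.2]) /\
  continuous (fun p : R * R => Im T.[Complex p.1 p.2]).
Proof.
elim/poly_ind: T => [|T c [IH1 IH2]].
  by split; under eq_fun do rewrite horner0; exact: cst_continuous.
split => p.
- under eq_fun do rewrite hornerMXaddC ReD ReM /=.
  apply: cvgD; last exact: cvg_cst.
  apply: cvgB; apply: cvgM; [exact: IH1|exact: cvg_fst|exact: IH2|exact: cvg_snd].
- under eq_fun do rewrite hornerMXaddC ImD ImM /=.
  apply: cvgD; last exact: cvg_cst.
  apply: cvgD; apply: cvgM; [exact: IH1|exact: cvg_snd|exact: IH2|exact: cvg_fst].
Qed.

(** The product [x y] is harmonic, and the logarithm makes the barrier grow faster than
  [x ^+ 2 + y ^+ 2] on every sector [k x <= y], [k y <= x]; the last term makes it strictly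
  superharmonic. *)
Definition barrier (x y : R) : R :=
  x * y * ln (1 + (x * x + y * y)) - 2 * (x * x + y * y).

Definition majorant (c k e x y : R) : R :=
  c * (x + y) + k * (x * y) + e * barrier x y.

(** Only derivatives in [x] are computed: [majorantC] gives those in [y]. *)
Definition majorant' (c k e x y : R) : R :=
  c + k * y + e * (y * ln (1 + (x * x + y * y))
    + x * y * ((1 + (x * x + y * y))^-1 * (x + x)) - 2 * (x + x)).

Lemma majorantC c k e x y : majorant c k e x y = majorant c k e y x.
Proof. by rewrite /majorant /barrier [y * y + _]addrC [y * x]mulrC [y + x]addrC. Qed.

Lemma quad_gt0 (x y : R) : 0 < 1 + (x * x + y * y).
Proof. by rewrite ltr_pwDl// addr_ge0// -expr2 sqr_ge0. Qed.

Lemma is_derive_majorant c k e (x y : R) :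
  is_derive x 1 (fun t => majorant c k e t y) (majorant' c k e x y).
Proof.
have dq := derD (derC 1 x) (derD (derM (derI x) (derI x)) (derC (y * y) x)).
have dln := @derln _ (fun t => 1 + (t * t + y * y)) x _ (quad_gt0 x y) dq.
apply: (is_derive_eq (derD (derD (derZ c (derD (derI x) (derC y x)))
  (derZ k (derM (derI x) (derC y x))))
  (derZ e (derB (derM (derM (derI x) (derC y x)) dln)
   (derZ 2 (derD (derM (derI x) (derI x)) (derC (y * y) x))))))).
by rewrite /majorant'; ring.
Qed.

Definition majorant'' (e x y : R) : R :=
  e * (x * y * (6 / (1 + (x * x + y * y)) - 4 * x ^+ 2 / (1 + (x * x + y * y)) ^+ 2) - 4).

Lemma is_derive2_majorant c k e (x y : R) :
  is_derive x 1 (fun t => majorant' c k e t y) (majorant'' e x y).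
Proof.
have dq := derD (derC 1 x) (derD (derM (derI x) (derI x)) (derC (y * y) x)).
have dln := @derln _ (fun t => 1 + (t * t + y * y)) x _ (quad_gt0 x y) dq.
have dV := @derV _ (fun t => 1 + (t * t + y * y)) x _ (lt0r_neq0 (quad_gt0 x y)) dq.
have d2 := derD (derI x) (derI x).
apply: (is_derive_eq (derD (derC (c + k * y) x)
  (derZ e (derB (derD (derM (derC y x) dln)
   (derM (derM (derI x) (derC y x)) (derM dV d2))) (derZ 2 d2))))).
rewrite /majorant''; field; exact: lt0r_neq0 (quad_gt0 x y).
Qed.

Lemma laplacian_majorant e x y : 0 < e ->
  majorant'' e x y + majorant'' e y x < 0.
Proof.
move=> e0; rewrite /majorant'' -mulrDr pmulr_rlt0// [y * y + _]addrC [y * x]mulrC.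
have q0 := quad_gt0 x y; set q := 1 + _ in q0 *.
rewrite (_ : _ + _ = - 8 + x * y * (8 + 4 / q) / q); last first.
  have -> : x ^+ 2 = q - 1 - y ^+ 2 by rewrite /q; ring.
  by field; exact: lt0r_neq0.
have iq : q^-1 <= 1 by rewrite invf_le1// /q lerDl addr_ge0// -expr2 sqr_ge0.
have iq0 : 0 < q^-1 by rewrite invr_gt0.
have xy : 2 * (x * y) < q.
  have := sqr_ge0 (x - y); rewrite /q sqrrB !expr2 -mulr_natl; nra.
have : x * y / q < 1 / 2 by rewrite ltr_pdivrMr//; lra.
set s := x * y / q => s1.
rewrite (_ : _ * _ / q = s * (8 + 4 / q)); last by rewrite /s; field; exact: lt0r_neq0.
by set v := q^-1 in iq iq0 *; nra.
Qed.

Lemma sector_ge0 (k x y : R) : 0 < k -> k < 1 -> k * x <= y -> k * y <= x -> 0 <= x.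
Proof.
move=> k0 k1 h1 h2; rewrite -(@pmulr_rge0 _ (1 - k * k)); last by nra.
rewrite (_ : _ * x = (x - k * y) + k * (y - k * x)); last by ring.
by rewrite addr_ge0 ?mulr_ge0 ?subr_ge0// ltW.
Qed.

(** Maximum principle on the triangle [k x <= y], [k y <= x], [x + y <= rho]: a maximum of
  [|T| exp(- majorant)] in the interior would have to be a zero of [T], because the
  majorant is strictly superharmonic. *)
Lemma max_triangle T (c k e rho M : R) : 0 < k -> k < 1 -> 0 < e -> 0 < rho ->
  (forall x y, k * x <= y -> k * y <= x -> x + y <= rho ->
     [\/ k * x = y, k * y = x | x + y = rho] ->
     nc T.[Complex x y] <= M * expR (majorant c k e x y)) ->
  forall x y, k * x <= y -> k * y <= x -> x + y <= rho ->
    nc T.[Complex x y] <= M * expR (majorant c k e x y).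
Proof.
move=> k0 k1 e0 rho0 bd.
pose D : set (R * R) := [set p | 0 <= p.2 - k * p.1] `&` [set p | 0 <= p.1 - k * p.2]
  `&` [set p | 0 <= rho - (p.1 + p.2)].
have cZ' (b : R) (h : R * R -> R) : continuous h -> continuous (fun p => b * h p).
  by move=> ch p; apply: cvgM; [exact: cvg_cst|exact: ch].
have cZ := cZ' k.
have c1 : continuous (fun p : R * R => p.1) by move=> p; exact: cvg_fst.
have c2 : continuous (fun p : R * R => p.2) by move=> p; exact: cvg_snd.
have clos (h : R * R -> R) : continuous h -> closed [set p | 0 <= h p].
  move=> ch; rewrite (_ : [set p | _] = h @^-1` [set y | 0 <= y]) //.
  by apply: preimage_closed => [p _|]; [exact: ch|exact: closed_ge].
have cD : compact D.
  apply: (@subclosed_compact _ _ (`[0, rho] `*` `[0, rho])).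
  - apply: closedI; [apply: closedI|]; apply: clos => p.
    + by apply: cvgB; [exact: c2|exact: cZ].
    + by apply: cvgB; [exact: c1|exact: cZ].
    + by apply: cvgB; [exact: cvg_cst|apply: cvgD; [exact: c1|exact: c2]].
  - by apply: compact_setX; exact: segment_compact.
  - move=> [x y] [[/= h1 h2] h3].
    have x0 : 0 <= x by apply: (@sector_ge0 k x y) => //; lra.
    have y0 : 0 <= y by apply: (@sector_ge0 k y x) => //; lra.
    by split; rewrite /= in_itv /=; apply/andP; split; lra.
pose Phi (p : R * R) := (Re T.[Complex p.1 p.2] * Re T.[Complex p.1 p.2]
  + Im T.[Complex p.1 p.2] * Im T.[Complex p.1 p.2])
  * expR (- (2 * majorant c k e p.1 p.2)).
have cA (g h : R * R -> R) : continuous g -> continuous h -> continuous (fun p => g p + h p).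
  by move=> cg ch p; apply: cvgD; [exact: cg|exact: ch].
have cM (g h : R * R -> R) : continuous g -> continuous h -> continuous (fun p => g p * h p).
  by move=> cg ch p; apply: cvgM; [exact: cg|exact: ch].
have cN (h : R * R -> R) : continuous h -> continuous (fun p => - h p).
  by move=> ch p; apply: cvgN; exact: ch.
have cexp (h : R * R -> R) : continuous h -> continuous (fun p => expR (h p)).
  by move=> ch p; apply: (continuous_comp (ch p)); exact: continuous_expR.
have cq : continuous (fun p : R * R => p.1 * p.1 + p.2 * p.2) by apply: cA; exact: cM.
have cln : continuous (fun p : R * R => ln (1 + (p.1 * p.1 + p.2 * p.2))).
  have c0 : continuous (fun _ : R * R => 1 : R) by move=> p; exact: cvg_cst.
  move=> p; have c1q := cA _ _ c0 cq.
  by apply: (continuous_comp (c1q p)); exact/continuous_ln/quad_gt0.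
have cPhi : continuous Phi.
  have [cR cI] := horner_continuous T.
  have cxy := cM _ _ c1 c2.
  have cbar := cA _ _ (cM _ _ cxy cln) (cN _ (cZ' 2 _ cq)).
  have cmaj := cA _ _ (cA _ _ (cZ' c _ (cA _ _ c1 c2)) (cZ' k _ cxy)) (cZ' e _ cbar).
  exact: (cM _ _ (cA _ _ (cM _ _ cR cR) (cM _ _ cI cI)) (cexp _ (cN _ (cZ' 2 _ cmaj)))).
have [|[x0 y0] /set_mem [[/= D1 D2] D3] Phimax] := @compact_EVT_max _ _ Phi D _ cD (continuous_subspaceT cPhi).
  by exists (0, 0); rewrite /D /=; split; [split|] => /=; lra.
have toD x y : k * x <= y -> k * y <= x -> x + y <= rho -> (x, y) \in D.
  by move=> h1 h2 h3; rewrite inE; split; [split|] => /=; lra.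
have M0 : 0 <= M.
  have := bd 0 0; rewrite !mulr0 addr0 => /(_ _ _ _ _)/wrap[]//; first exact: ltW.
    by constructor 1.
  by move=> h; rewrite -(pmulr_lge0 _ (expR_gt0 (majorant c k e 0 0))) (le_trans _ h)// nc_ge0.
have PhiE x y : Phi (x, y) = (nc T.[Complex x y] * expR (- majorant c k e x y)) ^+ 2.
  by rewrite exprMn sqr_nc -expRM_natl mulrN.
have PhiM x y : Phi (x, y) <= M ^+ 2 ->
    nc T.[Complex x y] <= M * expR (majorant c k e x y).
  rewrite PhiE ler_sqr ?nnegrE ?mulr_ge0 ?nc_ge0 ?expR_ge0//.
  by rewrite expRN ler_pdivrMr ?expR_gt0.
suff maxM : Phi (x0, y0) <= M ^+ 2.
  by move=> x y h1 h2 h3; apply: PhiM; apply: le_trans maxM; apply: Phimax; exact: toD.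
have bdM : [\/ k * x0 = y0, k * y0 = x0 | x0 + y0 = rho] -> Phi (x0, y0) <= M ^+ 2.
  move=> b; rewrite PhiE ler_sqr ?nnegrE ?mulr_ge0 ?nc_ge0 ?expR_ge0//.
  rewrite expRN ler_pdivrMr ?expR_gt0//; apply: bd => //; lra.
have [e1|n1] := eqVneq (k * x0) y0; first by apply: bdM; constructor 1.
have [e2|n2] := eqVneq (k * y0) x0; first by apply: bdM; constructor 2.
have [e3|n3] := eqVneq (x0 + y0) rho; first by apply: bdM; constructor 3.
have l1 : k * x0 < y0 by rewrite lt_neqAle n1 /=; lra.
have l2 : k * y0 < x0 by rewrite lt_neqAle n2 /=; lra.
have l3 : x0 + y0 < rho by rewrite lt_neqAle n3 /=; lra.
pose dl := Num.min (y0 - k * x0) (Num.min (x0 - k * y0) (rho - (x0 + y0))) / 2.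
have dlP : [/\ 0 < dl, 2 * dl <= y0 - k * x0, 2 * dl <= x0 - k * y0 & 2 * dl <= rho - (x0 + y0)].
  have h : 2 * dl = Num.min (y0 - k * x0) (Num.min (x0 - k * y0) (rho - (x0 + y0))).
    by rewrite /dl; field.
  split.
  - by rewrite divr_gt0// !lt_min !subr_gt0 l1 l2 l3.
  - by rewrite h ge_min lexx.
  - by rewrite h !ge_min lexx orbT.
  - by rewrite h !ge_min lexx !orbT.
case: dlP => dl0 d1 d2 d3.
have T0 : T.[Complex x0 y0] = 0.
  have gm (s t : R) : x0 - dl < s < x0 + dl -> y0 - dl < t < y0 + dl ->
      Phi (s, t) <= Phi (x0, y0).
    move=> /andP[s1 s2] /andP[t1 t2]; apply: (Phimax (s, t)).
    have kd : k * dl <= dl by rewrite ger_pMl// ltW.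
    have ks : k * s <= k * (x0 + dl) by rewrite ler_wpM2l// ltW.
    have kt : k * t <= k * (y0 + dl) by rewrite ler_wpM2l// ltW.
    by apply: toD; clear - s1 s2 t1 t2 kd ks kt d1 d2 d3 dl0; lra.
  have dy (s t : R) : is_derive t 1 (fun t => majorant c k e s t) (majorant' c k e t s).
    by under eq_fun do rewrite majorantC; exact: is_derive_majorant.
  have lap := laplacian_majorant x0 y0 e0.
  exact: (weighted_interior_max (fun s t => is_derive_majorant c k e s t) dy
    (is_derive2_majorant c k e x0 y0) (is_derive2_majorant c k e y0 x0) lap dl0 gm).
by rewrite PhiE T0 Normc.normc0 mul0r expr0n /= sqr_ge0.
Qed.

(** Entire functions, as locally uniform limits of polynomials: the form in which
  holomorphy enters the maximum principle. *)
Definition poly_approximable (F : C -> C) := forall rho eta : R, 0 < eta ->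
  exists T : {poly C}, forall z, nc z <= rho -> nc (F z - T.[z]) <= eta.

(** The lower bound [- m] on the majorant is what lets a uniform error [eta] be absorbed as
  a small multiple of the right-hand side. *)
Lemma poly_approximable_max (F : C -> C) (c k e rho M m : R) :
  poly_approximable F -> 0 < k -> k < 1 -> 0 < e -> 0 < rho ->
  (forall x y, 0 <= x -> 0 <= y -> k * x <= y -> k * y <= x ->
     - m <= majorant c k e x y) ->
  (forall x y, k * x <= y -> k * y <= x -> x + y <= rho ->
     [\/ k * x = y, k * y = x | x + y = rho] ->
     nc (F (Complex x y)) <= M * expR (majorant c k e x y)) ->
  forall x y, k * x <= y -> k * y <= x -> x + y <= rho ->
    nc (F (Complex x y)) <= M * expR (majorant c k e x y).
Proof.
move=> aF k0 k1 e0 rho0 mlb bd x y h1 h2 h3.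
have ge0 a b : k * a <= b -> k * b <= a -> 0 <= a /\ 0 <= b.
  by move=> ab ba; split; [exact: (sector_ge0 k0 k1 ab ba)|exact: (sector_ge0 k0 k1 ba ab)].
set E := expR (majorant c k e x y).
apply/ler_addgt0Pr => eps eps0.
pose eta := eps / (expR m * E + 1).
have den0 : 0 < expR m * E + 1 by rewrite ltr_wpDl// mulr_ge0// expR_ge0.
have eta0 : 0 < eta by rewrite divr_gt0.
have [T TP] := aF rho eta eta0.
have inD a b : k * a <= b -> k * b <= a -> a + b <= rho ->
    nc (F (Complex a b) - T.[Complex a b]) <= eta.
  move=> ab ba abr; apply: TP.
  have [a0 b0] := ge0 _ _ ab ba.
  rewrite /= -(ger0_norm (ltW rho0)) -sqrtr_sqr ler_wsqrtr// !expr2; nra.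
have dist (z w : C) : nc w <= nc z + nc (z - w).
  by rewrite -[in leLHS](subKr z w) -(normcN (z - w)) le_normcD.
have bdT : nc T.[Complex x y] <= (M + eta * expR m) * E.
  apply: (max_triangle (T := T) (rho := rho)) => // a b ab ba abr b3.
  apply: le_trans (dist (F (Complex a b)) _) _.
  rewrite mulrDl lerD//; first exact: bd.
  apply: le_trans (inD _ _ ab ba abr) _.
  rewrite -mulrA -expRD ler_peMr ?(ltW eta0)// -expR0 ler_expR.
  have [a0 b0] := ge0 _ _ ab ba; have := mlb _ _ a0 b0 ab ba; lra.
have := le_normcD (F (Complex x y) - T.[Complex x y]) T.[Complex x y].
rewrite subrK => /le_trans; apply.
apply: le_trans (lerD (inD _ _ h1 h2 h3) bdT) _.
have -> : eps = eta * (expR m * E + 1) by rewrite /eta divfK// gt_eqF.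
by rewrite le_eqVlt; apply/orP; left; apply/eqP; ring.
Qed.

Lemma le_mul_expR_lim (a b m dl : R) : 0 < dl -> 0 <= b ->
  (forall e, 0 < e < dl -> a <= b * expR (e * m)) -> a <= b.
Proof.
move=> dl0 b0 h; have [m0|m0] := leP m 0.
  apply: le_trans (h (dl / 2) _) _; first by apply/andP; split; lra.
  by rewrite ler_piMr// -[leRHS]expR0 ler_expR pmulr_rle0//; lra.
rewrite leNgt; apply/negP => ba.
have [b00|bn0] := eqVneq b 0.
  by have := h (dl / 2); rewrite b00 mul0r leNgt -[in X in X < a]b00 ba => /(_ ltac:(apply/andP; split; lra)).
have b1 : 0 < b by rewrite lt0r bn0.
have l0 : 0 < ln (a / b) by rewrite ln_gt0// ltr_pdivlMr// mul1r.
pose e := Num.min dl (ln (a / b) / m) / 2.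
have e0 : 0 < Num.min dl (ln (a / b) / m) by rewrite lt_min dl0 divr_gt0.
have e1 : Num.min dl (ln (a / b) / m) <= dl by rewrite ge_min lexx.
have e2 : Num.min dl (ln (a / b) / m) <= ln (a / b) / m by rewrite ge_min lexx orbT.
have := h e; rewrite leNgt => /(_ _)/negP; apply.
  by rewrite /e; apply/andP; split; lra.
have : expR (e * m) < a / b.
  rewrite -[ltRHS]lnK ?posrE ?divr_gt0// ?(lt_trans b1)// ltr_expR -ltr_pdivlMr//.
  by rewrite /e; lra.
by rewrite ltr_pdivlMr// mulrC.
Qed.

(** For a given point, [k] is small enough for the sector [k x <= y], [k y <= x] to contain
  it. On the two rays bounding the sector [min (x ^+ 2) (y ^+ 2) = k * (x * y)], and on
  the third side of a large triangle the barrier dominates. First the weight [e] of the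
  barrier and then [k] tend to 0. *)
Lemma phragmen_lindelof_quadrant (F : C -> C) (c M : R) :
  poly_approximable F -> 0 <= c -> 0 <= M ->
  (forall x y : R, 0 <= x -> 0 <= y ->
    nc (F (Complex x y)) <= M * expR (c * (x + y) + x ^+ 2) /\
    nc (F (Complex x y)) <= M * expR (c * (x + y) + y ^+ 2)) ->
  forall x y : R, 0 < x -> 0 < y -> nc (F (Complex x y)) <= M * expR (c * (x + y)).
Proof.
move=> aF c0 M0 bd x y x0 y0.
pose dl := Num.min (Num.min (x / y) (y / x)) (1 / 2).
have dl0 : 0 < dl by rewrite !lt_min !divr_gt0.
apply: (@le_mul_expR_lim _ _ (x * y) dl dl0); first by rewrite mulr_ge0// expR_ge0.
move=> k /andP[k0]; rewrite !lt_min -andbA => /and3P[kxy kyx kh].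
have k1 : k < 1 by lra.
have ky : k * y <= x by rewrite -ler_pdivlMr// ltW.
have kx : k * x <= y by rewrite -ler_pdivlMr// ltW.
pose m := 2 * expR (4 / k).
have rxy (a b : R) : k * a <= b -> k * b <= a -> 0 <= a -> 0 <= b ->
    k / 2 * (a * a + b * b) <= a * b.
  move=> h1 h2 a0 b0; nra.
have lnq (a b : R) : 0 <= ln (1 + (a * a + b * b)).
  by rewrite ln_ge0// lerDl addr_ge0// -expr2 sqr_ge0.
have barE (a b : R) : k * a <= b -> k * b <= a -> 0 <= a -> 0 <= b ->
    (a * a + b * b) * (k / 2 * ln (1 + (a * a + b * b)) - 2) <= barrier a b.
  move=> h1 h2 a0 b0; have := rxy _ _ h1 h2 a0 b0; have := lnq a b; rewrite /barrier.
  set l := ln _; set q := a * a + b * b => l0 hq.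
  rewrite mulrBr mulrA [q * (k / 2)]mulrC [q * 2]mulrC lerD2r.
  exact: ler_wpM2r.
have barm (a b : R) : 0 <= a -> 0 <= b -> k * a <= b -> k * b <= a -> - m <= barrier a b.
  move=> a0 b0 h1 h2; apply: le_trans (barE _ _ h1 h2 a0 b0).
  have q0 : 0 <= a * a + b * b by rewrite addr_ge0// -expr2 sqr_ge0.
  have [l4|l4] := leP (4 / k) (ln (1 + (a * a + b * b))).
    apply: (@le_trans _ _ 0); first by rewrite oppr_le0 mulr_ge0// expR_ge0.
    apply: mulr_ge0 => //; move: l4; rewrite ler_pdivrMr//; lra.
  have : a * a + b * b <= expR (4 / k).
    have : 1 + (a * a + b * b) < expR (4 / k).
      by rewrite -[ltLHS]lnK ?posrE ?quad_gt0// ltr_expR.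
    lra.
  have := mulr_ge0 (ltW k0) (lnq a b); rewrite /m; set l := ln _ => kl hq.
  have : 0 <= (a * a + b * b) * (k / 2 * l) by rewrite mulr_ge0//; lra.
  rewrite mulrBr; lra.
have m0 : 0 <= m by rewrite mulr_ge0// expR_ge0.
apply: (@le_mul_expR_lim _ _ (barrier x y + m) 1) => //.
  by rewrite mulr_ge0 ?mulr_ge0 ?expR_ge0.
move=> e /andP[e0 _].
pose rho := Num.max (x + y) (2 * expR ((2 + 1 / e) * 2 / k)).
have rho0 : 0 < rho by rewrite lt_max addr_gt0.
have H := @poly_approximable_max F c k e rho (M * expR (e * m)) (e * m) aF k0 k1 e0 rho0.
have -> : M * expR (c * (x + y)) * expR (k * (x * y)) * expR (e * (barrier x y + m))
    = M * expR (e * m) * expR (majorant c k e x y).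
  rewrite -!mulrA -!expRD /majorant; congr (_ * expR _); ring.
apply: H => //; last by rewrite le_max lexx.
- move=> a b a0 b0 h1 h2; rewrite /majorant -mulrN.
  apply: (@le_trans _ _ (e * barrier a b)); first by rewrite ler_pM2l// barm.
  by rewrite lerDr addr_ge0// mulr_ge0// ?addr_ge0 ?mulr_ge0// ltW.
move=> a b h1 h2 h3 h4.
have a0 := sector_ge0 k0 k1 h1 h2; have b0 := sector_ge0 k0 k1 h2 h1.
have [B1 B2] := bd a b a0 b0.
have bm := barm a b a0 b0 h1 h2.
have em : 0 <= e * (barrier a b + m) by rewrite mulr_ge0 ?(ltW e0)//; lra.
rewrite -mulrA -expRD /majorant.
case: h4 => h4.
- have e2 : b ^+ 2 = k * (a * b) by rewrite mulrA h4 expr2.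
  by apply: (le_trans B2); rewrite ler_wpM2l// ler_expR e2; move: em; rewrite mulrDr; lra.
- have e2 : a ^+ 2 = k * (a * b) by rewrite mulrCA h4 expr2.
  by apply: (le_trans B1); rewrite ler_wpM2l// ler_expR e2; move: em; rewrite mulrDr; lra.
have q0 : 0 <= a * a + b * b by rewrite addr_ge0// -expr2 sqr_ge0.
have lq : (2 + 1 / e) * 2 / k <= ln (1 + (a * a + b * b)).
  rewrite -ler_expR lnK ?posrE ?quad_gt0//.
  have r1 : 2 * expR ((2 + 1 / e) * 2 / k) <= rho by rewrite le_max lexx orbT.
  rewrite -h4 in r1.
  move: r1 (expR_gt0 ((2 + 1 / e) * 2 / k)); set X := expR _ => r1 X0.
  have s1 : 2 * X * (2 * X) <= (a + b) * (a + b) by apply: ler_pM => //; lra.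
  have := sqr_ge0 (a - b); have := sqr_ge0 (X - 1 / 4); rewrite !expr2.
  by clear - s1; lra.
have : a * a + b * b <= e * barrier a b.
  apply: (@le_trans _ _ (e * ((a * a + b * b) * (k / 2 * ln (1 + (a * a + b * b)) - 2)))).
    rewrite mulrCA ler_peMr//.
    move: lq; rewrite ler_pdivrMr// => lq.
    have : (2 + 1 / e) <= k / 2 * ln (1 + (a * a + b * b)) by lra.
    have ee : e * (1 / e) = 1 by field; exact: lt0r_neq0.
    set l := k / 2 * _ => H.
    have : e * (2 + 1 / e) <= e * l by rewrite ler_pM2l.
    by rewrite mulrDr ee mulrBr; clear; lra.
  by rewrite ler_pM2l// barE.
move=> hq; apply: (le_trans B2); rewrite ler_wpM2l// ler_expR.
have : 0 <= k * (a * b) by rewrite mulr_ge0 ?mulr_ge0// ltW.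
have : 0 <= e * m by rewrite mulr_ge0// ltW.
have := sqr_ge0 a; rewrite !expr2; lra.
Qed.

End phragmen_lindelof.

Section plane.
Variable R : realType.
Local Notation C := R[i].
Local Notation nc := (@Normc.normc R).

Lemma poly_approximable_rot (F : C -> C) (u : C) : nc u = 1 ->
  poly_approximable F -> poly_approximable (fun z => F (u * z)).
Proof.
move=> u1 aF rho eta eta0; have [T TP] := aF rho eta eta0.
exists (T \Po (u *: 'X)) => z zr.
rewrite horner_comp hornerZ hornerX; apply: TP.
by rewrite Normc.normcM u1 mul1r.
Qed.

Lemma muli (a b : R) : Complex 0 1 * Complex a b = Complex (- b) a.
Proof. by congr Complex; ring. Qed.

Lemma mulNi (a b : R) : Complex 0 (-1) * Complex a b = Complex b (- a).
Proof. by congr Complex; ring. Qed.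

(** Quarter turns permute the quadrants, and exchange the two bounds or preserve them. On
  the axes one of the two bounds is already the conclusion. *)
Lemma phragmen_lindelof (F : C -> C) (c M : R) :
  poly_approximable F -> 0 <= c -> 0 <= M ->
  (forall x y,
    nc (F (Complex x y)) <= M * expR (c * (`|x| + `|y|) + x ^+ 2) /\
    nc (F (Complex x y)) <= M * expR (c * (`|x| + `|y|) + y ^+ 2)) ->
  forall x y, nc (F (Complex x y)) <= M * expR (c * (`|x| + `|y|)).
Proof.
move=> aF c0 M0 bd x y.
have [->|x0] := eqVneq x 0.
  by apply: le_trans (bd 0 y).1 _; rewrite expr0n /= addr0.
have [->|y0] := eqVneq y 0.
  by apply: le_trans (bd x 0).2 _; rewrite expr0n /= addr0.
have rot (u : C) : nc u = 1 ->
    (forall a b : R, [/\ complex.Re (u * Complex a b) ^+ 2 = a ^+ 2,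
        complex.Im (u * Complex a b) ^+ 2 = b ^+ 2 &
        `|complex.Re (u * Complex a b)| + `|complex.Im (u * Complex a b)| = `|a| + `|b|] \/
      [/\ complex.Re (u * Complex a b) ^+ 2 = b ^+ 2,
        complex.Im (u * Complex a b) ^+ 2 = a ^+ 2 &
        `|complex.Re (u * Complex a b)| + `|complex.Im (u * Complex a b)| = `|a| + `|b|]) ->
    forall a b, 0 < a -> 0 < b -> nc (F (u * Complex a b)) <= M * expR (c * (a + b)).
  move=> u1 hu; apply: (phragmen_lindelof_quadrant (poly_approximable_rot u1 aF)) => // a b a0 b0.
  have := bd (complex.Re (u * Complex a b)) (complex.Im (u * Complex a b)).
  rewrite (_ : Complex _ _ = u * Complex a b); last by case: (u * _).
  by case: (hu a b) => -[-> -> ->]; rewrite !ger0_norm// => -[]; split.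
have [x1|x1] := ltP 0 x; have [y1|y1] := ltP 0 y.
- rewrite !gtr0_norm//; have := rot 1; rewrite Normc.normc1 => /(_ erefl _ x y x1 y1).
  by rewrite mul1r; apply => a b; rewrite mul1r /=; left.
- have y2 : 0 < - y by rewrite oppr_gt0 lt_neqAle y0.
  rewrite gtr0_norm// ltr0_norm -?oppr_gt0//.
  have n1 : nc (Complex 0 (-1)) = 1 by rewrite /= expr0n /= add0r sqrrN expr1n sqrtr1.
  have := rot _ n1 _ (- y) x y2 x1.
  rewrite mulNi opprK.
  by rewrite [x - y]addrC; apply => a b; right; rewrite mulNi /= sqrrN normrN; split=> //; rewrite addrC.
- have x2 : 0 < - x by rewrite oppr_gt0 lt_neqAle x0.
  rewrite ltr0_norm -?oppr_gt0// gtr0_norm//.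
  have n1 : nc (Complex 0 1) = 1 by rewrite /= expr0n /= add0r expr1n sqrtr1.
  have := rot _ n1 _ y (- x) y1 x2.
  rewrite muli opprK.
  by rewrite [- x + y]addrC; apply => a b; right; rewrite muli /= sqrrN normrN; split=> //; rewrite addrC.
- have x2 : 0 < - x by rewrite oppr_gt0 lt_neqAle x0.
  have y2 : 0 < - y by rewrite oppr_gt0 lt_neqAle y0.
  rewrite !ltr0_norm -?oppr_gt0//.
  have := rot (-1); rewrite normcN Normc.normc1 => /(_ erefl _ (- x) (- y) x2 y2).
  rewrite (_ : _ * _ = Complex x y); last by rewrite mulN1r; congr Complex; ring.
  by apply => a b; left; rewrite mulN1r /= !sqrrN !normrN.
Qed.

End plane.

(** * Generating function of the Hermite polynomials *)

Section complex_exponential.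
Variable R : realType.
Local Notation C := R[i].
Local Notation Re := (@complex.Re R).
Local Notation Im := (@complex.Im R).
Local Notation nc := (@Normc.normc R).

Definition cexp (z : C) : C := Complex (expR (Re z) * cos (Im z)) (expR (Re z) * sin (Im z)).

Lemma cexpD (z w : C) : cexp (z + w) = cexp z * cexp w.
Proof.
case: z w => [a b] [c e]; rewrite /cexp /= expRD cosD sinD; congr Complex; ring.
Qed.

Lemma cexp0 : cexp 0 = 1.
Proof. by rewrite /cexp /= expR0 cos0 sin0 mulr1 mulr0. Qed.

Lemma nc_cexp (z : C) : nc (cexp z) = expR (Re z).
Proof.
by rewrite /cexp /= !exprMn -mulrDr cos2Dsin2 mulr1 sqrtr_sqr ger0_norm// expR_ge0.
Qed.

Lemma cexpNK (z : C) : cexp (- z) * cexp z = 1.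
Proof. by rewrite -cexpD addNr cexp0. Qed.

Lemma nc_Re (z : C) : `|Re z| <= nc z.
Proof. by case: z => a b /=; rewrite -sqrtr_sqr ler_wsqrtr// lerDl sqr_ge0. Qed.

Lemma nc_Im (z : C) : `|Im z| <= nc z.
Proof. by case: z => a b /=; rewrite -sqrtr_sqr ler_wsqrtr// lerDr sqr_ge0. Qed.

Lemma nc_le (z : C) : nc z <= `|Re z| + `|Im z|.
Proof.
case: z => a b /=; rewrite -[leRHS]ger0_norm ?addr_ge0// -sqrtr_sqr ler_wsqrtr//.
rewrite sqrrD !real_normK ?num_real// -addrA lerD2l lerDr.
by rewrite mulrn_wge0// mulr_ge0.
Qed.

Lemma nc_real (a : R) : nc (a%:C)%C = `|a|.
Proof. by rewrite /= expr0n /= addr0 sqrtr_sqr. Qed.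

Lemma ncX (z : C) n : nc (z ^+ n) = nc z ^+ n.
Proof. by elim: n => [|n IH]; rewrite ?expr0 ?Normc.normc1// !exprS Normc.normcM IH. Qed.

(** Derivative of a complex function of a real variable. *)
Definition cder (u : R -> C) (x : R) (v : C) :=
  is_derive x 1 (fun t => Re (u t)) (Re v) /\ is_derive x 1 (fun t => Im (u t)) (Im v).

Lemma cder_cst (z : C) x : cder (fun=> z) x 0.
Proof. by split; exact: derC. Qed.

Lemma cderD u v x u' v' : cder u x u' -> cder v x v' ->
  cder (fun t => u t + v t) x (u' + v').
Proof.
move=> [u1 u2] [v1 v2]; split.
- under eq_fun do rewrite ReD.
  by rewrite ReD; exact: derD.
- under eq_fun do rewrite ImD.
  by rewrite ImD; exact: derD.
Qed.

Lemma cderM u v x u' v' : cder u x u' -> cder v x v' ->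
  cder (fun t => u t * v t) x (u x * v' + u' * v x).
Proof.
move=> [u1 u2] [v1 v2]; split.
- under eq_fun do rewrite ReM.
  apply: (is_derive_eq (derB (derM u1 v1) (derM u2 v2))).
  by rewrite ReD !ReM; ring.
- under eq_fun do rewrite ImM.
  apply: (is_derive_eq (derD (derM u1 v2) (derM u2 v1))).
  by rewrite ImD !ImM; ring.
Qed.

Lemma cder_lin (z : C) x : cder (fun t => (t%:C)%C * z) x z.
Proof.
have h : cder (fun t => (t%:C)%C : C) x 1 by split; [exact: derI|exact: derC].
by have := cderM h (cder_cst z x); rewrite mulr0 add0r mul1r.
Qed.

Lemma cder_cexp u x u' : cder u x u' -> cder (fun t => cexp (u t)) x (cexp (u x) * u').
Proof.
move=> [u1 u2]; split; rewrite /cexp /=.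
- apply: (is_derive_eq (derM (derexp u1) (dercos u2))).
  by rewrite ReM /=; ring.
- apply: (is_derive_eq (derM (derexp u1) (dersin u2))).
  by rewrite ImM /=; ring.
Qed.

Lemma cder_horner (T : {poly C}) (z : C) x :
  cder (fun t => T.[(t%:C)%C * z]) x (T^`().[(x%:C)%C * z] * z).
Proof.
elim/poly_ind: T => [|T c IH].
  rewrite deriv0 horner0 mul0r.
  under eq_fun do rewrite horner0.
  exact: cder_cst.
under eq_fun do rewrite hornerMXaddC.
rewrite derivD derivM derivX derivC mulr1 addr0 hornerD hornerM hornerX.
have := cderD (cderM IH (cder_lin z x)) (cder_cst c x).
set v := (X in cder _ _ X -> _); set w := (X in _ -> cder _ _ X).
suff -> : v = w by [].
by rewrite /v /w; ring.
Qed.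

(** Mean value inequality, applied to the two components; hence the factor 2. *)
Lemma cder_le (u v : R -> C) (B : R) :
  (forall x, cder u x (v x)) -> (forall x, 0 <= x <= 1 -> nc (v x) <= B) ->
  nc (u 1 - u 0) <= 2 * B.
Proof.
move=> du vB.
have bd (h h' : R -> R) : (forall x : R, is_derive x 1 h (h' x)) ->
    (forall x, 0 <= x <= 1 -> `|h' x| <= B) -> `|h 1 - h 0| <= B.
  move=> dh hB.
  have cg : {within `[0, 1], continuous h}.
    apply: continuous_subspaceT => x.
    apply: differentiable_continuous; apply/derivable1_diffP.
    by case: (dh x).
  have [c cI ->] := MVT_segment (@ler01 R) (fun x _ => dh x) cg.
  by rewrite subr0 mulr1; apply: hB; move: cI; rewrite in_itv.
apply: (le_trans (nc_le _)); rewrite mulr_natl mulr2n lerD//.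
- have -> : Re (u 1 - u 0) = Re (u 1) - Re (u 0) by case: (u 1); case: (u 0).
  apply: bd (fun x => (du x).1) _ => x x01.
  exact: le_trans (nc_Re _) (vB x x01).
- have -> : Im (u 1 - u 0) = Im (u 1) - Im (u 0) by case: (u 1); case: (u 0).
  apply: bd (fun x => (du x).2) _ => x x01.
  exact: le_trans (nc_Im _) (vB x x01).
Qed.

End complex_exponential.

Section hermite_polynomials.
Variable R : realType.
Local Notation C := R[i].
Local Notation nc := (@Normc.normc R).

(** The physicists' Hermite polynomials: the recursion says that the derivative
  of [P_n exp(- t ^+ 2)] is [- P_(n+1) exp(- t ^+ 2)]. *)
Fixpoint hpoly (n : nat) : {poly R} :=
  if n is k.+1 then 2 *: 'X * hpoly k - (hpoly k)^`() else 1.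

Lemma deriv_hpoly n : (hpoly n.+1)^`() = (2 * n.+1%:R) *: hpoly n.
Proof.
elim: n => [|n IH] /=.
  by rewrite mulr1 derivB derivZ derivX derivC deriv0 subr0 mulr1.
rewrite -/(hpoly n.+1) derivB derivM derivZ derivX IH derivZ.
rewrite [hpoly n.+1]/= -!mul_polyC; move: (hpoly n) => p.
by rewrite -(natr1 n.+1) !(polyCM, polyCD) !polyC_natr; ring.
Qed.

Lemma hpolySS n : hpoly n.+2 = 2 *: 'X * hpoly n.+1 - (2 * n.+1%:R) *: hpoly n.
Proof. by rewrite -deriv_hpoly. Qed.

(** Taylor coefficients in [z] of [exp(2 t z - z ^ 2)]. *)
Definition hcoef (t : R) (n : nat) : R := (hpoly n).[t] / n`!%:R.

Lemma hcoef0 t : hcoef t 0 = 1.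
Proof. by rewrite /hcoef hornerC divr1. Qed.

Lemma hcoef1 t : hcoef t 1 = 2 * t.
Proof. by rewrite /hcoef /= derivC subr0 mulr1 !hornerE divr1. Qed.

Lemma hcoefS t n : n.+2%:R * hcoef t n.+2 = 2 * t * hcoef t n.+1 - 2 * hcoef t n.
Proof.
rewrite /hcoef hpolySS hornerD hornerN hornerM !hornerZ hornerX !factS !natrM.
have n1 : n.+1%:R != 0 :> R by rewrite pnatr_eq0.
have n2 : n.+2%:R != 0 :> R by rewrite pnatr_eq0.
have n3 : n`!%:R != 0 :> R by rewrite pnatr_eq0 -lt0n fact_gt0.
move: (n.+1%:R) (n.+2%:R) (n`!%:R) n1 n2 n3 => a b c a0 b0 c0.
by field; rewrite a0 b0 c0.
Qed.

Lemma sum_expR_le (x : R) n : 0 <= x -> \sum_(k < n) x ^+ k / k`!%:R <= expR x.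
Proof.
move=> x0.
have := @nondecreasing_cvgn_le R (series (exp_coeff x)).
rewrite /expR => /(_ _ (is_cvg_series_exp_coeff x) n).
rewrite /series /= big_mkord; apply.
apply/nondecreasing_seqP => k; rewrite /series /= big_nat_recr//= lerDl.
by rewrite divr_ge0// exprn_ge0.
Qed.

(** By induction on the recurrence [hcoefS], [|hcoef t n| * rho ^+ n] is at most the
  partial sum of order [n] of the exponential series of [2 * `|t| * rho + 2 * rho ^+ 2]. This is the bound that Cauchy's
  estimate would give, up to the constants in the exponent. *)
Lemma hcoef_le t rho n : 0 <= rho ->
  `|hcoef t n| * rho ^+ n <= expR (2 * `|t| * rho + 2 * rho ^+ 2).
Proof.
move=> r0; set K := (X in expR X).
have K0 : 0 <= K by rewrite addr_ge0 ?mulr_ge0 ?sqr_ge0.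
pose E m := \sum_(k < m.+1) K ^+ k / k`!%:R.
have Emono m : E m <= E m.+1 by rewrite /E [leRHS]big_ord_recr /= lerDl divr_ge0// exprn_ge0.
have E1 m : 1 <= E m.
  by rewrite /E big_ord_recl /= expr0 divr1 lerDl sumr_ge0// => i _; rewrite divr_ge0// exprn_ge0.
have ES m : K / m.+1%:R * E m <= E m.+1.
  rewrite /E mulr_sumr [leRHS]big_ord_recl /=; apply: ler_wpDl; first by rewrite divr_ge0 ?exprn_ge0.
  apply: ler_sum => i _; rewrite /bump /= add1n exprS factS natrM.
  have i1 : i.+1%:R != 0 :> R by rewrite pnatr_eq0.
  have i2 : i`!%:R != 0 :> R by rewrite pnatr_eq0 -lt0n fact_gt0.
  have m2 : m.+1%:R != 0 :> R by rewrite pnatr_eq0.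
  rewrite mulrAC mulrA [leLHS]mulrAC invfM [i.+1%:R^-1 * _]mulrC [leRHS]mulrA.
  rewrite [leLHS]mulrAC.
  rewrite ler_wpM2l ?divr_ge0 ?mulr_ge0 ?exprn_ge0//.
  by rewrite lef_pV2 ?posrE ?ltr0Sn// ler_nat ltn_ord.
suff H m : `|hcoef t m| * rho ^+ m <= E m /\ `|hcoef t m.+1| * rho ^+ m.+1 <= E m.+1.
  by apply: le_trans (H n).1 _; exact: sum_expR_le.
elim: m => [|m [IH1 IH2]].
  rewrite hcoef0 hcoef1 normr1 expr0 mulr1; split; first exact: E1.
  rewrite /E !big_ord_recr big_ord0 /= add0r expr0 expr1 !divr1 normrM ger0_norm// expr1.
  by rewrite /K; have := sqr_ge0 rho; lra.
split=> //.
have m2 : 0 < m.+2%:R :> R by rewrite ltr0Sn.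
apply: le_trans (ES m.+1); rewrite mulrAC ler_pdivlMr// mulrC mulrA.
apply: (@le_trans _ _ (2 * `|t| * rho * (`|hcoef t m.+1| * rho ^+ m.+1)
   + 2 * rho ^+ 2 * (`|hcoef t m| * rho ^+ m))).
  rewrite -[X in X * `|_|](ger0_norm (ltW m2)) -normrM hcoefS.
  apply: (@le_trans _ _ ((2 * `|t| * `|hcoef t m.+1| + 2 * `|hcoef t m|) * rho ^+ m.+2)).
    rewrite ler_wpM2r ?exprn_ge0//; apply: le_trans (ler_normB _ _) _.
    by rewrite !normrM !(@ger0_norm _ 2).
  by rewrite le_eqVlt; apply/orP; left; apply/eqP; rewrite !exprS expr0; ring.
have -> : K * E m.+1 = 2 * `|t| * rho * E m.+1 + 2 * rho ^+ 2 * E m.+1 by rewrite -mulrDl.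
rewrite lerD// ler_wpM2l ?mulr_ge0 ?sqr_ge0//.
exact: le_trans IH1 (Emono _).
Qed.

End hermite_polynomials.

Section generating_function.
Variable R : realType.
Local Notation C := R[i].
Local Notation nc := (@Normc.normc R).
Local Notation toC := (real_complex R).

Lemma cder_ext (u u' : R -> C) (x : R) (v v' : C) :
  cder u x v -> u =1 u' -> v = v' -> cder u' x v'.
Proof. by move=> h /funext <- <-. Qed.

Definition hpartial (t : R) (N : nat) : {poly C} := \sum_(n < N) toC (hcoef t n) *: 'X^n.

Definition hphase (t : R) (z : C) : C := toC (2 * t) * z - z ^+ 2.

(** The generating function solves [G' = (2 t - 2 z) G]; its partial sums do so up to two
  boundary terms. *)
Lemma hpartial_ode (t : R) (N : nat) (z : C) :
  (hpartial t N.+1)^`().[z] - (toC (2 * t) - 2 * z) * (hpartial t N.+1).[z]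
  = - toC (N.+1%:R * hcoef t N.+1) * z ^+ N + toC (2 * hcoef t N) * z ^+ N.+1.
Proof.
elim: N => [|N IH].
  rewrite /hpartial big_ord1 expr0 hcoef0 hcoef1 alg_polyC derivC horner0 hornerC !mulr1 expr1.
  by rewrite sub0r mul1r opprB addrC; congr (_ + _); rewrite rmorphD.
have E : hpartial t N.+2 = hpartial t N.+1 + toC (hcoef t N.+1) *: 'X^(N.+1).
  by rewrite /hpartial big_ord_recr.
rewrite E derivD derivZ derivXn !hornerD !hornerZ hornerMn !hornerXn mulrDr opprD addrACA IH.
rewrite hcoefS -(mulr_natl (z ^+ _)) /=.
move: (hcoef t N.+1) (hcoef t N) => b c.
rewrite !(rmorphB, rmorphM) !rmorph_nat /=.
rewrite [z ^+ N.+2]exprS [z ^+ N.+1]exprS.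
move: (toC t) (toC b) (toC c) (z ^+ N) (N.+1%:R : C) => a b' c' e n.
by ring.
Qed.

Lemma hphase_le (t : R) (z : C) (rho : R) : nc z <= rho ->
  `|complex.Re (hphase t z)| <= 2 * `|t| * rho + rho ^+ 2.
Proof.
move=> zr; apply: le_trans (nc_Re _) _; rewrite /hphase.
apply: le_trans (le_normcD _ _) _; rewrite normcN Normc.normcM nc_real normrM ger0_norm//.
by rewrite lerD ?ler_wpM2l ?mulr_ge0// ncX lerXn2r ?nnegrE ?nc_ge0// (le_trans _ zr) ?nc_ge0.
Qed.

Definition hbound (t rho : R) := 2 * expR (12 * `|t| * rho + 36 * rho ^+ 2).

(** Along the segment from 0 to [z], the derivative of [hpartial * exp(- hphase)] consists
  of the two boundary terms in [hpartial_ode]. Applied with the radius [4 * rho],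
  [hcoef_le] gives a factor [4 ^- N], and [2 ^- N] is left of it after the factor [N.+1]. *)
Lemma hpartial_close (t : R) (z : C) (rho : R) (N : nat) : nc z <= rho ->
  nc (cexp (hphase t z) - (hpartial t N.+1).[z]) <= hbound t rho / 2 ^+ N.
Proof.
move=> zr; have r0 : 0 <= rho := le_trans (nc_ge0 z) zr.
pose w (s : R) : C := toC s * z.
pose ph (s : R) : C := - hphase t (w s).
pose u (s : R) : C := cexp (ph s) * (hpartial t N.+1).[w s].
pose v (s : R) : C := cexp (ph s) * (z * ((hpartial t N.+1)^`().[w s]
   - (toC (2 * t) - 2 * w s) * (hpartial t N.+1).[w s])).
have du s : cder u s (v s).
  have dph : cder ph s (- ((toC (2 * t) - 2 * w s) * z)).
    have h1 := cder_lin (- toC (2 * t) * z) s; have h2 := cder_lin z s.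
    apply: (cder_ext (cderD h1 (cderM h2 h2))) => [x|]; last by rewrite /w; ring.
    by rewrite /ph /hphase /w; ring.
  apply: (cder_ext (cderM (cder_cexp dph) (cder_horner (hpartial t N.+1) z s))) => //.
  by rewrite /v /w; ring.
have u0 : u 0 = 1.
  rewrite /u /ph /w /hphase mul0r mulr0 expr0n /= subrr oppr0 cexp0 mul1r.
  rewrite /hpartial horner_sum big_ord_recl big1 ?addr0 => [|i _]; rewrite !hornerE.
    by rewrite hcoef0.
  by rewrite /bump /= expr0n mulr0.
set B := expR (10 * `|t| * rho + 35 * rho ^+ 2) / 2 ^+ N.
have vB (s : R) : 0 <= s <= 1 -> nc (v s) <= B.
  move=> /andP[s0 s1].
  have wr : nc (w s) <= rho.
    by rewrite /w Normc.normcM nc_real ger0_norm// (le_trans _ zr)// ler_piMl// nc_ge0.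
  rewrite /v hpartial_ode Normc.normcM nc_cexp.
  have K4 n : `|hcoef t n| * rho ^+ n <= expR (8 * `|t| * rho + 32 * rho ^+ 2) / 4 ^+ n.
    rewrite ler_pdivlMr ?exprn_gt0// -[leLHS]mulrA -exprMn.
    apply: le_trans (hcoef_le t n (_ : 0 <= rho * 4)) _; first by rewrite mulr_ge0.
    by rewrite ler_expR exprMn; lra.
  have two4 : N.+1%:R / 4 ^+ N.+1 <= (2 ^+ N.+1)^-1 :> R.
    rewrite ler_pdivrMr ?exprn_gt0// mulrC (_ : 4 = 2 * 2 :> R); last by ring.
    rewrite exprMn mulfK ?expf_neq0// -natrX ler_nat.
    by apply: ltnW; exact: ltn_expl.
  have h4 : (4 ^+ N)^-1 <= (2 ^+ N)^-1 :> R.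
    by rewrite lef_pV2 ?posrE ?exprn_gt0// lerXn2r ?nnegrE//; lra.
  set E4 := expR (8 * `|t| * rho + 32 * rho ^+ 2) in K4.
  have E40 : 0 <= E4 := expR_ge0 _.
  have h1 : nc (z * (- toC (N.+1%:R * hcoef t N.+1) * w s ^+ N + toC (2 * hcoef t N) * w s ^+ N.+1))
      <= (1 + 2 * rho ^+ 2) * E4 / 2 ^+ N.
    rewrite Normc.normcM; apply: (@le_trans _ _ (rho * (N.+1%:R * `|hcoef t N.+1| * rho ^+ N
        + 2 * `|hcoef t N| * rho ^+ N.+1))).
      apply: ler_pM; rewrite ?nc_ge0//; apply: le_trans (le_normcD _ _) _.
      rewrite !Normc.normcM normcN !nc_real !normrM !ncX !normr_nat.
      by apply: lerD; apply: ler_wpM2l; rewrite ?mulr_ge0// lerXn2r ?nnegrE ?nc_ge0.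
    rewrite (_ : rho * _ = N.+1%:R * (`|hcoef t N.+1| * rho ^+ N.+1)
        + 2 * rho ^+ 2 * (`|hcoef t N| * rho ^+ N)); last by rewrite !exprS expr0; ring.
    rewrite -[leRHS]mulrA [leRHS]mulrDl; apply: lerD.
      apply: le_trans (ler_wpM2l (ler0n _ _) (K4 _)) _.
      rewrite mulrCA mul1r ler_wpM2l//; apply: le_trans two4 _.
      by rewrite lef_pV2 ?posrE ?exprn_gt0// exprS ler_peMl ?exprn_ge0//; lra.
    rewrite ler_wpM2l ?mulr_ge0 ?sqr_ge0//; apply: le_trans (K4 _) _.
    by rewrite ler_wpM2l.
  apply: le_trans (ler_wpM2l (expR_ge0 _) h1) _.
  rewrite mulrA /B ler_wpM2r ?invr_ge0 ?exprn_ge0//.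
  apply: (@le_trans _ _ (expR (2 * `|t| * rho + rho ^+ 2) * (expR (2 * rho ^+ 2) * E4))).
    apply: ler_pM; rewrite ?expR_ge0 ?mulr_ge0 ?addr_ge0 ?mulr_ge0 ?sqr_ge0//.
      rewrite ler_expR (le_trans (ler_norm _))// /ph.
      have -> : complex.Re (- hphase t (w s)) = - complex.Re (hphase t (w s)) by case: (hphase _ _).
      by rewrite normrN hphase_le.
    by rewrite ler_wpM2r// expR_ge1Dx.
  by rewrite -!expRD ler_expR; lra.
have := cder_le du vB; rewrite u0.
have -> : u 1 = cexp (- hphase t z) * (hpartial t N.+1).[z].
  by rewrite /u /ph /w rmorph1 mul1r.
have -> : cexp (hphase t z) - (hpartial t N.+1).[z] =
    - cexp (hphase t z) * (cexp (- hphase t z) * (hpartial t N.+1).[z] - 1).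
  by rewrite mulrBr mulr1 mulrA mulNr [_ * cexp (- _)]mulrC cexpNK mulN1r; ring.
rewrite Normc.normcM normcN nc_cexp => h.
apply: le_trans (ler_pM (expR_ge0 _) (nc_ge0 _) (_ : _ <= expR (2 * `|t| * rho + rho ^+ 2)) h) _.
  by rewrite ler_expR (le_trans (ler_norm _))// hphase_le.
rewrite mulrCA /hbound -[leRHS]mulrA ler_wpM2l// /B mulrA -expRD.
by rewrite ler_wpM2r ?invr_ge0 ?exprn_ge0// ler_expR; lra.
Qed.

End generating_function.

(** * Lebesgue measure and linear changes of variables *)

Section affine_line.
Variable R : realType.
Local Notation mu := (@lebesgue_measure R).
Local Notation mR := (measurableTypeR R).
Local Open Scope ereal_scope.

Let aff (a b : R) : mR -> mR := fun t => (a * t + b)%R.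

Lemma measurable_aff (a b : R) : measurable_fun setT (aff a b).
Proof.
apply: measurable_funD; last exact: measurable_cst.
by apply: measurable_funM; [exact: measurable_cst|exact: measurable_id].
Qed.

Lemma lebesgue_measure_aff (a b : R) (A : set mR) : (0 < a)%R -> measurable A ->
  mu A = a%:E * mu (aff a b @^-1` A).
Proof.
move=> a0 mA.
have a0' : (0 <= a)%R := ltW a0.
pose m := mscale (NngNum a0')
  (measure_function_pushforward__canonical__measure_function_Measure mu (measurable_aff a b)).
transitivity (m A); last by [].
apply: lebesgue_measure_unique => // _ [[x y]] /= xy <-.
rewrite /m /mscale /= /pushforward.
rewrite (_ : aff a b @^-1` `]x, y] = `](x - b) / a, (y - b) / a]%classic)%R; last first.
  apply/seteqP; split => t; rewrite /= !in_itv /= /aff => /andP[h1 h2]; apply/andP; split.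
  - by rewrite ltr_pdivrMr// ltrBlDr mulrC.
  - by rewrite ler_pdivlMr// lerBrDr mulrC.
  - by rewrite -ltrBlDr mulrC -ltr_pdivrMr.
  - by rewrite -lerBrDr mulrC -ler_pdivlMr.
rewrite !lebesgue_measure_itv /= !lte_fin ltr_pM2r ?invr_gt0// ltrD2r.
case: ifPn => _; last by rewrite mule0.
by rewrite -EFinD -EFinM -mulrBl; congr EFin; field; exact: lt0r_neq0.
Qed.

Lemma ge0_integral_aff (a b : R) (h : mR -> \bar R) : (0 < a)%R ->
  measurable_fun setT h -> (forall t, 0 <= h t) ->
  \int[mu]_t h (a * t + b)%R = (a^-1)%:E * \int[mu]_t h t.
Proof.
move=> a0 mh h0.
have a0' : (0 <= a)%R := ltW a0.
pose p := measure_function_pushforward__canonical__measure_function_Measure mu (measurable_aff a b).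
have -> : \int[mu]_t h t = \int[mscale (NngNum a0') p]_t h t.
  apply: eq_measure_integral => A mA _.
  exact: (lebesgue_measure_aff b a0 mA).
rewrite ge0_integral_mscale//= muleA -EFinM mulVf ?gt_eqF// mul1e.
by rewrite ge0_integral_pushforward//; exact: measurable_aff.
Qed.

End affine_line.

Section lebesgue_cV_theory.
Variable R : realType.
Local Notation mu := (@lebesgue_measure R).
Local Notation mR := (measurableTypeR R).
Local Open Scope ereal_scope.

Lemma cons_cV0 n (t : R) (x : 'cV[R]_n) : cons_cV (t, x) ord0 ord0 = t.
Proof. by rewrite mxE unlift_none. Qed.

Lemma cons_cVS n (t : R) (x : 'cV[R]_n) j : cons_cV (t, x) (lift ord0 j) ord0 = x j ord0.
Proof. by rewrite mxE liftK. Qed.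

Lemma cons_cV_eq n (t : R) (x : 'cV[R]_n) (y : 'cV[R]_n.+1) :
  t = y ord0 ord0 -> (forall j, x j ord0 = y (lift ord0 j) ord0) -> cons_cV (t, x) = y.
Proof.
move=> h0 hS; apply/colP => i; case: (unliftP ord0 i) => [j ->|->].
  by rewrite cons_cVS hS.
by rewrite cons_cV0.
Qed.

Lemma measurable_mulmx n (S : 'M[R]_n) : measurable_fun setT (fun x : 'cV[R]_n => S *m x).
Proof.
apply: measurable_fun_cVP => i.
rewrite (_ : (fun t => _) = fun t : 'cV[R]_n => \sum_j (S i j * t j ord0))%R; last first.
  by apply/funext => t; rewrite mxE.
apply: measurable_sum => j; apply: measurable_funM; first exact: measurable_cst.
exact: measurable_coord.
Qed.

Lemma measurable_addcV n (b : 'cV[R]_n) : measurable_fun setT (fun x : 'cV[R]_n => x + b)%R.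
Proof.
apply: measurable_fun_cVP => i.
rewrite (_ : (fun t => _) = fun t : 'cV[R]_n => t i ord0 + b i ord0)%R; last first.
  by apply/funext => t; rewrite mxE.
by apply: measurable_funD; [exact: measurable_coord|exact: measurable_cst].
Qed.

Section step.
Variables (n : nat) (h : 'cV[R]_n.+1 -> \bar R).
Hypotheses (mh : measurable_fun setT h) (h0 : forall x, 0 <= h x).

Lemma measurable_comp_cons : measurable_fun setT (h \o @cons_cV R n).
Proof. by apply: measurableT_comp => //; exact: measurable_cons_cV. Qed.

Lemma integral_cVS :
  \int[lebesgue_cV R n.+1]_x h x = \int[mu]_t \int[lebesgue_cV R n]_x h (cons_cV (t, x)).
Proof.
transitivity (\int[mu \x lebesgue_cV R n]_z (h \o @cons_cV R n) z).
  by rewrite [LHS]ge0_integral_pushforward//; exact: measurable_cons_cV.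
apply: (fubini_tonelli1 (h \o @cons_cV R n)); first exact: measurable_comp_cons.
by move=> z; exact: h0.
Qed.

Lemma integral_cVS_swap :
  \int[lebesgue_cV R n.+1]_x h x = \int[lebesgue_cV R n]_x \int[mu]_t h (cons_cV (t, x)).
Proof.
rewrite integral_cVS.
apply: (fubini_tonelli (h \o @cons_cV R n)); first exact: measurable_comp_cons.
by move=> z; exact: h0.
Qed.

Lemma measurable_cons_l t : measurable_fun setT (fun x => h (cons_cV (t, x))).
Proof. exact: (measurableT_comp measurable_comp_cons (pair1_measurable t)). Qed.

Lemma measurable_cons_r x : measurable_fun setT (fun t : mR => h (cons_cV (t, x))).
Proof. exact: (measurableT_comp measurable_comp_cons (pair2_measurable x)). Qed.

Lemma measurable_integral_cons_l :
  measurable_fun setT (fun t : mR => \int[lebesgue_cV R n]_x h (cons_cV (t, x))).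
Proof.
apply: (measurable_fun_fubini_tonelli_F (h \o @cons_cV R n)); first exact: measurable_comp_cons.
by move=> z; exact: h0.
Qed.

End step.

Lemma ge0_integral_translate n (h : 'cV[R]_n -> \bar R) (b : 'cV[R]_n) :
  measurable_fun setT h -> (forall x, 0 <= h x) ->
  \int[lebesgue_cV R n]_x h (x + b)%R = \int[lebesgue_cV R n]_x h x.
Proof.
elim: n h b => [|n IH] h b mh h0.
  by apply: eq_integral => x _; congr h; apply/colP => -[].
have mhb := measurableT_comp mh (measurable_addcV b).
rewrite (integral_cVS mh h0) (integral_cVS mhb (fun x => h0 _)).
pose g (t : mR) := \int[lebesgue_cV R n]_x h (cons_cV (t, x)).
transitivity (\int[mu]_t g (1 * t + b ord0 ord0)%R).
  apply: eq_integral => t _; rewrite /g.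
  rewrite -[RHS](IH _ (\col_j b (lift ord0 j) ord0))//; last exact: measurable_cons_l.
  apply: eq_integral => x _; congr h; apply/esym/cons_cV_eq.
    by rewrite !mxE unlift_none mul1r.
  by move=> j; rewrite !mxE liftK.
rewrite ge0_integral_aff//.
- by rewrite invr1 mul1e.
- exact: measurable_integral_cons_l.
- by move=> t; exact: integral_ge0.
Qed.

(** One step of Gaussian elimination writes [S] as a product of two shears and a
  block-diagonal map, whose blocks are the pivot and the Schur complement [S']; the latter is
  again positive definite. Each factor is handled by Fubini, the translation invariance or
  the scaling of the measure. The constant is the inverse of the determinant of [S]. *)
Lemma ge0_integral_posdef n (S : 'M[R]_n) : posdefmx S ->
  exists2 c : R, (0 < c)%R & forall h : 'cV[R]_n -> \bar R,
    measurable_fun setT h -> (forall x, 0 <= h x) ->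
    \int[lebesgue_cV R n]_x h (S *m x) = c%:E * \int[lebesgue_cV R n]_x h x.
Proof.
elim: n S => [|n IH] S [Ssym Spos].
  exists 1%R => // h mh h0; rewrite mul1e.
  by apply: eq_integral => x _; congr h; apply/colP => -[].
pose a := S ord0 ord0.
pose w : 'cV[R]_n := (\col_i S (lift ord0 i) ord0)%R.
pose S' : 'M[R]_n := (\matrix_(i, j) (S (lift ord0 i) (lift ord0 j) - w i ord0 * w j ord0 / a))%R.
have symE i j : S i j = S j i by rewrite -[in LHS]Ssym mxE.
have SE t x i : (S *m cons_cV (t, x)) i ord0 =
    (S i ord0 * t + \sum_j S i (lift ord0 j) * x j ord0)%R.
  rewrite mxE big_ord_recl cons_cV0; congr (_ + _)%R.
  by apply: eq_bigr => j _; rewrite cons_cVS.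
have a0 : (0 < a)%R.
  have e0 : cons_cV (1%R, 0%R : 'cV[R]_n) != 0%R.
    apply/eqP => /colP/(_ ord0); rewrite cons_cV0 mxE => /eqP; by rewrite oner_eq0.
  have := Spos _ e0; rewrite /dotv big_ord_recl cons_cV0 mul1r SE mulr1 big1 ?addr0.
    by rewrite big1 ?addr0// => i _; rewrite cons_cVS mxE mul0r.
  by move=> i _; rewrite mxE mulr0.
have S'E x i : (S' *m x) i ord0 = (\sum_j S (lift ord0 i) (lift ord0 j) * x j ord0 -
     w i ord0 / a * \sum_j w j ord0 * x j ord0)%R.
  rewrite mxE mulr_sumr -sumrB; apply: eq_bigr => j _; rewrite mxE; ring.
have S'pd : posdefmx S'.
  split; first by apply/matrixP => i j; rewrite !mxE symE [(_ * S _ _)%R]mulrC.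
  move=> x x0.
  pose s := (\sum_j w j ord0 * x j ord0)%R.
  have y0 : cons_cV ((- (s / a))%R, x) != 0%R.
    apply: contra x0 => /eqP/colP h; apply/eqP/colP => j.
    by have := h (lift ord0 j); rewrite cons_cVS !mxE.
  have := Spos _ y0; rewrite /dotv big_ord_recl SE.
  rewrite (_ : \sum_j S ord0 _ * _ = s)%R; last first.
    by apply: eq_bigr => j _; rewrite symE /w mxE.
  rewrite -/a mulrN mulrCA divff ?gt_eqF// mulr1 addNr mulr0 add0r.
  congr (_ < _)%R; apply: eq_bigr => i _; rewrite cons_cVS SE S'E -/s.
  by rewrite [w i ord0]mxE; congr (_ * _)%R; ring.
have [c c0 cP] := IH S' S'pd.
exists (a^-1 * c)%R; first by rewrite mulr_gt0 ?invr_gt0.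
move=> h mh h0.
rewrite integral_cVS_swap//; last exact: (measurableT_comp mh (measurable_mulmx S)).
(* what remains of S once t := a t + <w, x> has been substituted in the first coordinate *)
pose L : 'M[R]_n.+1 := (\matrix_(i, j)
  if unlift ord0 i is Some i' then
    if unlift ord0 j is Some j' then S' i' j' else w i' ord0 / a
  else if j == ord0 then 1 else 0)%R.
have L00 : L ord0 ord0 = 1%R by rewrite mxE unlift_none eqxx.
have L0S j : L ord0 (lift ord0 j) = 0%R by rewrite mxE unlift_none.
have LS0 i : L (lift ord0 i) ord0 = (w i ord0 / a)%R by rewrite mxE liftK unlift_none.
have LSS i j : L (lift ord0 i) (lift ord0 j) = S' i j by rewrite mxE !liftK.
have LE t x : L *m cons_cV (t, x) = cons_cV (t, (S' *m x + (t / a) *: w)%R).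
  apply/esym/cons_cV_eq => [|j].
    by rewrite mxE big_ord_recl cons_cV0 L00 mul1r big1 ?addr0// => j _; rewrite L0S mul0r.
  rewrite [RHS]mxE big_ord_recl cons_cV0 LS0 [LHS]mxE [((t / a) *: w) j _]mxE addrC.
  congr (_ + _)%R; first by rewrite mulrAC [in RHS]mulrC mulrA mulrAC.
  by rewrite mxE; apply: eq_bigr => k _; rewrite LSS cons_cVS.
have mhL : measurable_fun setT (fun x => h (L *m x)).
  exact: (measurableT_comp mh (measurable_mulmx L)).
transitivity (a^-1%:E * \int[lebesgue_cV R n]_x \int[mu]_t h (L *m cons_cV (t, x))).
  rewrite -ge0_integralZl//; last 3 first.
  - apply: (measurable_fun_fubini_tonelli_G ((fun x => h (L *m x)) \o @cons_cV R n)).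
      exact: measurable_comp_cons.
    by move=> z; exact: h0.
  - by move=> x _; exact: integral_ge0.
  - by rewrite lee_fin invr_ge0 ltW.
  apply: eq_integral => x _; pose s := (\sum_j w j ord0 * x j ord0)%R.
  rewrite -(@ge0_integral_aff _ a s (fun t => h (L *m cons_cV (t, x))))//; last first.
    exact: (measurable_cons_r mhL).
  apply: eq_integral => t _; congr h; rewrite LE; apply/esym/cons_cV_eq => [|j].
    rewrite SE -/a; congr (_ + _)%R.
    by apply: eq_bigr => j _; rewrite symE /w mxE.
  rewrite [LHS]mxE S'E [(_ *: w) j _]mxE SE -/s.
  rewrite (_ : S (lift ord0 j) ord0 = w j ord0); last by rewrite mxE.
  by move: (w j ord0) (\sum_(k < n) _)%R => u v; field; exact: lt0r_neq0.
rewrite EFinM -muleA; congr (_ * _).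
rewrite -(integral_cVS_swap mhL)// !integral_cVS//.
rewrite -ge0_integralZl//; last 3 first.
- exact: measurable_integral_cons_l.
- by move=> t _; exact: integral_ge0.
- by rewrite lee_fin ltW.
apply: eq_integral => t _; under eq_integral do rewrite LE.
have mt := measurable_cons_l mh t.
have mtr : measurable_fun setT (fun y : 'cV[R]_n => h (cons_cV (t, y + (t / a) *: w)%R)).
  exact: (measurableT_comp mt (measurable_addcV _)).
by rewrite (cP _ mtr)// (ge0_integral_translate ((t / a) *: w)%R mt).
Qed.

End lebesgue_cV_theory.

Section product_integrals.
Variable R : realType.
Local Notation mu := (@lebesgue_measure R).
Local Notation mR := (measurableTypeR R).

Lemma measurable_prod_coord n (phi : 'I_n -> mR -> R) :
  (forall i, measurable_fun setT (phi i)) ->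
  measurable_fun setT (fun x : 'cV[R]_n => \prod_i phi i (x i ord0)).
Proof.
move=> mphi; apply: measurable_prod => i _.
exact: (measurableT_comp (mphi i) (measurable_coord i)).
Qed.

Lemma integral_prod_coord_le n (phi : 'I_n -> mR -> R) (k : 'I_n -> R) :
  (forall i, measurable_fun setT (phi i)) -> (forall i t, 0 <= phi i t) ->
  (forall i, (\int[mu]_t (phi i t)%:E <= (k i)%:E)%E) ->
  (\int[lebesgue_cV R n]_x (\prod_i phi i (x i ord0))%:E <= (\prod_i k i)%:E)%E.
Proof.
elim: n phi k => [|n IH] phi k mphi phi0 hk.
  rewrite !big_ord0 (eq_integral (fun=> 1%:E)); last by move=> x _; rewrite big_ord0.
  by rewrite integral_dirac// diracT mule1.
have k0 i : 0 <= k i.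
  by rewrite -lee_fin; apply: le_trans (hk i); apply: integral_ge0 => t _; rewrite lee_fin.
have mp : measurable_fun setT (fun x : 'cV[R]_n.+1 => (\prod_i phi i (x i ord0))%:E).
  by apply/measurable_EFinP; exact: measurable_prod_coord.
rewrite (integral_cVS mp); last by move=> x; rewrite lee_fin prodr_ge0.
pose J := (\int[lebesgue_cV R n]_x (\prod_i phi (lift ord0 i) (x i ord0))%:E)%E.
have mq : measurable_fun setT (fun x : 'cV[R]_n => (\prod_i phi (lift ord0 i) (x i ord0))%:E).
  apply/measurable_EFinP.
  exact: (@measurable_prod_coord n (fun i => phi (lift ord0 i)) (fun i => mphi _)).
have q0 (x : 'cV[R]_n) : (0 <= (\prod_i phi (lift ord0 i) (x i ord0))%:E)%E.
  by rewrite lee_fin prodr_ge0.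
have J0 : (0 <= J)%E by apply: integral_ge0 => x _; exact: q0.
rewrite (eq_integral (fun t => J * (phi ord0 t)%:E)%E); last first.
  move=> t _; rewrite muleC /J -ge0_integralZl//; last by rewrite lee_fin.
  apply: eq_integral => x _; rewrite -EFinM big_ord_recl cons_cV0; congr (_ * _)%:E.
  by apply: eq_bigr => i _; rewrite cons_cVS.
rewrite ge0_integralZl//; last 2 first.
- by apply/measurable_EFinP.
- by move=> t _; rewrite lee_fin.
rewrite big_ord_recl mulrC EFinM; apply: lee_pmul => //.
- by apply: integral_ge0 => t _; rewrite lee_fin.
- exact: (IH (fun i => phi (lift ord0 i)) (fun i => k (lift ord0 i))
    (fun i => mphi _) (fun i => phi0 _) (fun i => hk _)).
Qed.

End product_integrals.

(** * Integrals of complex-valued functions *)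

Lemma integral_scale_le d (T : measurableType d) (R : realType)
    (m : {measure set T -> \bar R}) (h : T -> R) (c M : R) :
  0 <= c -> measurable_fun setT h -> (forall x, 0 <= h x) ->
  (\int[m]_x (h x)%:E <= M%:E)%E -> (\int[m]_x (c * h x)%:E <= (c * M)%:E)%E.
Proof.
move=> c0 mh h0 hM.
have mE : measurable_fun setT (fun x => (h x)%:E) by exact/measurable_EFinP.
under eq_integral do rewrite EFinM.
rewrite ge0_integralZl//; last by move=> x _; rewrite lee_fin.
by rewrite EFinM; apply: lee_wpmul2l; rewrite ?lee_fin.
Qed.

Section complex_integral.
Context {d} {T : measurableType d} {R : realType}.
Variable m : {measure set T -> \bar R}.
Local Notation C := R[i].
Local Notation Re := (@complex.Re R).
Local Notation Im := (@complex.Im R).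
Local Notation nc := (@Normc.normc R).
Implicit Types f g : T -> C.

Definition cint f : C :=
  Complex (\int[m]_x Re (f x)) (\int[m]_x Im (f x)).

Definition cmeasurable f : Prop :=
  measurable_fun setT (fun x => Re (f x)) /\ measurable_fun setT (fun x => Im (f x)).

Definition cintegrable f : Prop :=
  cmeasurable f /\ (\int[m]_x (nc (f x))%:E < +oo)%E.

Lemma cmeasurable_cst (z : C) : cmeasurable (fun=> z).
Proof. by split; exact: measurable_cst. Qed.

Lemma cmeasurableD f g : cmeasurable f -> cmeasurable g -> cmeasurable (fun x => f x + g x).
Proof.
move=> [f1 f2] [g1 g2]; split.
- by under eq_fun do rewrite ReD; exact: measurable_funD.
- by under eq_fun do rewrite ImD; exact: measurable_funD.
Qed.

Lemma cmeasurableM f g : cmeasurable f -> cmeasurable g -> cmeasurable (fun x => f x * g x).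
Proof.
move=> [f1 f2] [g1 g2]; split.
- by under eq_fun do rewrite ReM; apply: measurable_funB; exact: measurable_funM.
- by under eq_fun do rewrite ImM; apply: measurable_funD; exact: measurable_funM.
Qed.

Lemma cmeasurable_prod (I : Type) (r : seq I) (F : I -> T -> C) :
  (forall i, cmeasurable (F i)) -> cmeasurable (fun x => \prod_(i <- r) F i x).
Proof.
move=> mF; elim: r => [|i r IH].
  under eq_fun do rewrite big_nil; exact: cmeasurable_cst.
under eq_fun do rewrite big_cons; exact: cmeasurableM.
Qed.

Lemma cmeasurable_real (h : T -> R) : measurable_fun setT h ->
  cmeasurable (fun x => (h x)%:C%C).
Proof. by move=> mh; split => //=; exact: measurable_cst. Qed.

Lemma measurable_sin_cos (h : T -> R) : measurable_fun setT h ->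
  measurable_fun setT (fun x => sin (h x)) /\ measurable_fun setT (fun x => cos (h x)).
Proof.
move=> mh; split.
- apply: (measurableT_comp _ mh); apply: continuous_measurable_fun; exact: continuous_sin.
- apply: (measurableT_comp _ mh); apply: continuous_measurable_fun; exact: continuous_cos.
Qed.

Lemma cmeasurable_cexp f : cmeasurable f -> cmeasurable (fun x => cexp (f x)).
Proof.
move=> [f1 f2]; have [ms mc] := measurable_sin_cos f2.
by split => /=; apply: measurable_funM => //; exact: measurableT_comp.
Qed.

Lemma measurable_nc f : cmeasurable f -> measurable_fun setT (fun x => nc (f x)).
Proof.
move=> [f1 f2].
rewrite (_ : (fun x => _) = fun x => Num.sqrt (Re (f x) ^+ 2 + Im (f x) ^+ 2)); last first.
  by apply/funext => x; case: (f x).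
apply: (@measurableT_comp _ _ _ _ _ _ (@Num.sqrt R)).
  by apply: continuous_measurable_fun; exact: sqrt_continuous.
by apply: measurable_funD; exact: measurable_funX.
Qed.

Lemma measurable_ncE f : cmeasurable f -> measurable_fun setT (fun x => (nc (f x))%:E).
Proof. by move=> mf; apply/measurable_EFinP; exact: measurable_nc. Qed.

Lemma integrable_Re f : cintegrable f -> m.-integrable setT (fun x => (Re (f x))%:E).
Proof.
move=> [[f1 f2] fi]; apply/integrableP; split; first exact/measurable_EFinP.
apply: le_lt_trans fi; apply: ge0_le_integral => //.
- by apply: measurableT_comp => //; exact/measurable_EFinP.
- exact: measurable_ncE.
- by move=> x _; rewrite abse_EFin lee_fin nc_Re.
Qed.

Lemma integrable_Im f : cintegrable f -> m.-integrable setT (fun x => (Im (f x))%:E).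
Proof.
move=> [[f1 f2] fi]; apply/integrableP; split; first exact/measurable_EFinP.
apply: le_lt_trans fi; apply: ge0_le_integral => //.
- by apply: measurableT_comp => //; exact/measurable_EFinP.
- exact: measurable_ncE.
- by move=> x _; rewrite abse_EFin lee_fin nc_Im.
Qed.

Lemma cintegrable_le f (h : T -> R) : cmeasurable f -> measurable_fun setT h ->
  (forall x, 0 <= h x) ->
  {ae m, forall x, nc (f x) <= h x} -> (\int[m]_x (h x)%:E < +oo)%E -> cintegrable f.
Proof.
move=> mf mh h0 fh hi; split=> //; apply: le_lt_trans hi.
apply: ae_ge0_le_integral => //.
- by move=> x _; rewrite lee_fin nc_ge0.
- exact: measurable_ncE.
- by move=> x _; rewrite lee_fin.
- exact/measurable_EFinP.
- by apply: filterS fh => x hx _; rewrite lee_fin.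
Qed.

Lemma cintegrableD f g : cintegrable f -> cintegrable g -> cintegrable (fun x => f x + g x).
Proof.
move=> [mf fi] [mg gi].
apply: (@cintegrable_le _ (fun x => nc (f x) + nc (g x))).
- exact: cmeasurableD.
- by apply: measurable_funD; exact: measurable_nc.
- by move=> x; rewrite addr_ge0// nc_ge0.
- by apply: aeW => x; exact: le_normcD.
under eq_integral do rewrite EFinD.
rewrite ge0_integralD//; first exact: lte_add_pinfty.
- by move=> x _; rewrite lee_fin nc_ge0.
- exact: measurable_ncE.
- by move=> x _; rewrite lee_fin nc_ge0.
- exact: measurable_ncE.
Qed.

Lemma cintegrableZ f (z : C) : cintegrable f -> cintegrable (fun x => z * f x).
Proof.
move=> [mf fi]; split; first by apply: cmeasurableM => //; exact: cmeasurable_cst.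
under eq_integral do rewrite Normc.normcM EFinM.
rewrite ge0_integralZl//; last 3 first.
- exact: measurable_ncE.
- by move=> x _; rewrite lee_fin nc_ge0.
- by rewrite lee_fin nc_ge0.
by rewrite lte_mul_pinfty// lee_fin nc_ge0.
Qed.

Lemma cintegrable0 : cintegrable (fun=> 0).
Proof.
split; first exact: cmeasurable_cst.
by under eq_integral do rewrite Normc.normc0; rewrite integral0.
Qed.

Lemma cintD f g : cintegrable f -> cintegrable g ->
  cint (fun x => f x + g x) = cint f + cint g.
Proof.
move=> fi gi; rewrite /cint.
under eq_Rintegral do rewrite ReD.
under [X in Complex _ X]eq_Rintegral do rewrite ImD.
rewrite !RintegralD//; [exact: integrable_Im|exact: integrable_Im|exact: integrable_Re|exact: integrable_Re].
Qed.

Lemma cintZ f (z : C) : cintegrable f -> cint (fun x => z * f x) = z * cint f.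
Proof.
move=> fi; rewrite /cint; case: z => a b.
have iR := integrable_Re fi; have iI := integrable_Im fi.
under eq_Rintegral do rewrite ReM /=.
under [X in Complex _ X]eq_Rintegral do rewrite ImM /=.
rewrite RintegralB//; [|exact: integrableZl iR|exact: integrableZl iI].
rewrite RintegralD//; [|exact: integrableZl iI|exact: integrableZl iR].
by rewrite !RintegralZl.
Qed.

Lemma cintegrable_sum (I : Type) (r : seq I) (F : I -> T -> C) :
  (forall i, cintegrable (F i)) -> cintegrable (fun x => \sum_(i <- r) F i x).
Proof.
move=> mF; elim: r => [|i r IH].
  under eq_fun do rewrite big_nil; exact: cintegrable0.
under eq_fun do rewrite big_cons; exact: cintegrableD.
Qed.

Lemma cint0 : cint (fun=> 0) = 0.
Proof. by rewrite /cint /= /Rintegral integral0. Qed.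

Lemma cint_sum (I : Type) (r : seq I) (F : I -> T -> C) :
  (forall i, cintegrable (F i)) -> cint (fun x => \sum_(i <- r) F i x) = \sum_(i <- r) cint (F i).
Proof.
move=> mF; elim: r => [|i r IH].
  by rewrite big_nil; under eq_fun do rewrite big_nil; exact: cint0.
rewrite big_cons -IH; under eq_fun do rewrite big_cons.
by rewrite cintD//; exact: cintegrable_sum.
Qed.

Lemma eq_cint f g : f =1 g -> cint f = cint g.
Proof. by move=> /funext ->. Qed.

(** The factor 2 comes from bounding the two components separately. *)
Lemma nc_cint_le f (h : T -> R) (M : R) : cmeasurable f -> measurable_fun setT h ->
  (forall x, 0 <= h x) -> {ae m, forall x, nc (f x) <= h x} ->
  (\int[m]_x (h x)%:E <= M%:E)%E -> nc (cint f) <= 2 * M.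
Proof.
move=> mf mh h0 fh hM.
have fi : cintegrable f.
  by apply: cintegrable_le fh _ => //; exact: le_lt_trans hM (ltry _).
have nM : (\int[m]_x (nc (f x))%:E <= M%:E)%E.
  apply: le_trans hM; apply: ae_ge0_le_integral => //.
  - by move=> x _; rewrite lee_fin nc_ge0.
  - exact: measurable_ncE.
  - by move=> x _; rewrite lee_fin.
  - exact/measurable_EFinP.
  - by apply: filterS fh => x hx _; rewrite lee_fin.
have bd (h' : T -> R) : m.-integrable setT (EFin \o h') -> (forall x, `|h' x| <= nc (f x)) ->
    `|\int[m]_x h' x| <= M.
  move=> hi hn; apply: (le_trans (le_normr_Rintegral measurableT hi)).
  have /integrableP[mh' fin] := hi.
  rewrite -lee_fin; apply: le_trans nM; rewrite /Rintegral fineK; last first.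
    by rewrite ge0_fin_numE// integral_ge0.
  apply: ge0_le_integral => //.
  - have m1 : measurable_fun setT h' by exact/measurable_EFinP.
    by apply/measurable_EFinP; apply: measurableT_comp.
  - exact: measurable_ncE.
  - by move=> x _; rewrite lee_fin.
apply: le_trans (nc_le _) _; rewrite mulr_natl mulr2n; apply: lerD.
- by apply: bd; [exact: integrable_Re|move=> x; exact: nc_Re].
- by apply: bd; [exact: integrable_Im|move=> x; exact: nc_Im].
Qed.

End complex_integral.

Section complex_fubini.
Context {d1 d2} {T1 : measurableType d1} {T2 : measurableType d2} {R : realType}.
Variables (m1 : {sigma_finite_measure set T1 -> \bar R})
  (m2 : {sigma_finite_measure set T2 -> \bar R}).
Local Notation C := R[i].
Local Notation Re := (@complex.Re R).
Local Notation Im := (@complex.Im R).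
Local Notation nc := (@Normc.normc R).

Let Rfubini (p : T1 * T2 -> R) : (m1 \x m2)%E.-integrable setT (fun z => (p z)%:E) ->
  (forall x, m2.-integrable setT (fun y => (p (x, y))%:E)) ->
  (forall y, m1.-integrable setT (fun x => (p (x, y))%:E)) ->
  [/\ \int[m1]_x \int[m2]_y p (x, y) = \int[(m1 \x m2)%E]_z p z,
    \int[m2]_y \int[m1]_x p (x, y) = \int[(m1 \x m2)%E]_z p z,
    measurable_fun setT (fun x => \int[m2]_y p (x, y)) &
    measurable_fun setT (fun y => \int[m1]_x p (x, y))].
Proof.
move=> pi px py; split.
- rewrite [RHS]/Rintegral -(integral12_prod_meas1 pi) /Rintegral; congr fine.
  apply: eq_integral => x _; rewrite fineK//; exact: integrable_fin_num (px x).
- rewrite [RHS]/Rintegral -(integral21_prod_meas1 pi) /Rintegral; congr fine.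
  apply: eq_integral => y _; rewrite fineK//; exact: integrable_fin_num (py y).
- apply: (measurableT_comp (fine_measurable measurableT)).
  exact: (measurable_fubini_F pi).
- apply: (measurableT_comp (fine_measurable measurableT)).
  exact: (measurable_fubini_G pi).
Qed.

Variable p : T1 * T2 -> C.
Hypotheses (ip : cintegrable (m1 \x m2)%E p)
  (ip1 : forall x, cintegrable m2 (fun y => p (x, y)))
  (ip2 : forall y, cintegrable m1 (fun x => p (x, y))).

Let fR := Rfubini (integrable_Re ip) (fun x => integrable_Re (ip1 x)) (fun y => integrable_Re (ip2 y)).
Let fI := Rfubini (integrable_Im ip) (fun x => integrable_Im (ip1 x)) (fun y => integrable_Im (ip2 y)).

Lemma cint_prod12 : cint m1 (fun x => cint m2 (fun y => p (x, y))) = cint (m1 \x m2)%E p.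
Proof. by case: fR fI => [a _ _ _] [b _ _ _]; rewrite /cint /= a b. Qed.

Lemma cint_prod21 : cint m2 (fun y => cint m1 (fun x => p (x, y))) = cint (m1 \x m2)%E p.
Proof. by case: fR fI => [_ a _ _] [_ b _ _]; rewrite /cint /= a b. Qed.

Lemma cint_fubini : cint m1 (fun x => cint m2 (fun y => p (x, y))) =
  cint m2 (fun y => cint m1 (fun x => p (x, y))).
Proof. by rewrite cint_prod12 cint_prod21. Qed.

Lemma cmeasurable_cint2 : cmeasurable (fun y => cint m1 (fun x => p (x, y))).
Proof. by case: fR fI => [_ _ _ a] [_ _ _ b]. Qed.

End complex_fubini.

Section complex_product.
Variable R : realType.
Local Notation C := R[i].
Local Notation mu := (@lebesgue_measure R).
Local Notation mR := (measurableTypeR R).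
Local Notation Re := (@complex.Re R).
Local Notation Im := (@complex.Im R).
Local Notation nc := (@Normc.normc R).

Lemma nc_prod (I : Type) (r : seq I) (F : I -> C) : nc (\prod_(i <- r) F i) = \prod_(i <- r) nc (F i).
Proof. by apply: big_morph => [x y|]; [exact: Normc.normcM|exact: Normc.normc1]. Qed.

Lemma nc_sum (I : Type) (r : seq I) (F : I -> C) : nc (\sum_(i <- r) F i) <= \sum_(i <- r) nc (F i).
Proof.
elim: r => [|i r IH]; first by rewrite !big_nil Normc.normc0.
by rewrite !big_cons; apply: le_trans (le_normcD _ _) _; rewrite lerD2l.
Qed.

Lemma cmeasurable_comp d1 d2 (T1 : measurableType d1) (T2 : measurableType d2)
    (f : T2 -> C) (phi : T1 -> T2) : cmeasurable f -> measurable_fun setT phi ->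
  cmeasurable (fun x => f (phi x)).
Proof.
by move=> [f1 f2] mphi; split; [exact: (measurableT_comp f1 mphi)|exact: (measurableT_comp f2 mphi)].
Qed.

Lemma cmeasurable_prod_coord n (g : 'I_n -> mR -> C) : (forall i, cmeasurable (g i)) ->
  cmeasurable (fun x : 'cV[R]_n => \prod_i g i (x i ord0)).
Proof.
move=> mg; apply: cmeasurable_prod => i.
exact: (cmeasurable_comp (mg i) (measurable_coord i)).
Qed.

Lemma cint_cVS n (f : 'cV[R]_n.+1 -> C) : cintegrable (lebesgue_cV R n.+1) f ->
  cint (lebesgue_cV R n.+1) f = cint (mu \x lebesgue_cV R n)%E (f \o @cons_cV R n) /\
  cintegrable (mu \x lebesgue_cV R n)%E (f \o @cons_cV R n).
Proof.
move=> fi; have [mf foo] := fi.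
have [mf1 mf2] := mf.
have mfc : cmeasurable (f \o @cons_cV R n).
  exact: (cmeasurable_comp mf (@measurable_cons_cV R n)).
have ic : cintegrable (mu \x lebesgue_cV R n)%E (f \o @cons_cV R n).
  split => //; move: foo.
  rewrite [X in (X < _)%E -> _]ge0_integral_pushforward//.
  - exact: measurable_cons_cV.
  - exact: measurable_ncE.
  - by move=> x _; rewrite lee_fin nc_ge0.
split => //; rewrite /cint /Rintegral; congr Complex; congr fine.
- rewrite [LHS]integral_pushforward//.
  + exact: measurable_cons_cV.
  + exact/measurable_EFinP.
  + by rewrite preimage_setT; exact: (integrable_Re ic).
- rewrite [LHS]integral_pushforward//.
  + exact: measurable_cons_cV.
  + exact/measurable_EFinP.
  + by rewrite preimage_setT; exact: (integrable_Im ic).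
Qed.

Lemma cintegrable_prod n (g : 'I_n -> mR -> C) : (forall i, cintegrable mu (g i)) ->
  cintegrable (lebesgue_cV R n) (fun x => \prod_i g i (x i ord0)).
Proof.
move=> ig; split; first by apply: cmeasurable_prod_coord => i; case: (ig i).
under eq_integral do rewrite nc_prod.
pose k i := fine (\int[mu]_t (nc (g i t))%:E).
apply: (@le_lt_trans _ _ (\prod_i k i)%:E); last exact: ltry.
apply: (integral_prod_coord_le (phi := fun i t => nc (g i t))).
- by move=> i; apply: measurable_nc; case: (ig i).
- by move=> i t; exact: nc_ge0.
- move=> i; rewrite /k fineK// ge0_fin_numE; first by case: (ig i).
  by apply: integral_ge0 => t _; rewrite lee_fin nc_ge0.
Qed.

Lemma cint_prod n (g : 'I_n -> mR -> C) : (forall i, cintegrable mu (g i)) ->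
  cint (lebesgue_cV R n) (fun x => \prod_i g i (x i ord0)) = \prod_i cint mu (g i).
Proof.
elim: n g => [|n IH] g ig.
  rewrite big_ord0 (eq_cint _ (g := fun=> 1)); last by move=> x; rewrite big_ord0.
  rewrite /cint /Rintegral /=; congr Complex.
    by rewrite integral_dirac// diracT mul1e.
  by rewrite integral0.
have [-> ic] := cint_cVS (cintegrable_prod ig).
pose G := fun x : 'cV[R]_n => \prod_i g (lift ord0 i) (x i ord0).
have iG : cintegrable (lebesgue_cV R n) G by exact: (cintegrable_prod (g := fun i => g (lift ord0 i))).
have E t x : ((fun x => \prod_i g i (x i ord0)) \o @cons_cV R n) (t, x) = g ord0 t * G x.
  by rewrite /= big_ord_recl cons_cV0; congr (_ * _); apply: eq_bigr => i _; rewrite cons_cVS.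
rewrite -cint_prod12//.
- rewrite (eq_cint _ (g := fun t => cint (lebesgue_cV R n) G * g ord0 t)).
    rewrite cintZ// big_ord_recl mulrC; congr (_ * _).
    exact: (IH (fun i => g (lift ord0 i))).
  move=> t; rewrite (eq_cint _ (g := fun x => g ord0 t * G x)) => [|x]; last exact: E.
  by rewrite cintZ// mulrC.
- move=> t; have -> : (fun x => ((fun x => \prod_i g i (x i ord0)) \o @cons_cV R n) (t, x)) =
    (fun x => g ord0 t * G x) by apply/funext => x; exact: E.
  exact: cintegrableZ.
- move=> x; have -> : (fun t => ((fun x => \prod_i g i (x i ord0)) \o @cons_cV R n) (t, x)) =
    (fun t => G x * g ord0 t) by apply/funext => t; rewrite mulrC; exact: E.
  exact: cintegrableZ.
Qed.

End complex_product.

Lemma pow2_small (R : realType) (K e : R) : 0 <= K -> 0 < e ->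
  exists N0, forall N, (N0 <= N)%N -> K / 2 ^+ N <= e.
Proof.
move=> K0 e0; exists (Num.bound (K / e)) => N hN.
rewrite ler_pdivrMr ?exprn_gt0// mulrC -ler_pdivrMr//.
have h := archi_boundP (divr_ge0 K0 (ltW e0)).
apply: (le_trans (ltW h)); rewrite -natrX ler_nat.
by apply: (leq_trans hN); rewrite ltnW// ltn_expl.
Qed.

Section power_series_uniqueness.
Variable R : realType.

(** Identity theorem for a power series whose partial sums converge to 0 on [0, 1] at a
  geometric rate. *)
Lemma power_series_constant (m : nat -> R) (K : R) : 0 <= K ->
  (forall (N : nat) (x : R), 0 <= x <= 1 ->
    `|\sum_(n < N) m n.+1 * x ^+ n.+1| <= K / 2 ^+ N) ->
  forall n, m n.+1 = 0.
Proof.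
move=> K0 hK.
have two0 (n : nat) : 0 < (2 ^+ n)^-1 :> R by rewrite invr_gt0 exprn_gt0.
have mb n : `|m n.+1| <= 3 * K / 2 ^+ n.+1.
  have h1 := hK n.+1 1 (ltac:(by rewrite ler01 lexx)).
  have h2 := hK n 1 (ltac:(by rewrite ler01 lexx)).
  rewrite big_ord_recr /= expr1n mulr1 in h1.
  have -> : m n.+1 = (\sum_(i < n) m i.+1 * 1 ^+ i.+1 + m n.+1) - \sum_(i < n) m i.+1 * 1 ^+ i.+1.
    by rewrite addrC addKr.
  apply: le_trans (ler_normB _ _) _; apply: le_trans (lerD h1 h2) _.
  rewrite (_ : K / 2 ^+ n = 2 * K / 2 ^+ n.+1); first by rewrite -mulrDl -[X in X + _]mul1r -mulrDl.
  by rewrite exprS; field; rewrite expf_neq0.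
move=> k; elim/ltn_ind: k => k IH.
(* if all the previous coefficients vanish, the k-th one dominates the rest near 0 *)
have key (x : R) : 0 < x <= 1 -> `|m k.+1| <= 3 * K * x.
  move=> /andP[x0 x1].
  suff : forall N, `|m k.+1| * x ^+ k.+1 <= K / 2 ^+ (k.+1 + N) + 3 * K * x ^+ k.+2.
    move=> h; rewrite -(ler_pM2r (exprn_gt0 k.+1 x0)) -[leRHS]mulrA -exprS.
    apply/ler_addgt0Pr => e e0.
    have [N /(_ (k.+1 + N)%N (leq_addl _ _)) hN] := pow2_small K0 e0.
    by apply: le_trans (h N) _; rewrite addrC lerD2l.
  move=> N.
  have := hK (k.+1 + N)%N x (ltac:(by rewrite (ltW x0))).
  rewrite big_split_ord /= big_ord_recr /= big1 ?add0r; last first.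
    by move=> i _; rewrite IH ?mul0r.
  set S := \sum_(i < N) _ => hS.
  have SB : `|S| <= 3 * K * x ^+ k.+2.
    apply: le_trans (ler_norm_sum _ _ _) _.
    apply: (@le_trans _ _ (\sum_(i < N) 3 * K * x ^+ k.+2 / 2 ^+ i.+1)).
      apply: ler_sum => i _; rewrite normrM normrX (gtr0_norm x0).
      apply: le_trans (ler_wpM2r (exprn_ge0 _ (ltW x0)) (mb _)) _.
      rewrite mulrAC -[leRHS]mulrA -[leLHS]mulrA; rewrite -[leLHS]mulrA.
      rewrite -[leRHS]mulrA; apply: ler_wpM2l => //; apply: ler_wpM2l => //.
      apply: ler_pM; rewrite ?exprn_ge0 ?(ltW x0) ?(ltW (two0 _))//.
        by rewrite ler_wiXn2l// ?(ltW x0)// addSn !ltnS leq_addr.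
      by rewrite lef_pV2 ?posrE ?exprn_gt0// ler_eXn2l// ?ltr1n// ltnS leq_addl.
    have C0 : 0 <= 3 * K * x ^+ k.+2.
      by apply: mulr_ge0; [exact: mulr_ge0|exact/exprn_ge0/ltW].
    rewrite -mulr_sumr (ler_piMr C0)//.
    have -> : \sum_(i < N) (2 ^+ i.+1)^-1 = 1 - (2 ^+ N)^-1 :> R.
      elim: N {S hS} => [|N IHN]; first by rewrite big_ord0 expr0 invr1 subrr.
      rewrite big_ord_recr /= IHN exprS; field; by rewrite expf_neq0.
    by rewrite lerBlDr lerDl ltW.
  rewrite -(gtr0_norm (exprn_gt0 k.+1 x0)) -normrM.
  have -> : m k.+1 * x ^+ k.+1 = (m k.+1 * x ^+ k.+1 + S) - S by rewrite addrK.
  apply: le_trans (ler_normB _ _) _; exact: lerD.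
apply/eqP; rewrite -normr_le0 leNgt; apply/negP => m0.
have c0 : 0 < 3 * K + `|m k.+1| by rewrite ltr_wpDl// mulr_ge0.
pose x := `|m k.+1| / (2 * (3 * K + `|m k.+1|)).
have x0 : 0 < x by rewrite divr_gt0// mulr_gt0.
have := key x; rewrite x0 /= ler_pdivrMr ?mulr_gt0// => /(_ _)/wrap[].
  have : 0 <= 3 * K by rewrite mulr_ge0.
  by rewrite mul1r; lra.
rewrite leNgt /x mulrCA => /negP; apply.
rewrite gtr_pMr// ltr_pdivrMr ?mulr_gt0// mul1r.
have : 0 <= 3 * K by rewrite mulr_ge0.
by lra.
Qed.

End power_series_uniqueness.

(** * Gaussian integrals *)

Section gaussian_integrals.
Variable R : realType.
Local Notation C := R[i].
Local Notation mu := (@lebesgue_measure R).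
Local Notation mR := (measurableTypeR R).
Local Notation Re := (@complex.Re R).
Local Notation Im := (@complex.Im R).
Local Notation nc := (@Normc.normc R).
Local Notation toC := (real_complex R).

Lemma measurable_expabs (b s : R) : measurable_fun setT (fun t : mR => expR (b * `|t| - s * t ^+ 2)).
Proof.
apply: measurableT_comp => //; apply: measurable_funB; apply: measurable_funM => //.
Qed.

(** Completing the square: [b t - s t ^ 2 <= b ^ 2 / (2 s) - (s / 2) t ^ 2]. *)
Lemma expabs_integral (b s : R) : 0 < s ->
  exists2 M : R, 0 <= M & (\int[mu]_t (expR (b * `|t| - s * t ^+ 2))%:E <= M%:E)%E.
Proof.
move=> s0.
pose al := Num.sqrt (s / 2); have al0 : 0 < al by rewrite sqrtr_gt0 divr_gt0.
have al2 : al ^+ 2 = s / 2 by rewrite sqr_sqrtr// ltW// divr_gt0.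
exists (expR (b ^+ 2 / (2 * s)) * (al^-1 * Num.sqrt pi)).
  by rewrite mulr_ge0 ?expR_ge0// mulr_ge0 ?invr_ge0 ?sqrtr_ge0// ltW.
apply: (@le_trans _ _ (\int[mu]_t ((expR (b ^+ 2 / (2 * s)))%:E * (gauss_fun (al * t + 0))%:E))%E).
  apply: ge0_le_integral => //.
  - by apply/measurable_EFinP; exact: measurable_expabs.
  - apply: measurable_funeM; apply/measurable_EFinP.
    exact: (measurableT_comp measurable_gauss_fun (measurable_aff al 0)).
  - move=> t _; rewrite -EFinM lee_fin /gauss_fun addr0 -expRD ler_expR exprMn al2.
    rewrite -subr_ge0 (_ : _ - _ = (s * `|t| - b) ^+ 2 / (2 * s)).
      by rewrite divr_ge0 ?sqr_ge0// mulr_ge0// ltW.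
    rewrite -(real_normK (num_real t)); field; exact: lt0r_neq0.
have mg : measurable_fun setT (fun t : mR => (gauss_fun (al * t + 0))%:E).
  by apply/measurable_EFinP; exact: (measurableT_comp measurable_gauss_fun (measurable_aff al 0)).
rewrite ge0_integralZl//; last by move=> t _; rewrite lee_fin gauss_fun_ge0.
rewrite (@ge0_integral_aff R al 0 (fun t => (gauss_fun t)%:E))//.
- by rewrite integralT_gauss -!EFinM.
- by apply/measurable_EFinP; exact: measurable_gauss_fun.
- by move=> t; rewrite lee_fin gauss_fun_ge0.
Qed.

Lemma cint_aff (a b : R) (f : mR -> C) : 0 < a -> cintegrable mu f ->
  cint mu (fun t => f (a * t + b)) = toC a^-1 * cint mu f.
Proof.
move=> a0 fi.
suff H (h : mR -> R) : mu.-integrable setT (fun t => (h t)%:E) ->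
    \int[mu]_t h (a * t + b) = a^-1 * \int[mu]_t h t.
  rewrite /cint (H _ (integrable_Re fi)) (H _ (integrable_Im fi)).
  by congr Complex; rewrite /= mul0r ?subr0 ?addr0.
move=> hi; rewrite /Rintegral.
have := integrable_pos_fin_num measurableT hi; have := integrable_neg_fin_num measurableT hi.
have /integrableP[mh _] := hi.
rewrite [in LHS]integralE [in RHS]integralE.
set h1 : mR -> \bar R := fun t => (h t)%:E.
have -> : ((fun t : mR => (h (a * t + b)%R)%:E)^\+ = (fun t : mR => h1^\+ (a * t + b)%R))%E.
  exact: (funepos_comp h1 (fun t : mR => a * t + b)).
have -> : ((fun t : mR => (h (a * t + b)%R)%:E)^\- = (fun t : mR => h1^\- (a * t + b)%R))%E.
  exact: (funeneg_comp h1 (fun t : mR => a * t + b)).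
rewrite !ge0_integral_aff//; [|exact: measurable_funeneg|exact: measurable_funepos].
move=> f1 f2; rewrite -(fineK f1) -(fineK f2) -!EFinM -!EFinB /=.
by rewrite mulrBr.
Qed.

Lemma cintegrable_aff (a b : R) (f : mR -> C) : 0 < a -> cintegrable mu f ->
  cintegrable mu (fun t => f (a * t + b)).
Proof.
move=> a0 [mf fi]; split.
  case: mf => f1 f2; have ma := measurable_aff a b.
  by split; [exact: (measurableT_comp f1 ma)|exact: (measurableT_comp f2 ma)].
rewrite (@ge0_integral_aff R a b (fun t => (nc (f t))%:E))//.
- by rewrite lte_mul_pinfty// lee_fin invr_ge0 ltW.
- exact: measurable_ncE.
- by move=> t; rewrite lee_fin nc_ge0.
Qed.

Lemma cmeasurable_hphase (z : C) : cmeasurable (fun t : mR => hphase t z).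
Proof.
rewrite /hphase; apply: cmeasurableD; last exact: cmeasurable_cst.
apply: cmeasurableM; last exact: cmeasurable_cst.
by apply: cmeasurable_real; exact: measurable_funM.
Qed.

Lemma measurable_gauss (s : R) : measurable_fun setT (fun t : mR => expR (- (s * t ^+ 2))).
Proof.
by apply: measurableT_comp => //; apply: measurableT_comp => //; apply: measurable_funM => //; exact: measurable_funX.
Qed.

(** The kernel of the Bargmann transform is the case [s = 1 / 2]. The case [s = 1], in which
  the exponent is [- (t - z) ^ 2], is the one whose integral does not depend on [z]. *)
Definition hgauss (s t : R) (z : C) : C := cexp (hphase t z) * toC (expR (- (s * t ^+ 2))).

Lemma cmeasurable_hgauss s (z : C) : cmeasurable (fun t : mR => hgauss s t z).
Proof.
apply: cmeasurableM; first by apply: cmeasurable_cexp; exact: cmeasurable_hphase.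
by apply: cmeasurable_real; exact: measurable_gauss.
Qed.

Lemma nc_hgauss s t (z : C) :
  nc (hgauss s t z) = expR (2 * t * Re z - Re z ^+ 2 + Im z ^+ 2 - s * t ^+ 2).
Proof.
rewrite Normc.normcM nc_cexp nc_real (ger0_norm (expR_ge0 _)) -expRD; congr expR.
congr (_ - _); case: z => p q; rewrite /hphase /= ; ring.
Qed.

Lemma nc_hgauss_le s t (z : C) (rho : R) : nc z <= rho ->
  nc (hgauss s t z) <= expR (rho ^+ 2) * expR (2 * rho * `|t| - s * t ^+ 2).
Proof.
move=> zr; rewrite Normc.normcM nc_cexp nc_real (ger0_norm (expR_ge0 _)) -!expRD ler_expR.
have := le_trans (ler_norm _) (hphase_le t zr); lra.
Qed.

Lemma cintegrable_hgauss s (z : C) : 0 < s -> cintegrable mu (fun t => hgauss s t z).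
Proof.
move=> s0; have [M M0 hM] := expabs_integral (2 * nc z) s0.
apply: (cintegrable_le
    (h := fun t : mR => expR (nc z ^+ 2) * expR (2 * nc z * `|t| - s * t ^+ 2))).
- exact: cmeasurable_hgauss.
- by apply: measurable_funM => //; exact: measurable_expabs.
- by move=> t; rewrite mulr_ge0 ?expR_ge0.
- by apply: aeW => t; exact: nc_hgauss_le.
under eq_integral do rewrite EFinM.
rewrite ge0_integralZl//.
  by rewrite lte_mul_pinfty ?lee_fin ?expR_ge0//; exact: le_lt_trans hM (ltry _).
by apply/measurable_EFinP; exact: measurable_expabs.
Qed.

End gaussian_integrals.

Section gaussian_fourier.
Variable R : realType.
Local Notation C := R[i].
Local Notation mu := (@lebesgue_measure R).
Local Notation mR := (measurableTypeR R).
Local Notation Re := (@complex.Re R).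
Local Notation Im := (@complex.Im R).
Local Notation nc := (@Normc.normc R).
Local Notation toC := (real_complex R).

Lemma measurable_horner (p : {poly R}) : measurable_fun setT (fun t : mR => p.[t]).
Proof.
elim/poly_ind: p => [|p c IH].
  by under eq_fun do rewrite horner0; exact: measurable_cst.
under eq_fun do rewrite hornerMXaddC.
by apply: measurable_funD => //; exact: measurable_funM.
Qed.

Lemma measurable_hcoef n : measurable_fun setT (fun t : mR => hcoef t n).
Proof. by apply: measurable_funM => //; exact: measurable_horner. Qed.

Lemma hpartial_horner (t : R) N (w : C) :
  (hpartial t N).[w] = \sum_(n < N) w ^+ n * toC (hcoef t n).
Proof.
rewrite /hpartial horner_sum; apply: eq_bigr => i _.
by rewrite hornerZ hornerXn mulrC.
Qed.

Lemma cintegrable_hcoef s n : 0 < s ->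
  cintegrable mu (fun t : mR => toC (hcoef t n) * toC (expR (- (s * t ^+ 2)))).
Proof.
move=> s0; have [M M0 hM] := expabs_integral 2 s0.
apply: (cintegrable_le (h := fun t : mR => expR 2 * expR (2 * `|t| - s * t ^+ 2))).
- by apply: cmeasurableM; apply: cmeasurable_real; [exact: measurable_hcoef|exact: measurable_gauss].
- by apply: measurable_funM => //; exact: measurable_expabs.
- by move=> t; rewrite mulr_ge0 ?expR_ge0.
- apply: aeW => t; rewrite Normc.normcM !nc_real (ger0_norm (expR_ge0 _)).
  have := hcoef_le t n (@ler01 R); rewrite !expr1n !mulr1 => h.
  apply: le_trans (ler_wpM2r (expR_ge0 _) h) _.
  by rewrite -!expRD ler_expR; lra.
under eq_integral do rewrite EFinM.
rewrite ge0_integralZl//.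
  by rewrite lte_mul_pinfty ?lee_fin ?expR_ge0//; exact: le_lt_trans hM (ltry _).
by apply/measurable_EFinP; exact: measurable_expabs.
Qed.

Let m n := \int[mu]_t (hcoef t n * expR (- (1 * t ^+ 2))).

Let cint_hcoef n :
  cint mu (fun t : mR => toC (hcoef t n) * toC (expR (- (1 * t ^+ 2)))) = toC (m n).
Proof.
rewrite /cint /m; congr Complex.
  by apply: eq_Rintegral => t _; rewrite ReM /= mul0r subr0.
by rewrite /Rintegral (eq_integral (fun=> 0%E)) ?integral0// => t _; rewrite ImM /= mulr0 mul0r addr0.
Qed.

(** The integral is a limit of polynomials in [w], whose coefficients are the moments
  [m n]. *)
Let Phi_close (rho : R) : exists2 K : R, 0 <= K & forall (w : C) N, nc w <= rho ->
  nc (cint mu (fun t => hgauss 1 t w) - \sum_(n < N.+1) w ^+ n * toC (m n)) <= K / 2 ^+ N.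
Proof.
have [M M0 hM] := expabs_integral (12 * rho) (@ltr01 R).
exists (2 * (2 * expR (36 * rho ^+ 2) * M)).
  by rewrite !mulr_ge0 ?expR_ge0.
move=> w N wr.
pose q n (t : mR) := w ^+ n * (toC (hcoef t n) * toC (expR (- (1 * t ^+ 2)))).
have iq n : cintegrable mu (q n) by apply: cintegrableZ; exact: cintegrable_hcoef.
have -> : \sum_(n < N.+1) w ^+ n * toC (m n) = cint mu (fun t => \sum_(n < N.+1) q n t).
  rewrite cint_sum//; apply: eq_bigr => i _.
  by rewrite cintZ ?cint_hcoef//; exact: cintegrable_hcoef.
have iG := @cintegrable_hgauss R 1 w ltr01.
have iS : cintegrable mu (fun t => \sum_(n < N.+1) q n t) by exact: cintegrable_sum.
rewrite -mulN1r -cintZ// -cintD//; last exact: cintegrableZ.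
rewrite -[leRHS]mulrA.
apply: (nc_cint_le (h := fun t : mR =>
  2 * expR (36 * rho ^+ 2) / 2 ^+ N * expR (12 * rho * `|t| - 1 * t ^+ 2))).
- apply: cmeasurableD; first exact: cmeasurable_hgauss.
  by case: (cintegrableZ (-1) iS).
- by apply: measurable_funM => //; exact: measurable_expabs.
- by move=> t; rewrite mulr_ge0 ?expR_ge0// divr_ge0 ?mulr_ge0 ?expR_ge0 ?exprn_ge0.
- apply: aeW => t.
  have -> : hgauss 1 t w + -1 * (\sum_(n < N.+1) q n t) =
      (cexp (hphase t w) - (hpartial t N.+1).[w]) * toC (expR (- (1 * t ^+ 2))).
    rewrite mulrBl mulN1r hpartial_horner mulr_suml; congr (_ - _).
    by apply: eq_bigr => i _; rewrite /q mulrA.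
  rewrite Normc.normcM nc_real (ger0_norm (expR_ge0 _)).
  apply: le_trans (ler_wpM2r (expR_ge0 _) (hpartial_close t N wr)) _.
  rewrite /hbound -!mulrA ler_wpM2l// [X in _ <= _ * X]mulrC mulrCA [leLHS]mulrC.
  by rewrite [leRHS]mulrA -!expRD ler_wpM2r ?invr_ge0 ?exprn_ge0// ler_expR; lra.
have cp : 0 <= 2 * expR (36 * rho ^+ 2) / 2 ^+ N.
  by rewrite divr_ge0 ?mulr_ge0 ?expR_ge0 ?exprn_ge0.
have mE : measurable_fun setT (fun t : mR => (expR (12 * rho * `|t| - 1 * t ^+ 2))%:E).
  by apply/measurable_EFinP; exact: measurable_expabs.
under eq_integral do rewrite EFinM.
rewrite ge0_integralZl//.
rewrite [X in (_ <= X%:E)%E]mulrAC [in leRHS]EFinM.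
by apply: lee_wpmul2l; rewrite ?lee_fin.
Qed.

Let Phi_real (x : R) : cint mu (fun t => hgauss 1 t (toC x)) = toC (Num.sqrt pi).
Proof.
rewrite /cint; have E t : hgauss 1 t (toC x) = toC (gauss_fun (1 * t - x)).
  rewrite /hgauss /hphase /cexp /=; congr Complex; rewrite !(mul0r, mulr0, addr0, subr0, sin0, cos0, mulr1, subrr)//.
  by rewrite /gauss_fun -expRD; congr expR; ring.
congr Complex; last first.
  by rewrite /Rintegral (eq_integral (fun=> 0%E)) ?integral0// => t _; rewrite E.
transitivity (\int[mu]_t gauss_fun (1 * t - x)); first by apply: eq_Rintegral => t _; rewrite E.
rewrite /Rintegral (@ge0_integral_aff R 1 (- x) (fun t => (gauss_fun t)%:E))//.
- by rewrite invr1 mul1e integralT_gauss.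
- by apply/measurable_EFinP; exact: measurable_gauss_fun.
- by move=> t; rewrite lee_fin gauss_fun_ge0.
Qed.

(** Both sides are power series in [w]; they agree for real [w] by translation
  invariance, hence coefficientwise. *)
Lemma cint_hgauss1 (w : C) : cint mu (fun t => hgauss 1 t w) = toC (Num.sqrt pi).
Proof.
have m0 : m 0 = Num.sqrt pi.
  transitivity (Re (cint mu (fun t => hgauss 1 t (toC 0)))); last by rewrite Phi_real.
  apply: eq_Rintegral => t _.
  rewrite hcoef0 mul1r /hgauss (_ : hphase t (toC 0) = 0) ?cexp0 ?mul1r//.
  by rewrite /hphase rmorph0; ring.
have mS : forall n, m n.+1 = 0.
  have [K K0 hK] := Phi_close 1.
  apply: (power_series_constant K0) => N x /andP[x0 x1].
  have := hK (toC x) N; rewrite nc_real ger0_norm// => /(_ x1).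
  rewrite Phi_real big_ord_recl expr0 mul1r m0 opprD addrA subrr add0r normcN.
  congr (_ <= _); rewrite -nc_real; congr nc.
  rewrite rmorph_sum; apply: eq_bigr => i _.
  by rewrite lift0 rmorphM rmorphXn mulrC.
have [K K0 hK] := Phi_close (nc w).
apply/eqP; rewrite -subr_eq0; apply/eqP/(@Normc.eq0_normc R)/eqP.
rewrite eq_le nc_ge0 andbT; apply/ler_addgt0Pr => e e0; rewrite add0r.
have [N hN] := pow2_small K0 e0.
have := hK w N (lexx _); rewrite big_ord_recl expr0 mul1r m0 big1 ?addr0; last first.
  by move=> i _; rewrite mS rmorph0 mulr0.
by move=> /le_trans; apply; exact: hN.
Qed.

(** Gaussians are eigenfunctions of the Fourier transform, jointly for all [z]: after
  completing the square and scaling by [sqrt 2], this is [cint_hgauss1] at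
  [w = i (2 z - y) / sqrt 2]. *)
Lemma hgauss_fourier (y : R) (z : C) :
  cint mu (fun t => hgauss 2^-1 t (Complex 0 1 * z) * cexp (Complex 0 (- (y * t))))
  = toC (Num.sqrt 2 * Num.sqrt pi) * hgauss 2^-1 y z.
Proof.
pose s2 := Num.sqrt 2 : R.
have s20 : 0 < s2 by rewrite sqrtr_gt0.
have s22 : s2 * s2 = 2 by rewrite -expr2 sqr_sqrtr.
pose w : C := Complex 0 1 * (2 * z - toC y) * toC s2^-1.
have E t : hgauss 2^-1 t (Complex 0 1 * z) * cexp (Complex 0 (- (y * t)))
   = hgauss 2^-1 y z * hgauss 1 (s2^-1 * t + 0) w.
  have toCexp x : toC (expR x) = cexp (toC x).
    by rewrite /cexp /= cos0 sin0 mulr1 mulr0.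
  rewrite /hgauss !toCexp -!cexpD; congr cexp.
  pose I : C := Complex 0 1; have I2 : I * I = -1 by rewrite -expr2 sqr_i.
  pose s : C := toC s2^-1; have ss : s * s = 2^-1.
    by rewrite -rmorphM -invfM s22 rmorphV ?unitfE// rmorph_nat.
  have -> : Complex 0 (- (y * t)) = - (I * (toC y * toC t)).
    by rewrite -rmorphM; congr Complex; ring.
  have tM (a b : R) : toC (a * b) = toC a * toC b by rewrite rmorphM.
  have tN (a : R) : toC (- a) = - toC a by rewrite rmorphN.
  have t2 : toC 2 = 2 by rewrite rmorph_nat.
  have t2V : toC 2^-1 = 2^-1 by rewrite rmorphV ?unitfE// rmorph_nat.
  rewrite /hphase addr0 -/I mul1r !expr2 !tN !tM t2 t2V -/s.
  have -> : w = I * (2 * z - toC y) * s by [].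
  have -> : I * z * (I * z) = I * I * (z * z) by ring.
  have -> : I * (2 * z - toC y) * s * (I * (2 * z - toC y) * s)
      = I * I * (s * s) * ((2 * z - toC y) * (2 * z - toC y)) by ring.
  have -> : s * toC t * (s * toC t) = s * s * (toC t * toC t) by ring.
  have -> : 2 * (s * toC t) * (I * (2 * z - toC y) * s)
      = 2 * (s * s) * toC t * I * (2 * z - toC y) by ring.
  rewrite ss I2; clear I2; clearbody I; move: (toC t) (toC y) => t' y'.
  by field.
transitivity (cint mu (fun t : mR => hgauss 2^-1 y z * hgauss 1 (s2^-1 * t + 0) w)).
  exact: eq_cint.
rewrite cintZ; last first.
  apply: (@cintegrable_aff R s2^-1 0 (fun t => hgauss 1 t w)); last exact: cintegrable_hgauss.
  by rewrite invr_gt0.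
rewrite (@cint_aff R s2^-1 0 (fun t => hgauss 1 t w)) ?invr_gt0//; last exact: cintegrable_hgauss.
by rewrite cint_hgauss1 invrK -rmorphM mulrC.
Qed.

End gaussian_fourier.

(** * The Bargmann transform and its Taylor expansion *)

Section skewed_products.
Variables (R : realType) (n : nat) (S : 'M[R]_n).
Local Notation C := R[i].
Local Notation mu := (@lebesgue_measure R).
Local Notation L := (lebesgue_cV R n).
Local Notation mR := (measurableTypeR R).
Local Notation nc := (@Normc.normc R).
Local Notation toC := (real_complex R).

Lemma measurable_mulmx_coord i : measurable_fun setT (fun x : 'cV[R]_n => (S *m x) i ord0 : mR).
Proof. exact: (measurableT_comp (measurable_coord i) (measurable_mulmx S)). Qed.

Lemma measurable_prod_mulmx (phi : 'I_n -> mR -> R) :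
  (forall i, measurable_fun setT (phi i)) ->
  measurable_fun setT (fun x : 'cV[R]_n => \prod_i phi i ((S *m x) i ord0)).
Proof.
move=> mphi; apply: measurable_prod => i _.
exact: (measurableT_comp (mphi i) (measurable_mulmx_coord i)).
Qed.

Lemma cmeasurable_prod_mulmx (g : 'I_n -> mR -> C) : (forall i, cmeasurable (g i)) ->
  cmeasurable (fun x : 'cV[R]_n => \prod_i g i ((S *m x) i ord0)).
Proof.
move=> mg; apply: cmeasurable_prod => i.
exact: (cmeasurable_comp (mg i) (measurable_mulmx_coord i)).
Qed.

Lemma integral_prod_mulmx_le (c : R) (phi : 'I_n -> mR -> R) (k : 'I_n -> R) :
  0 < c -> (forall h : 'cV[R]_n -> \bar R, measurable_fun setT h -> (forall x, (0 <= h x)%E) ->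
    (\int[L]_x h (S *m x) = c%:E * \int[L]_x h x)%E) ->
  (forall i, measurable_fun setT (phi i)) -> (forall i t, 0 <= phi i t) ->
  (forall i, (\int[mu]_t (phi i t)%:E <= (k i)%:E)%E) ->
  (\int[L]_x (\prod_i phi i ((S *m x) i ord0))%:E <= (c * \prod_i k i)%:E)%E.
Proof.
move=> c0 cP mphi phi0 hk.
rewrite (cP (fun y => (\prod_i phi i (y i ord0))%:E)).
- rewrite EFinM; apply: lee_wpmul2l; first by rewrite lee_fin ltW.
  exact: integral_prod_coord_le.
- by apply/measurable_EFinP; exact: measurable_prod_coord.
- by move=> x; rewrite lee_fin prodr_ge0.
Qed.

(** Telescoping: the factors are exchanged one at a time. *)
Lemma prod_close (m : nat) (g e : 'I_m -> C) (k : 'I_m -> R) (eps : R) : 0 <= eps ->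
  (forall i, nc (g i) <= k i) -> (forall i, nc (e i) <= k i) ->
  (forall i, nc (g i - e i) <= eps * k i) ->
  nc (\prod_i g i - \prod_i e i) <= m%:R * eps * \prod_i k i.
Proof.
elim: m g e k => [|m IH] g e k eps0 hg he hge.
  by rewrite !big_ord0 subrr Normc.normc0 mul0r mul0r.
have k0 i : 0 <= k i by rewrite (le_trans (nc_ge0 _) (hg i)).
rewrite !big_ord_recl; set G := \prod_(i < m) _; set E := \prod_(i < m) _.
set K := \prod_(i < m) _.
have -> : g ord0 * G - e ord0 * E = (g ord0 - e ord0) * G + e ord0 * (G - E) by ring.
apply: le_trans (le_normcD _ _) _; rewrite !Normc.normcM.
rewrite -natr1 mulrDl mul1r mulrDl addrC lerD//.
- rewrite [leRHS]mulrCA; apply: ler_pM; rewrite ?nc_ge0//.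
  by apply: IH.
- rewrite mulrA; apply: ler_pM; rewrite ?nc_ge0//.
  by rewrite /G nc_prod; apply: ler_prod => i _; rewrite nc_ge0 hg.
Qed.

End skewed_products.

Section expansion.
Variables (R : realType) (n : nat) (S : 'M[R]_n).
Local Notation C := R[i].
Local Notation mu := (@lebesgue_measure R).
Local Notation L := (lebesgue_cV R n).
Local Notation mR := (measurableTypeR R).
Local Notation nc := (@Normc.normc R).
Local Notation toC := (real_complex R).

(** Bargmann transform of [f] in the coordinates [y = S *m x]. *)
Definition bargmann (f : 'cV[R]_n -> C) (z : 'I_n -> C) : C :=
  cint L (fun x => f x * \prod_i hgauss 2^-1 ((S *m x) i ord0) (z i)).

(** The Taylor coefficients of [bargmann f], by [bargmann_expansion]. *)
Definition bargmann_coef (f : 'cV[R]_n -> C) (al : 'I_n -> nat) : C :=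
  cint L (fun x => f x * \prod_i (toC (hcoef ((S *m x) i ord0) (al i)) *
    toC (expR (- (2^-1 * ((S *m x) i ord0) ^+ 2))))).

Lemma cintegrable_mul_prod (f : 'cV[R]_n -> C) (Cf : R) (q : 'I_n -> mR -> C)
    (phi : 'I_n -> mR -> R) (k : 'I_n -> R) : posdefmx S ->
  cmeasurable f -> 0 <= Cf -> {ae L, forall x, nc (f x) <= Cf} ->
  (forall i, cmeasurable (q i)) -> (forall i, measurable_fun setT (phi i)) ->
  (forall i t, nc (q i t) <= phi i t) -> (forall i, (\int[mu]_t (phi i t)%:E <= (k i)%:E)%E) ->
  cintegrable L (fun x => f x * \prod_i q i ((S *m x) i ord0)).
Proof.
move=> /ge0_integral_posdef[c c0 cP] mf Cf0 fC mq mphi qphi hk.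
have phi0 i t : 0 <= phi i t by rewrite (le_trans (nc_ge0 _) (qphi i t)).
have mP := measurable_prod_mulmx S mphi.
apply: (cintegrable_le (h := fun x => Cf * \prod_i phi i ((S *m x) i ord0))).
- by apply: cmeasurableM => //; exact: cmeasurable_prod_mulmx.
- exact: measurable_funM.
- by move=> x; rewrite mulr_ge0// prodr_ge0.
- apply: filterS fC => x hx; rewrite Normc.normcM; apply: ler_pM; rewrite ?nc_ge0//.
  by rewrite nc_prod; apply: ler_prod => i _; rewrite nc_ge0 qphi.
apply: le_lt_trans (integral_scale_le Cf0 mP _ (integral_prod_mulmx_le c0 cP mphi phi0 hk)) (ltry _).
by move=> x; rewrite prodr_ge0.
Qed.

Lemma nc_hcoef_le (t : R) m :
  nc (toC (hcoef t m) * toC (expR (- (2^-1 * t ^+ 2))))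
    <= expR 2 * expR (2 * `|t| - 2^-1 * t ^+ 2).
Proof.
rewrite Normc.normcM !nc_real (ger0_norm (expR_ge0 _)).
have := hcoef_le t m (@ler01 R); rewrite !expr1n !mulr1 => h.
apply: le_trans (ler_wpM2r (expR_ge0 _) h) _.
by rewrite -!expRD ler_expR; lra.
Qed.

Lemma cintegrable_coef (f : 'cV[R]_n -> C) (Cf : R) (al : 'I_n -> nat) : posdefmx S ->
  cmeasurable f -> 0 <= Cf -> {ae L, forall x, nc (f x) <= Cf} ->
  cintegrable L (fun x => f x * \prod_i (toC (hcoef ((S *m x) i ord0) (al i)) *
    toC (expR (- (2^-1 * ((S *m x) i ord0) ^+ 2))))).
Proof.
move=> Spd mf Cf0 fC; have half0 : 0 < 2^-1 :> R by rewrite invr_gt0.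
have [M M0 hM] := expabs_integral 2 half0.
apply: (cintegrable_mul_prod
  (q := fun i t => toC (hcoef t (al i)) * toC (expR (- (2^-1 * t ^+ 2))))
  (phi := fun i t => expR 2 * expR (2 * `|t| - 2^-1 * t ^+ 2)) (k := fun=> expR 2 * M) Spd mf Cf0 fC).
- by move=> i; have [] := cintegrable_hcoef (al i) half0.
- by move=> i; apply: measurable_funM => //; exact: measurable_expabs.
- by move=> i t; exact: nc_hcoef_le.
- by move=> i; apply: integral_scale_le => //; exact: measurable_expabs.
Qed.

(** Each factor of the kernel is within [2 ^- N] of its Taylor polynomial of order [N], up to a
  Gaussian weight ([hpartial_close]). The product of the [n] Taylor polynomials, expanded by
  distributivity, is the sum over [b], and the weights are integrable against the bounded
  function [f]. *)
Lemma bargmann_expansion (f : 'cV[R]_n -> C) (Cf rho : R) : posdefmx S ->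
  cmeasurable f -> 0 <= Cf -> {ae L, forall x, nc (f x) <= Cf} -> 0 <= rho ->
  exists2 K : R, 0 <= K & forall (z : 'I_n -> C) (N : nat), (forall i, nc (z i) <= rho) ->
    nc (bargmann f z - \sum_(b : {ffun 'I_n -> 'I_N.+1})
      (\prod_i z i ^+ b i) * bargmann_coef f (fun i => b i)) <= K / 2 ^+ N.
Proof.
move=> Spd mf Cf0 fC rho0.
have [c c0 cP] := ge0_integral_posdef Spd.
have half0 : 0 < 2^-1 :> R by rewrite invr_gt0.
have [M M0 hM] := expabs_integral (12 * rho) half0.
pose kap (t : mR) := 4 * expR (36 * rho ^+ 2) * expR (12 * rho * `|t| - 2^-1 * t ^+ 2).
have kap0 t : 0 <= kap t by rewrite /kap !mulr_ge0 ?expR_ge0.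
have mkap : measurable_fun setT kap.
  by apply: measurable_funM => //; exact: measurable_expabs.
pose k := 4 * expR (36 * rho ^+ 2) * M.
have kapk : (\int[mu]_t (kap t)%:E <= k%:E)%E.
  by apply: integral_scale_le => //; exact: measurable_expabs.
pose Kap (x : 'cV[R]_n) := \prod_i kap ((S *m x) i ord0).
have Kap0 x : 0 <= Kap x by rewrite prodr_ge0.
have mKap : measurable_fun setT Kap by exact: (measurable_prod_mulmx S (fun=> mkap)).
have KapI : (\int[L]_x (Kap x)%:E <= (c * k ^+ n)%:E)%E.
  rewrite -[n in k ^+ n]card_ord -prodr_const.
  exact: (integral_prod_mulmx_le c0 cP (fun=> mkap) (fun=> kap0) (fun=> kapk)).
have IKap (B : R) : 0 <= B -> (\int[L]_x (B * Kap x)%:E <= (B * (c * k ^+ n))%:E)%E.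
  by move=> B0; apply: integral_scale_le.
have gk t (w : C) : nc w <= rho -> nc (hgauss 2^-1 t w) <= kap t / 2.
  move=> wr; apply: le_trans (nc_hgauss_le _ _ wr) _.
  rewrite /kap (_ : 4 * _ * _ / 2 = 2 * (expR (36 * rho ^+ 2) * expR (12 * rho * `|t| - 2^-1 * t ^+ 2))); last by field.
  rewrite -!expRD; apply: (@le_trans _ _ (1 * expR (36 * rho ^+ 2 + (12 * rho * `|t| - 2^-1 * t ^+ 2)))).
    rewrite mul1r ler_expR; have := mulr_ge0 rho0 (normr_ge0 t); have := sqr_ge0 rho; lra.
  by rewrite ler_wpM2r ?expR_ge0//; lra.
pose e N (t : R) (w : C) := (hpartial t N.+1).[w] * toC (expR (- (2^-1 * t ^+ 2))).
have gek N t (w : C) : nc w <= rho -> nc (hgauss 2^-1 t w - e N t w) <= (kap t / 2) / 2 ^+ N.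
  move=> wr; rewrite /e /hgauss -mulrBl Normc.normcM nc_real (ger0_norm (expR_ge0 _)).
  apply: le_trans (ler_wpM2r (expR_ge0 _) (hpartial_close t N wr)) _.
  rewrite /hbound /kap mulrAC ler_wpM2r ?invr_ge0 ?exprn_ge0//.
  rewrite (_ : 4 * _ * _ / 2 = 2 * (expR (36 * rho ^+ 2) * expR (12 * rho * `|t| - 2^-1 * t ^+ 2))); last by field.
  by rewrite -!mulrA ler_wpM2l// -!expRD ler_expR; lra.
have ek N t (w : C) : nc w <= rho -> nc (e N t w) <= kap t.
  move=> wr; have -> : e N t w = hgauss 2^-1 t w + - (hgauss 2^-1 t w - e N t w).
    by rewrite opprB addrC subrK.
  apply: le_trans (le_normcD _ _) _; rewrite normcN [leRHS]splitr lerD ?gk//.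
  apply: le_trans (gek N _ _ wr) _; rewrite ler_piMr ?divr_ge0//.
  by rewrite invf_le1 ?exprn_gt0// exprn_ege1// ler1n.
have hk0 : 0 <= k by rewrite /k !mulr_ge0 ?expR_ge0.
have kn0 : 0 <= k ^+ n by exact: exprn_ge0.
exists (2 * (Cf * n%:R * (c * k ^+ n))).
  by rewrite !mulr_ge0// ltW.
move=> z N zr.
pose E (x : 'cV[R]_n) : C := \prod_i e N ((S *m x) i ord0) (z i).
pose G (x : 'cV[R]_n) : C := \prod_i hgauss 2^-1 ((S *m x) i ord0) (z i).
pose B (b : {ffun 'I_n -> 'I_N.+1}) (x : 'cV[R]_n) : C :=
  f x * \prod_i (toC (hcoef ((S *m x) i ord0) (b i)) *
    toC (expR (- (2^-1 * ((S *m x) i ord0) ^+ 2)))).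
have fB (x : 'cV[R]_n) : f x * E x = \sum_(b : {ffun 'I_n -> 'I_N.+1}) (\prod_i z i ^+ b i) * B b x.
  rewrite /E /e; under eq_bigr do rewrite hpartial_horner mulr_suml.
  rewrite bigA_distr_bigA /= mulr_sumr; apply: eq_bigr => b _.
  rewrite /B mulrCA -big_split; congr (_ * _); apply: eq_bigr => i _.
  exact: esym (mulrA _ _ _).
have iB b : cintegrable L (B b) by exact: (cintegrable_coef (fun i => b i) Spd mf Cf0 fC).
have mG : cmeasurable G.
  exact: (cmeasurable_prod_mulmx S (fun i => cmeasurable_hgauss 2^-1 (z i))).
have iG : cintegrable L (fun x => f x * G x).
  apply: (cintegrable_mul_prod (k := fun=> k) Spd mf Cf0 fC
    (fun i => cmeasurable_hgauss 2^-1 (z i)) (fun=> mkap)) => // i t.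
  by apply: le_trans (gk _ _ (zr i)) _; rewrite ler_piMr//; lra.
have iE : cintegrable L (fun x => \sum_(b : {ffun 'I_n -> 'I_N.+1}) (\prod_i z i ^+ b i) * B b x).
  by apply: cintegrable_sum => b; exact: cintegrableZ.
have -> : \sum_(b : {ffun 'I_n -> 'I_N.+1}) (\prod_i z i ^+ b i) * bargmann_coef f (fun i => b i)
    = cint L (fun x => \sum_(b : {ffun 'I_n -> 'I_N.+1}) (\prod_i z i ^+ b i) * B b x).
  rewrite cint_sum; last by move=> b; exact: cintegrableZ.
  by apply: eq_bigr => b _; rewrite cintZ.
rewrite /bargmann -mulN1r -cintZ// -cintD//; last exact: cintegrableZ.
rewrite -[leRHS]mulrA.
apply: (nc_cint_le (h := fun x => Cf * (n%:R * (2 ^+ N)^-1 * Kap x))).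
- apply: cmeasurableD; first by case: iG.
  by case: (cintegrableZ (-1) iE).
- by apply: measurable_funM => //; exact: measurable_funM.
- by move=> x; rewrite !mulr_ge0// invr_ge0 exprn_ge0.
- apply: filterS fC => x hx; rewrite -fB mulN1r -mulrBr Normc.normcM.
  apply: ler_pM; rewrite ?nc_ge0//.
  apply: prod_close; first by rewrite invr_ge0 exprn_ge0.
  + by move=> i; apply: le_trans (gk _ _ (zr i)) _; rewrite ler_piMr//; lra.
  + by move=> i; exact: ek.
  + move=> i; apply: le_trans (gek N _ _ (zr i)) _; rewrite mulrC.
    by rewrite ler_wpM2l ?invr_ge0 ?exprn_ge0// ler_piMr//; lra.
have p1 : 0 <= Cf * n%:R / 2 ^+ N by rewrite divr_ge0 ?mulr_ge0 ?exprn_ge0.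
have := IKap _ p1; congr (_ <= _)%E.
  by apply: eq_integral => x _; congr EFin; rewrite -!mulrA.
by congr EFin; rewrite mulrAC.
Qed.

End expansion.

(** * Cauchy estimates *)

Section torus_cauchy.
Variable R : realType.
Local Notation C := R[i].
Local Notation nc := (@Normc.normc R).
Local Notation toC := (real_complex R).

Definition cis (r : R) : C := cexp (Complex 0 r).

Lemma cisD r s : cis (r + s) = cis r * cis s.
Proof. by rewrite /cis -cexpD; congr cexp; congr Complex; rewrite addr0. Qed.

Lemma cis0 : cis 0 = 1.
Proof. exact: cexp0. Qed.

Lemma nc_cis r : nc (cis r) = 1.
Proof. by rewrite /cis nc_cexp expR0. Qed.

Lemma cis_natmul r k : cis (r * k%:R) = cis r ^+ k.
Proof.
elim: k => [|k IH]; first by rewrite mulr0 cis0.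
by rewrite -natr1 mulrDr mulr1 cisD IH exprSr.
Qed.

Lemma cis2pi : cis (2 * pi) = 1.
Proof.
rewrite /cis /cexp /= expR0 !mul1r mulr_natl cos2pi.
by rewrite mulr2n sinD cospi sinpi !mulr0 mul0r addr0.
Qed.

Lemma cis_neq1 r : 0 < `|r| < 2 * pi -> cis r != 1.
Proof.
move=> /andP[r0 r1]; apply/negP => /eqP [].
rewrite expR0 !mul1r => h _.
have s0 : sin (r / 2) != 0.
  have pos s : 0 < s < pi -> sin s != 0 by move=> hs; rewrite gt_eqF// sin_gt0_pi.
  have [rp|rn] := ltP 0 r.
    by rewrite gtr0_norm// in r1; apply: pos; apply/andP; split; lra.
  have rn' : r < 0 by rewrite lt_neqAle rn andbT -normr_gt0.
  rewrite ltr0_norm// in r1.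
  by rewrite -[r / 2]opprK sinN oppr_eq0; apply: pos; apply/andP; split; lra.
have : cos r = 1 - 2 * sin (r / 2) ^+ 2.
  rewrite [in LHS](splitr r) cosD -!expr2 cos2sin2; ring.
rewrite h => /eqP; rewrite eq_sym -subr_eq0 addrAC subrr add0r oppr_eq0 mulf_eq0 sqrf_eq0.
by rewrite (negPf s0) orbF pnatr_eq0.
Qed.

Variable N : nat.
Let w (k b : nat) : C := cis (2 * pi / N.+1%:R * k%:R * b%:R).

(** Orthogonality of the characters of [Z / N.+1]. *)
Let cis_orthogonal (b b' : 'I_N.+1) :
  \sum_(k < N.+1) w k b' * cis (- (2 * pi / N.+1%:R * k%:R * b%:R)) = if b' == b then N.+1%:R else 0.
Proof.
have n0 : N.+1%:R != 0 :> R by rewrite pnatr_eq0.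
have np : 0 < N.+1%:R :> R by rewrite ltr0Sn.
have E (k : 'I_N.+1) : w k b' * cis (- (2 * pi / N.+1%:R * k%:R * b%:R)) =
    cis (2 * pi / N.+1%:R * (b'%:R - b%:R)) ^+ k.
  by rewrite /w -cisD -cis_natmul; congr cis; ring.
rewrite (eq_bigr _ (fun k _ => E k)); set x := cis _ in E *.
have [bb|bb] := eqVneq b' b.
  have -> : x = 1 by rewrite /x bb subrr mulr0 cis0.
  by rewrite (eq_bigr (fun=> 1)) => [|k _]; rewrite ?expr1n// sumr_const card_ord.
have x1 : x != 1.
  apply: cis_neq1; rewrite normrM gtr0_norm; last by rewrite divr_gt0// mulr_gt0// pi_gt0.
  have d0 : 0 < `|b'%:R - b%:R| :> R.
    by rewrite normr_gt0 subr_eq0 eqr_nat.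
  have d1 : `|b'%:R - b%:R| < N.+1%:R :> R.
    have hb : b%:R < N.+1%:R :> R by rewrite ltr_nat.
    have hb' : b'%:R < N.+1%:R :> R by rewrite ltr_nat.
    have b0 : 0 <= b%:R :> R by [].
    have b'0 : 0 <= b'%:R :> R by [].
    rewrite ltr_norml; move: (N.+1%:R : R) (b%:R : R) (b'%:R : R) hb hb' b0 b'0 => p q q' *.
    by apply/andP; split; lra.
  rewrite mulr_gt0 ?divr_gt0 ?mulr_gt0 ?pi_gt0//=.
  by rewrite mulrAC -mulrA gtr_pMr ?mulr_gt0 ?pi_gt0// ltr_pdivrMr// mul1r.
have xn : x ^+ N.+1 = 1.
  rewrite -cis_natmul.
  rewrite (_ : _ * _ = 2 * pi * b'%:R + - (2 * pi * b%:R)); last by field.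
  have one b1 : cis (2 * pi * b1%:R) = 1 by rewrite cis_natmul cis2pi expr1n.
  have inv1 : cis (- (2 * pi * b%:R)) = 1.
    by rewrite -[LHS]mulr1 -(one b) -cisD addNr cis0.
  by rewrite cisD one inv1 mulr1.
apply/eqP; have := subrX1 x N.+1; rewrite xn subrr => /esym/eqP.
by rewrite mulf_eq0 subr_eq0 (negPf x1).
Qed.

(** Averaging over the torus of [N.+1]-st roots of unity isolates one
  coefficient, with no aliasing because all exponents are at most [N]. *)
Lemma torus_cauchy n (c : {ffun 'I_n -> 'I_N.+1} -> C) (rad : 'I_n -> R) (M : R) :
  (forall i, 0 <= rad i) ->
  (forall z : 'I_n -> C, (forall i, nc (z i) = rad i) ->
    nc (\sum_(b : {ffun 'I_n -> 'I_N.+1}) (\prod_i z i ^+ b i) * c b) <= M) ->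
  forall b, nc (c b) * \prod_i rad i ^+ b i <= M.
Proof.
move=> rad0 hM b.
have n0 : 0 < N.+1%:R :> R by rewrite ltr0Sn.
pose z (k : {ffun 'I_n -> 'I_N.+1}) (i : 'I_n) : C := toC (rad i) * w (k i) 1.
have nz k i : nc (z k i) = rad i.
  by rewrite Normc.normcM nc_cis mulr1 nc_real ger0_norm.
pose u (k : {ffun 'I_n -> 'I_N.+1}) : C :=
  \prod_i cis (- (2 * pi / N.+1%:R * (k i)%:R * (b i)%:R)).
have nu k : nc (u k) = 1.
  by rewrite /u nc_prod big1// => i _; exact: nc_cis.
have inner (b' : {ffun 'I_n -> 'I_N.+1}) :
    \sum_(k : {ffun 'I_n -> 'I_N.+1}) u k * ((\prod_i z k i ^+ b' i) * c b')
    = c b' * \prod_i toC (rad i) ^+ b' i * \prod_i (if b' i == b i then N.+1%:R else 0).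
  rewrite -(eq_bigr _ (fun i _ => cis_orthogonal (b i) (b' i))) bigA_distr_bigA /= mulr_sumr.
  apply: eq_bigr => k _.
  have -> : \prod_i z k i ^+ b' i = (\prod_i toC (rad i) ^+ b' i) * \prod_i w (k i) (b' i).
    rewrite -big_split; apply: eq_bigr => i _.
    by rewrite /z exprMn /w mulr1 -cis_natmul.
  rewrite big_split /= -/(u k); ring.
have key : \sum_(k : {ffun 'I_n -> 'I_N.+1}) u k *
      (\sum_(b' : {ffun 'I_n -> 'I_N.+1}) (\prod_i z k i ^+ b' i) * c b')
    = c b * \prod_i toC (rad i) ^+ b i * N.+1%:R ^+ n.
  transitivity (\sum_(k : {ffun 'I_n -> 'I_N.+1}) \sum_(b' : {ffun 'I_n -> 'I_N.+1})
      u k * ((\prod_i z k i ^+ b' i) * c b')).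
    by apply: eq_bigr => k _; rewrite mulr_sumr.
  rewrite exchange_big (bigD1 b)//= inner [X in _ + X]big1 ?addr0.
    congr (_ * _); rewrite (eq_bigr (fun=> N.+1%:R)) => [|i _]; last by rewrite eqxx.
    by rewrite prodr_const card_ord.
  move=> b' bb'; rewrite inner.
  have [i hi] : exists i, b' i != b i.
    apply/existsP; apply: contraNT bb'; rewrite negb_exists => /forallP h.
    by apply/eqP/ffunP => i; move: (h i); rewrite negbK => /eqP.
  by rewrite [X in _ * X](bigD1 i)//= (negPf hi) mul0r mulr0.
have card : #|{: {ffun 'I_n -> 'I_N.+1}}| = (N.+1 ^ n)%N by rewrite card_ffun !card_ord.
have : nc (\sum_(k : {ffun 'I_n -> 'I_N.+1}) u k *
      (\sum_(b' : {ffun 'I_n -> 'I_N.+1}) (\prod_i z k i ^+ b' i) * c b')) <= M * N.+1%:R ^+ n.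
  apply: le_trans (nc_sum _ _) _.
  apply: (@le_trans _ _ (\sum_(k : {ffun 'I_n -> 'I_N.+1}) M)).
    by apply: ler_sum => k _; rewrite Normc.normcM nu mul1r; exact: hM.
  by rewrite sumr_const card -natrX mulr_natr.
have nat_nc k : nc (k%:R : C) = k%:R.
  by rewrite -(rmorph_nat toC) nc_real normr_nat.
rewrite key !Normc.normcM nc_prod ncX nat_nc ler_pM2r ?exprn_gt0//.
rewrite (eq_bigr (fun i => rad i ^+ b i))// => i _.
by rewrite ncX nc_real ger0_norm.
Qed.

End torus_cauchy.

(** * Growth of the Bargmann transform *)

Section fourier_side.
Variables (R : realType) (n : nat) (S : 'M[R]_n).
Hypothesis Spd : posdefmx S.
Local Notation C := R[i].
Local Notation mu := (@lebesgue_measure R).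
Local Notation L := (lebesgue_cV R n).
Local Notation mR := (measurableTypeR R).
Local Notation nc := (@Normc.normc R).
Local Notation toC := (real_complex R).

(** The frequency bounds hold almost everywhere in [xi] and are needed almost everywhere in
  [eta], where [xi = S *m eta]; null sets correspond, by the change of variables. *)
Lemma ae_mulmx (P : 'cV[R]_n -> Prop) : {ae L, forall x, P x} -> {ae L, forall x, P (S *m x)}.
Proof.
have [c c0 cP] := ge0_integral_posdef Spd.
move=> [N [mN N0 PN]].
exists ((fun x => S *m x) @^-1` N); split.
- by rewrite -[X in measurable X]setTI; exact: measurable_mulmx.
- have mSN : measurable ((fun x => S *m x) @^-1` N).
    by rewrite -[X in measurable X]setTI; exact: measurable_mulmx.
  have I1 : (\int[L]_x (\1_N (S *m x))%:E = L ((fun x => S *m x) @^-1` N))%E.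
    transitivity (\int[L]_x (\1_((fun x => S *m x) @^-1` N) x)%:E)%E; first by [].
    by rewrite integral_indic// setIT.
  have I2 : (\int[L]_x (\1_N x)%:E = 0)%E by rewrite integral_indic// setIT.
  rewrite -I1 (cP (fun x => (\1_N x)%:E)) ?I2 ?mule0//.
  by apply/measurable_EFinP; exact: measurable_indic.
- by move=> x hx; apply: PN.
Qed.

Definition fphase (x xi : 'cV[R]_n) : C := cis (- dotv x xi).

Lemma measurable_dotv : measurable_fun setT (fun p : 'cV[R]_n * 'cV[R]_n => dotv p.1 p.2).
Proof.
apply: measurable_sum => i; apply: measurable_funM.
- exact: (measurableT_comp (measurable_coord i) measurable_fst).
- exact: (measurableT_comp (measurable_coord i) measurable_snd).
Qed.

Lemma measurable_mulmx2 : measurable_fun setT (fun p : 'cV[R]_n * 'cV[R]_n => (p.1, S *m p.2)).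
Proof.
apply/measurable_fun_pairP; split; first exact: measurable_fst.
exact: (measurableT_comp (measurable_mulmx S) measurable_snd).
Qed.

Lemma cmeasurable_fphase : cmeasurable (fun p : 'cV[R]_n * 'cV[R]_n => fphase p.1 (S *m p.2)).
Proof.
apply: cmeasurable_cexp; split => /=; first exact: measurable_cst.
apply: measurableT_comp => //.
exact: (measurableT_comp measurable_dotv measurable_mulmx2).
Qed.

Lemma fphase_prod (x eta : 'cV[R]_n) :
  fphase x (S *m eta) = \prod_i cexp (Complex 0 (- ((S *m x) i ord0 * eta i ord0))).
Proof.
rewrite /fphase dotv_mulmx; case: Spd => -> _; rewrite /dotv -sumrN.
exact: (big_morph (@cis R) (@cisD R) (@cis0 R)).
Qed.

(** The kernel at [i z]: it takes the place of the kernel at [z] on the frequency side. *)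
Definition hprod (z : 'I_n -> C) (eta : 'cV[R]_n) : C :=
  \prod_i hgauss 2^-1 (eta i ord0) (Complex 0 1 * z i).

(** Parseval's formula for the kernel: [hgauss_fourier] is applied to each factor, and the
  integrals in [x] and [eta] are exchanged. *)
Lemma bargmann_fourier (f : 'cV[R]_n -> C) (z : 'I_n -> C) : cintegrable L f ->
  let Phi eta := cint L (fun x => f x * fphase x (S *m eta)) in
  toC (Num.sqrt 2 * Num.sqrt pi) ^+ n * bargmann S f z
    = cint L (fun eta => hprod z eta * Phi eta) /\
  cmeasurable (fun eta => hprod z eta * Phi eta).
Proof.
move=> fi Phi.
have [mf foo] := fi.
have ihp : cintegrable L (hprod z).
  apply: (@cintegrable_prod R n (fun i t => hgauss 2^-1 t (Complex 0 1 * z i))) => i.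
  by apply: cintegrable_hgauss; rewrite invr_gt0.
have [mh hoo] := ihp.
pose p (xe : 'cV[R]_n * 'cV[R]_n) : C := f xe.1 * (hprod z xe.2 * fphase xe.1 (S *m xe.2)).
have ncp x eta : nc (p (x, eta)) = nc (f x) * nc (hprod z eta).
  by rewrite /p !Normc.normcM nc_cis mulr1.
have mp : cmeasurable p.
  apply: cmeasurableM; first exact: (cmeasurable_comp mf measurable_fst).
  apply: cmeasurableM; first exact: (cmeasurable_comp mh measurable_snd).
  exact: cmeasurable_fphase.
have mp1 x : cmeasurable (fun eta => p (x, eta)).
  exact: (cmeasurable_comp mp (pair1_measurable x)).
have mp2 eta : cmeasurable (fun x => p (x, eta)).
  exact: (cmeasurable_comp mp (pair2_measurable eta)).
have mfE := measurable_ncE mf; have mhE := measurable_ncE mh.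
have I1 x : (\int[L]_eta (nc (p (x, eta)))%:E = (nc (f x))%:E * \int[L]_eta (nc (hprod z eta))%:E)%E.
  under eq_integral do rewrite ncp EFinM.
  by rewrite ge0_integralZl// => [y _|]; rewrite lee_fin nc_ge0.
have ip1 x : cintegrable L (fun eta => p (x, eta)).
  by split=> //; rewrite I1 lte_mul_pinfty// lee_fin nc_ge0.
have ip2 eta : cintegrable L (fun x => p (x, eta)).
  split=> //; under eq_integral do rewrite ncp mulrC EFinM.
  rewrite ge0_integralZl//; last 2 first.
  - by move=> y _; rewrite lee_fin nc_ge0.
  - by rewrite lee_fin nc_ge0.
  by rewrite lte_mul_pinfty// lee_fin nc_ge0.
have h0 : (0 <= \int[L]_eta (nc (hprod z eta))%:E)%E.
  by apply: integral_ge0 => y _; rewrite lee_fin nc_ge0.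
have ip : cintegrable (L \x L)%E p.
  split=> //; rewrite (fubini_tonelli1 (fun xe => (nc (p xe))%:E)); last 2 first.
  - exact: measurable_ncE.
  - by move=> x; rewrite lee_fin nc_ge0.
  rewrite /fubini_F; under eq_integral do rewrite I1 muleC.
  rewrite ge0_integralZl//; last by move=> y _; rewrite lee_fin nc_ge0.
  by rewrite lte_mul_pinfty// ge0_fin_numE.
have E2 eta : hprod z eta * Phi eta = cint L (fun x => p (x, eta)).
  rewrite /Phi -cintZ; first by apply: eq_cint => x; rewrite /p /=; ring.
  have ncf x : nc (f x * fphase x (S *m eta)) = nc (f x) by rewrite Normc.normcM nc_cis mulr1.
  split; last by under eq_integral do rewrite ncf.
  apply: cmeasurableM => //.
  exact: (cmeasurable_comp cmeasurable_fphase (pair2_measurable eta)).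
split; last first.
  have -> : (fun eta => hprod z eta * Phi eta) = fun eta => cint L (fun x => p (x, eta)).
    by apply/funext => eta; exact: E2.
  exact: (cmeasurable_cint2 ip ip1 ip2).
rewrite (eq_cint _ E2) -(cint_fubini ip ip1 ip2) /bargmann.
have ig i (y : R) : cintegrable mu (fun t : mR => hgauss 2^-1 t (Complex 0 1 * z i) *
    cexp (Complex 0 (- (y * t)))).
  have half0 : 0 < 2^-1 :> R by rewrite invr_gt0.
  have [mg goo] := cintegrable_hgauss (Complex 0 1 * z i) half0.
  split.
    apply: cmeasurableM => //; apply: cmeasurable_cexp; split => /=; first exact: measurable_cst.
    by apply: measurableT_comp => //; exact: measurable_funM.
  move: goo; congr (_ < _)%E; apply: eq_integral => t _; congr EFin.
  have -> : cexp (Complex 0 (- (y * t))) = cis (- (y * t)) by [].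
  by rewrite [RHS]Normc.normcM nc_cis mulr1.
have E1 x : toC (Num.sqrt 2 * Num.sqrt pi) ^+ n *
    (f x * \prod_i hgauss 2^-1 ((S *m x) i ord0) (z i)) = cint L (fun eta => p (x, eta)).
  have -> : toC (Num.sqrt 2 * Num.sqrt pi) ^+ n =
      \prod_(i < n) toC (Num.sqrt 2 * Num.sqrt pi) by rewrite prodr_const card_ord.
  rewrite mulrCA -big_split /=.
  under eq_bigr do rewrite -hgauss_fourier.
  pose G i (t : R) := hgauss 2^-1 t (Complex 0 1 * z i) * cexp (Complex 0 (- ((S *m x) i ord0 * t))).
  have iG i : cintegrable mu (G i) by exact: ig.
  transitivity (f x * cint L (fun eta => \prod_i G i (eta i ord0))).
    by congr (_ * _); rewrite (cint_prod iG).
  rewrite -cintZ; last exact: (cintegrable_prod iG).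
  by apply: eq_cint => eta; rewrite /p /= fphase_prod /hprod -big_split.
rewrite -cintZ; first exact: eq_cint.
pose B := \prod_i expR (3 * nc (z i) ^+ 2).
apply: (cintegrable_le (h := fun x => B * nc (f x))).
- apply: cmeasurableM => //.
  exact: (cmeasurable_prod_mulmx S (fun i => cmeasurable_hgauss 2^-1 (z i))).
- by apply: measurable_funM => //; exact: measurable_nc.
- by move=> x; rewrite mulr_ge0 ?nc_ge0// prodr_ge0// => i _; exact: expR_ge0.
- apply: aeW => x; rewrite Normc.normcM mulrC ler_wpM2r ?nc_ge0// nc_prod.
  apply: ler_prod => i _; rewrite nc_ge0 /=.
  apply: le_trans (nc_hgauss_le _ _ (lexx _)) _; rewrite -expRD ler_expR.
  have := sqr_ge0 (2 * nc (z i) - `|(S *m x) i ord0|).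
  rewrite -(real_normK (num_real ((S *m x) i ord0))); set a := nc _; set b := `|_|.
  by rewrite !expr2; lra.
have B0 : 0 <= B by rewrite prodr_ge0// => i _; exact: expR_ge0.
have fin : (\int[L]_x (nc (f x))%:E)%E \is a fin_num.
  by rewrite ge0_fin_numE// integral_ge0// => x _; rewrite lee_fin nc_ge0.
apply: (@le_lt_trans _ _ (B * fine (\int[L]_x (nc (f x))%:E))%:E); last exact: ltry.
apply: integral_scale_le => //; [exact: measurable_nc|by move=> x; exact: nc_ge0|].
by rewrite fineK.
Qed.

End fourier_side.

Section growth.
Variables (R : realType) (n : nat) (S : 'M[R]_n).
Hypothesis Spd : posdefmx S.
Local Notation C := R[i].
Local Notation mu := (@lebesgue_measure R).
Local Notation L := (lebesgue_cV R n).
Local Notation mR := (measurableTypeR R).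
Local Notation nc := (@Normc.normc R).
Local Notation Re := (@complex.Re R).
Local Notation Im := (@complex.Im R).

(** In the [j]-th coordinate the bound on [u] and the kernel multiply to
  [exp(- (t - p) ^ 2 + q ^ 2 + N t)], where [z j = p + i q]; then [N] is replaced by its affine
  majorant, and [c |t| <= |t - p| + c |p|] leaves a function of [t - p] whose integral depends
  neither on [p] nor on [c]. The other coordinates contribute constants. *)
Lemma bargmann_growth (u : 'cV[R]_n -> C) (N : R -> R) (Cu : R) (j : 'I_n) : 0 <= Cu ->
  {ae L, forall x, nc (u x) <= Cu * expR (- (2^-1 * ((S *m x) j ord0) ^+ 2) +
     N `|(S *m x) j ord0|)} ->
  exists2 K : R, 0 <= K & forall (c NR : R) (z : 'I_n -> C), 0 <= c <= 1 ->
    (forall t, 0 <= t -> N t <= NR + c * t) -> (forall i, i != j -> nc (z i) <= 1) ->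
    cmeasurable (fun x => u x * \prod_i hgauss 2^-1 ((S *m x) i ord0) (z i)) ->
    nc (bargmann S u z) <= K * expR NR * expR (c * `|Re (z j)| + Im (z j) ^+ 2).
Proof.
move=> Cu0 ub.
have [cS cS0 cSP] := ge0_integral_posdef Spd.
have [M1 M10 hM1] := expabs_integral 1 (@ltr01 R).
have half0 : 0 < 2^-1 :> R by rewrite invr_gt0.
have [M2 M20 hM2] := expabs_integral 2 half0.
pose k i := if i == j then M1 else expR 1 * M2.
have k0 i : 0 <= k i by rewrite /k; case: ifP => // _; rewrite mulr_ge0 ?expR_ge0.
have pk0 : 0 <= \prod_i k i by rewrite prodr_ge0.
exists (2 * (Cu * (cS * \prod_i k i))); first by rewrite !mulr_ge0// ltW.
move=> c NR z /andP[c0 c1] hN hz mz.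
set p := Re (z j); set q := Im (z j).
pose phi i : mR -> R :=
  if i == j then (fun t => expR (1 * `|1 * t - p| - 1 * (1 * t - p) ^+ 2))
  else (fun t => expR 1 * expR (2 * `|t| - 2^-1 * t ^+ 2)).
have phi0 i t : 0 <= phi i t by rewrite /phi; case: ifP => _; rewrite ?mulr_ge0 ?expR_ge0.
have mphi i : measurable_fun setT (phi i).
  rewrite /phi; case: ifP => _; last by apply: measurable_funM => //; exact: measurable_expabs.
  have m1 : measurable_fun setT (fun t : mR => 1 * t - p : mR).
    by apply: measurable_funB => //; exact: measurable_funM.
  exact: (measurableT_comp (measurable_expabs 1 1) m1).
have iphi i : (\int[mu]_t (phi i t)%:E <= (k i)%:E)%E.
  rewrite /phi /k; case: ifP => _; last first.
    by apply: integral_scale_le => //; exact: measurable_expabs.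
  rewrite (@ge0_integral_aff R 1 (- p) (fun t => (expR (1 * `|t| - 1 * t ^+ 2))%:E))//.
  - by rewrite invr1 mul1e.
  - by apply/measurable_EFinP; exact: measurable_expabs.
pose B := Cu * expR NR * expR (c * `|p| + q ^+ 2).
have B0 : 0 <= B by rewrite !mulr_ge0 ?expR_ge0.
have mprod := measurable_prod_mulmx S mphi.
have pphi0 x : 0 <= \prod_i phi i ((S *m x) i ord0) by rewrite prodr_ge0.
apply: (@le_trans _ _ (2 * (B * (cS * \prod_i k i)))); last by rewrite /B; lra.
apply: (nc_cint_le (h := fun x => B * \prod_i phi i ((S *m x) i ord0))) => //.
- by apply: measurable_funM.
- by move=> x; rewrite mulr_ge0.
- apply: filterS ub => x ux; rewrite Normc.normcM.
  rewrite nc_prod (bigD1 j)// [X in _ <= B * X](bigD1 j)// mulrA [X in _ <= X]mulrA.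
  apply: ler_pM; rewrite ?mulr_ge0 ?nc_ge0 ?prodr_ge0//; first by move=> i _; exact: nc_ge0.
    apply: (@le_trans _ _ (Cu * expR (- (2^-1 * ((S *m x) j ord0) ^+ 2) + N `|(S *m x) j ord0|) *
       nc (hgauss 2^-1 ((S *m x) j ord0) (z j)))); first by rewrite ler_wpM2r ?nc_ge0.
    rewrite nc_hgauss -/p -/q /phi eqxx /B; set t := (S *m x) j ord0.
    rewrite -!mulrA ler_wpM2l// -!expRD ler_expR.
    have h1 := hN _ (normr_ge0 t).
    have h2 : `|t| <= `|1 * t - p| + `|p| by rewrite -[t in `|t|](subrK p) mul1r ler_normD.
    have h3 : c * `|t| <= c * (`|1 * t - p| + `|p|) by rewrite ler_wpM2l.
    have h4 : c * `|1 * t - p| <= 1 * `|1 * t - p| by rewrite ler_wpM2r.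
    have h5 : 2 * t * p - p ^+ 2 + q ^+ 2 - 2^-1 * t ^+ 2 =
       q ^+ 2 - 1 * (1 * t - p) ^+ 2 + 2^-1 * t ^+ 2 by field.
    move: h1 h3 h4 h5; rewrite mulrDr; lra.
  apply: ler_prod => i /andP[_ ij]; rewrite nc_ge0 /phi (negPf ij) andTb.
  by have := nc_hgauss_le 2^-1 ((S *m x) i ord0) (hz i ij); rewrite expr1n mulr1.
apply: integral_scale_le => //.
exact: integral_prod_mulmx_le.
Qed.

End growth.

Section coefficient_bound.
Variables (R : realType) (n : nat) (S : 'M[R]_n).
Hypothesis Spd : posdefmx S.
Local Notation C := R[i].
Local Notation L := (lebesgue_cV R n).
Local Notation nc := (@Normc.normc R).
Local Notation Re := (@complex.Re R).
Local Notation Im := (@complex.Im R).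
Local Notation toC := (real_complex R).

Variables (f : 'cV[R]_n -> C) (Cf : R).
Hypotheses (fi : cintegrable L f) (Cf0 : 0 <= Cf).
Hypothesis fC : {ae L, forall x, nc (f x) <= Cf}.

Let subst (j : 'I_n) (z : 'I_n -> C) (w : C) : 'I_n -> C := fun i => if i == j then w else z i.

(** The partial sums in [bargmann_expansion] are polynomials in each variable. *)
Lemma bargmann_poly_approximable (j : 'I_n) (z : 'I_n -> C) : (forall i, nc (z i) = 1) ->
  poly_approximable (fun w => bargmann S f (subst j z w)).
Proof.
move=> z1 rho eta eta0.
have [mf _] := fi.
have r0 : 0 <= Num.max rho 1 by rewrite le_max ler01 orbT.
have [K K0 hK] := bargmann_expansion Spd mf Cf0 fC r0.
have [N hN] := pow2_small K0 eta0.
exists (\sum_(b : {ffun 'I_n -> 'I_N.+1})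
  ((\prod_(i | i != j) z i ^+ b i) * bargmann_coef S f (fun i => b i)) *: 'X^(b j)) => w hw.
have -> : (\sum_(b : {ffun 'I_n -> 'I_N.+1})
    ((\prod_(i | i != j) z i ^+ b i) * bargmann_coef S f (fun i => b i)) *: 'X^(b j)).[w] =
  \sum_(b : {ffun 'I_n -> 'I_N.+1})
     (\prod_i subst j z w i ^+ b i) * bargmann_coef S f (fun i => b i).
  rewrite horner_sum; apply: eq_bigr => b _; rewrite hornerZ hornerXn.
  rewrite [in RHS](bigD1 j)// {1}/subst eqxx mulrC mulrA; congr (_ * _ * _).
  by apply: eq_big => [i|i /negPf ij]; rewrite /subst ?ij.
apply: (le_trans (hK _ _ _)); last exact: hN.
move=> i; rewrite /subst; case: ifP => _; first by rewrite le_max hw.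
by rewrite z1 le_max lexx orbT.
Qed.

(** The Fourier side is the Bargmann transform of [Phi] in the frame given by the identity
  matrix, taken at [i z]; so [bargmann_growth] provides both bounds required by
  [phragmen_lindelof] in the [j]-th variable. *)
Lemma bargmann_coef_le (N : R -> R) (j : 'I_n) (Cu Cv : R) : 0 <= Cu -> 0 <= Cv ->
  {ae L, forall x, nc (f x) <= Cu * expR (- (2^-1 * ((S *m x) j ord0) ^+ 2) +
     N `|(S *m x) j ord0|)} ->
  {ae L, forall eta : 'cV[R]_n, nc (cint L (fun x => f x * fphase x (S *m eta))) <=
     Cv * expR (- (2^-1 * (eta j ord0) ^+ 2) + N `|eta j ord0|)} ->
  exists2 K : R, 0 <= K & forall (c NR r : R), 0 <= c <= 1 -> 0 <= r ->
    (forall t, 0 <= t -> N t <= NR + c * t) -> forall al : 'I_n -> nat,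
    nc (bargmann_coef S f al) * r ^+ al j <= K * expR (NR + 2 * c * r).
Proof.
move=> Cu0 Cv0 hu hv; have [mf _] := fi.
have [K1 K10 hK1] := bargmann_growth Spd Cu0 hu.
pose Phi eta := cint L (fun x => f x * fphase x (S *m eta)).
have pd1 : posdefmx (1%:M : 'M[R]_n).
  by split; [rewrite trmx1|move=> x x0; rewrite mul1mx dotvv_gt0].
have hv1 : {ae L, forall eta, nc (Phi eta) <= Cv * expR (- (2^-1 * (((1%:M : 'M[R]_n) *m eta) j ord0) ^+ 2) +
     N `|((1%:M : 'M[R]_n) *m eta) j ord0|)}.
  by apply: filterS hv => eta; rewrite mul1mx.
have [K2 K20 hK2] := bargmann_growth pd1 Cv0 hv1.
pose kf : R := Num.sqrt 2 * Num.sqrt pi.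
have kf0 : 0 < kf by rewrite mulr_gt0 ?sqrtr_gt0 ?pi_gt0.
have kfn0 : 0 < kf ^+ n by rewrite exprn_gt0.
pose K := K1 + K2 / kf ^+ n.
have K20' : 0 <= K2 / kf ^+ n by rewrite divr_ge0 ?(ltW kfn0).
have K0 : 0 <= K by rewrite addr_ge0.
exists K => // c NR r hc r0 hN al.
have side z : (forall i, i != j -> nc (z i) <= 1) ->
    nc (bargmann S f z) <= K * expR NR * expR (c * `|Re (z j)| + Im (z j) ^+ 2) /\
    nc (bargmann S f z) <= K * expR NR * expR (c * `|Im (z j)| + Re (z j) ^+ 2).
  move=> hz; split.
    apply: le_trans (hK1 c NR z hc hN hz _) _; last first.
      by rewrite !ler_wpM2r ?expR_ge0// lerDl.
    apply: cmeasurableM => //.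
    exact: (cmeasurable_prod_mulmx S (fun i => cmeasurable_hgauss 2^-1 (z i))).
  have [E mE] := bargmann_fourier Spd z fi.
  pose z' i := Complex 0 1 * z i.
  have hE eta : hprod z eta * Phi eta =
      Phi eta * \prod_i hgauss 2^-1 (((1%:M : 'M[R]_n) *m eta) i ord0) (z' i).
    by rewrite mul1mx mulrC.
  have hz' i : i != j -> nc (z' i) <= 1.
    move=> ij; rewrite /z' Normc.normcM.
    have -> : nc (Complex 0 1) = 1 by rewrite /Normc.normc expr0n add0r expr1n sqrtr1.
    by rewrite mul1r hz.
  have mE' : cmeasurable (fun eta => Phi eta *
      \prod_i hgauss 2^-1 (((1%:M : 'M[R]_n) *m eta) i ord0) (z' i)).
    by move: mE; congr cmeasurable; apply/funext => eta; exact: hE.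
  have B2 := hK2 c NR z' hc hN hz' mE'.
  have E' : toC kf ^+ n * bargmann S f z = bargmann 1%:M Phi z'.
    by rewrite E; apply: eq_cint => eta; exact: hE.
  have Ez : Re (z' j) = - Im (z j) /\ Im (z' j) = Re (z j).
    by rewrite /z'; case: (z j) => p q /=; split; ring.
  case: Ez => Ez1 Ez2; move: B2; rewrite -E' Ez1 Ez2 normrN Normc.normcM ncX nc_real.
  rewrite ger0_norm ?(ltW kf0)// => B2.
  apply: (@le_trans _ _ (K2 / kf ^+ n * expR NR * expR (c * `|Im (z j)| + Re (z j) ^+ 2))).
    rewrite -(ler_pM2l kfn0); apply: (le_trans B2).
    by rewrite !mulrA [_ * K2]mulrC mulfK ?gt_eqF.
  by rewrite !ler_wpM2r ?expR_ge0// lerDr.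
have onT z : (forall i, nc (z i) = if i == j then r else 1) ->
    nc (bargmann S f z) <= K * expR (NR + 2 * c * r).
  move=> hz; case/andP: hc => c0 c1.
  pose z1 i := if i == j then 1 else z i.
  have z11 i : nc (z1 i) = 1.
    by rewrite /z1; case: ifP => ij; rewrite ?nc_real ?normr1 ?hz ?ij//; exact: Normc.normc1.
  have aF := bargmann_poly_approximable j z11.
  have hM : 0 <= K * expR NR by rewrite mulr_ge0 ?expR_ge0.
  have bd x y : nc (bargmann S f (subst j z1 (Complex x y))) <=
      K * expR NR * expR (c * (`|x| + `|y|) + x ^+ 2) /\
    nc (bargmann S f (subst j z1 (Complex x y))) <=
      K * expR NR * expR (c * (`|x| + `|y|) + y ^+ 2).
    have hs i : i != j -> nc (subst j z1 (Complex x y) i) <= 1.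
      by move=> /negPf ij; rewrite /subst ij z11.
    have [b1 b2] := side _ hs.
    have sj : subst j z1 (Complex x y) j = Complex x y by rewrite /subst eqxx.
    move: b1 b2; rewrite sj [Re _]/= [Im _]/= => b1 b2; split.
      by apply: (le_trans b2); rewrite ler_wpM2l// ler_expR lerD2r ler_wpM2l// lerDr.
    by apply: (le_trans b1); rewrite ler_wpM2l// ler_expR lerD2r ler_wpM2l// lerDl.
  have := phragmen_lindelof aF c0 hM bd (Re (z j)) (Im (z j)).
  have -> : subst j z1 (Complex (Re (z j)) (Im (z j))) = z.
    apply/funext => i; rewrite /subst /z1; case: eqP => [->|//].
    by case: (z j).
  move=> /le_trans; apply; rewrite expRD mulrA ler_wpM2l// ler_expR [2 * c]mulrC -mulrA ler_wpM2l//.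
  have zj : nc (z j) = r by rewrite hz eqxx.
  by rewrite mulr_natl mulr2n -zj lerD ?nc_Re ?nc_Im.
apply/ler_addgt0Pr => e e0.
pose rho := Num.max r 1; have rho0 : 0 <= rho by rewrite le_max ler01 orbT.
have [K' K'0 hK'] := bargmann_expansion Spd mf Cf0 fC rho0.
have [N0 hN0] := pow2_small K'0 e0.
pose M := maxn N0 (\sum_i al i).
have alM i : (al i < M.+1)%N.
  by rewrite ltnS leq_max; apply/orP; right; rewrite (bigD1 i)//= leq_addr.
pose b : {ffun 'I_n -> 'I_M.+1} := [ffun i => inord (al i)].
have bE i : b i = al i :> nat by rewrite ffunE inordK.
pose rad i := if i == j then r else 1.
have rad0 i : 0 <= rad i by rewrite /rad; case: ifP.
(* M is at least every entry of al, so that al is one of the exponents of the partial sum *)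
have := torus_cauchy (N := M) (c := fun b => bargmann_coef S f (fun i => b i))
  (M := K * expR (NR + 2 * c * r) + e) rad0.
move=> /(_ _ b); have -> : \prod_i rad i ^+ b i = r ^+ al j.
  rewrite (bigD1 j)//= {1}/rad eqxx bE big1 ?mulr1// => i /negPf ij.
  by rewrite /rad ij expr1n.
have -> : (fun i => b i) = al :> ('I_n -> nat) by apply/funext => i; exact: bE.
apply => z hz.
have hz' i : nc (z i) <= rho by rewrite hz /rad le_max; case: ifP; rewrite lexx ?orbT.
have h1 := hK' z M hz'.
have h2 := onT z hz.
have h3 := hN0 M (leq_maxl _ _).
set Sg := \sum_(b0 : _) _ in h1 *.
have -> : Sg = bargmann S f z - (bargmann S f z - Sg) by rewrite opprB addrC subrK.
apply: (le_trans (le_normcD _ _)).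
rewrite normcN; apply: lerD h2 _.
exact: le_trans h1 h3.
Qed.

End coefficient_bound.

(** * Hermite functions *)

Section hermite_formula.
Variables (R : realType) (d : nat).
Implicit Types (y : 'cV[R]_d) (ks : 'I_d -> nat).

(** Rodrigues' formula: the derivative of order [k] of [exp(- t ^ 2)]. *)
Definition gauss_deriv (k : nat) (t : R) : R := (-1) ^+ k * ((hpoly R k).[t] * expR (- t ^+ 2)).

Lemma is_derive_gauss_deriv k (t : R) : is_derive t 1 (gauss_deriv k) (gauss_deriv k.+1 t).
Proof.
have dp : is_derive t 1 (fun t : R => (hpoly R k).[t]) ((hpoly R k)^`()).[t].
  exact: is_derive_poly.
have dt : is_derive t 1 (fun t : R => - (t * t)) (- (t * 1 + t * 1)).
  exact: (derN (derM (derI t) (derI t))).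
have := derZ ((-1) ^+ k) (derM dp (derexp dt)).
rewrite [in X in is_derive _ _ X]/=.
have <- : gauss_deriv k = (fun t0 : R => (-1) ^+ k * ((hpoly R k).[t0] * expR (- (t0 * t0)))).
  by [].
move=> h; apply: (is_derive_eq (df := _) h).
by rewrite /gauss_deriv exprS /= hornerD hornerN hornerM hornerZ hornerX expr2; ring.
Qed.

(** Along a coordinate direction the other factors are constant, so the difference quotient is
  one-dimensional. *)
Lemma partial_prod (j : 'I_d) (phi : 'I_d -> R -> R) (dphi : R -> R) :
  (forall t : R, is_derive t 1 (phi j) (dphi t)) ->
  partial j (fun y => \prod_i phi i (y i 0)) =
  fun y => \prod_i (if i == j then dphi else phi i) (y i 0).
Proof.
move=> dj; apply/funext => y; rewrite /partial.
rewrite [RHS](bigD1 j)//= eqxx.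
set c := \prod_(i < d | i != j) _.
have ec : \prod_(i < d | i != j) phi i (y i 0) = c by apply: eq_bigr => i /negPf ->.
have dg : is_derive (y j 0) 1 (fun t : R => c * phi j t) (c * dphi (y j 0)) by exact: derZ.
transitivity ('D_1 (fun t : R => c * phi j t) (y j 0)); last by rewrite derive_val mulrC.
have E (h : R) : h^-1 *: ((\prod_i phi i ((h *: basis_cV j + y) i 0)) - \prod_i phi i (y i 0)) =
    h^-1 *: (c * phi j (h *: (1 : R) + y j 0) - c * phi j (y j 0)).
  congr (_ *: (_ - _)); last by rewrite (bigD1 j)//= ec mulrC.
  rewrite (bigD1 j)//= !mxE !eqxx /= mulrC; congr (_ * _).
  by rewrite -ec; apply: eq_bigr => i ij; rewrite !mxE (negPf ij) /= mulr0 add0r.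
by rewrite /derive; under [X in lim (X @ _)]eq_fun do rewrite /= E.
Qed.

Lemma iter_partial j m ks :
  iter m (partial j) (fun y => \prod_i gauss_deriv (ks i) (y i 0)) =
  fun y => \prod_i gauss_deriv (if i == j then (ks i + m)%N else ks i) (y i 0).
Proof.
elim: m => [|m IH] /=.
  by apply/funext => y; apply: eq_bigr => i _; rewrite addn0 if_same.
rewrite IH; pose phi i := gauss_deriv (if i == j then (ks i + m)%N else ks i).
have dphi (t : R) : is_derive t 1 (phi j) (gauss_deriv (ks j + m).+1 t).
  by rewrite /phi eqxx; exact: is_derive_gauss_deriv.
apply: etrans (partial_prod dphi) _.
apply/funext => y; apply: eq_bigr => i _; rewrite /phi; case: eqP => [->|//].
by rewrite addnS.
Qed.

Lemma mpartial_gauss (al : 'I_d -> nat) :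
  mpartial al (fun y => expR (- dotv y y)) = fun y => \prod_i gauss_deriv (al i) (y i 0).
Proof.
have -> : (fun y => expR (- dotv y y)) = fun y => \prod_i gauss_deriv 0 (y i 0).
  apply/funext => y; rewrite /dotv -sumrN.
  rewrite (big_morph (@expR R) (@expRD R) (@expR0 R)); apply: eq_bigr => i _.
  by rewrite /gauss_deriv expr0 hornerC !mul1r expr2.
rewrite /mpartial.
have -> : foldr (fun j => iter (al j) (partial j)) (fun y => \prod_i gauss_deriv 0 (y i 0)) (enum 'I_d)
  = fun y => \prod_i gauss_deriv (if i \in enum 'I_d then al i else 0) (y i 0).
  elim: (enum _) (enum_uniq 'I_d) => [//|j s IH] /= /andP[js us].
  rewrite IH// iter_partial; apply/funext => y; apply: eq_bigr => i _.
  rewrite in_cons; case: eqP => [->|//].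
  by rewrite (negPf js) add0n.
by apply/funext => y; apply: eq_bigr => i _; rewrite mem_enum.
Qed.

End hermite_formula.

Section hermite_coefficients.
Variables (R : realType) (d : nat).
Local Notation C := R[i].
Local Notation L := (lebesgue_cV R d).
Local Notation nc := (@Normc.normc R).
Local Notation toC := (real_complex R).

Lemma hermiteE (al : 'I_d -> nat) (y : 'cV[R]_d) :
  hermite al y = (-1) ^+ midx_norm al * pi `^ (- (d%:R / 4))
    * (2 ^+ midx_norm al * (midx_fact al)%:R) `^ (- 2^-1)
    * (\prod_i ((-1) ^+ al i * (al i)`!%:R))
    * \prod_i (hcoef (y i ord0) (al i) * expR (- (2^-1 * (y i ord0) ^+ 2))).
Proof.
rewrite /hermite mpartial_gauss -!mulrA; do 3 congr (_ * _).
have -> : expR (2^-1 * dotv y y) = \prod_i expR (2^-1 * (y i ord0) ^+ 2).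
  rewrite /dotv mulr_sumr; exact: (big_morph (@expR R) (@expRD R) (@expR0 R)).
rewrite -!big_split /=; apply: eq_bigr => i _; rewrite /gauss_deriv /hcoef.
set t := y i ord0.
have -> : expR (- t ^+ 2) = expR (- (2^-1 * t ^+ 2)) * expR (- (2^-1 * t ^+ 2)).
  by rewrite -expRD; congr expR; field.
have h0 : (al i)`!%:R != 0 :> R by rewrite pnatr_eq0 -lt0n fact_gt0.
rewrite expRN; have h1 : expR (2^-1 * t ^+ 2) != 0 by rewrite gt_eqF ?expR_gt0.
by field; rewrite h0 h1.
Qed.

(** The factor [(2 ^ |alpha| alpha!) ^ (- 1 / 2)] is bounded by 1: what is lost is at most
  exponential in [|alpha| ln |alpha|], hence negligible in the final estimate. *)
Lemma hermite_coef_le (A : 'M[R]_d) (f : 'cV[R]_d -> C) (Cf : R) (al : 'I_d -> nat) :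
  posdefmx A -> cmeasurable f -> 0 <= Cf -> {ae L, forall x, nc (f x) <= Cf} ->
  nc (hermite_coef A f al) <= \det A `^ 4^-1 * pi `^ (- (d%:R / 4)) * (midx_fact al)%:R
    * nc (bargmann_coef (sqrtmx A) f al).
Proof.
move=> Apd mf Cf0 fC; have [Spd _] := sqrtmxP Apd.
set S := sqrtmx A in Spd *.
pose kap := \det A `^ 4^-1 * ((-1) ^+ midx_norm al * pi `^ (- (d%:R / 4))
    * (2 ^+ midx_norm al * (midx_fact al)%:R) `^ (- 2^-1)
    * (\prod_i ((-1) ^+ al i * (al i)`!%:R))) : R.
have -> : hermite_coef A f al = toC kap * bargmann_coef S f al.
  rewrite /bargmann_coef -cintZ.
    apply: eq_cint => x; have -> : skew_hermite A al x = kap *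
        \prod_i (hcoef ((S *m x) i ord0) (al i) * expR (- (2^-1 * ((S *m x) i ord0) ^+ 2))).
      by rewrite /skew_hermite hermiteE mulrA.
    have conj_real (s : R) : conjc (toC s) = toC s by congr Complex; rewrite oppr0.
    rewrite conj_real rmorphM rmorph_prod /= mulrCA; congr (_ * (_ * _)).
    by apply: eq_bigr => i _; rewrite rmorphM.
  exact: (cintegrable_coef al Spd mf Cf0 fC).
rewrite Normc.normcM nc_real; apply: ler_wpM2r; first exact: nc_ge0.
have f1 : (midx_fact al)%:R = \prod_i (al i)`!%:R :> R by rewrite natr_prod.
have X1 : 1 <= 2 ^+ midx_norm al * (midx_fact al)%:R :> R.
  rewrite -natrX -natrM ler1n muln_gt0 expn_gt0 /midx_fact.
  by apply: prodn_gt0 => i; exact: fact_gt0.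
have p1 : (2 ^+ midx_norm al * (midx_fact al)%:R) `^ (- 2^-1) <= 1 :> R.
  rewrite powRN invf_le1 ?powR_gt0 ?(lt_le_trans ltr01)//.
  have h0 : 0 <= 2^-1 :> R by rewrite invr_ge0.
  by have := ge0_ler_powR h0 ler01 (le_trans ler01 X1) X1; rewrite powR1.
have -> : `|kap| = \det A `^ 4^-1 * pi `^ (- (d%:R / 4)) * (midx_fact al)%:R *
    (2 ^+ midx_norm al * (midx_fact al)%:R) `^ (- 2^-1).
  rewrite /kap !normrM normrX normrN1 expr1n mul1r !(ger0_norm (powR_ge0 _ _)).
  have -> : `|\prod_i ((-1) ^+ al i * (al i)`!%:R)| = (midx_fact al)%:R :> R.
    by rewrite f1 normr_prod; apply: eq_bigr => i _; rewrite normrM normrX normrN1 expr1n mul1r ger0_norm.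
  by rewrite -!mulrA; do 2 congr (_ * _); rewrite mulrC.
by rewrite ler_piMr// !mulr_ge0// powR_ge0.
Qed.
End hermite_coefficients.

(** * Choice of the radius *)

Section asymptotics.
Variable R : realType.
Implicit Types a lam s t x K : R.

Lemma ln_le_sub1 x : 0 < x -> ln x <= x - 1.
Proof.
move=> x0; have h : -1 < x - 1 by lra.
by have := le_ln1Dx h; rewrite addrC subrK.
Qed.

Lemma ln_small K s : 0 <= K -> 0 < s -> 4 * K ^+ 2 <= s -> K * ln s <= s.
Proof.
move=> K0 s0 Ks.
have y0 : 0 < Num.sqrt s by rewrite sqrtr_gt0.
have sy : s = Num.sqrt s ^+ 2 by rewrite sqr_sqrtr// ltW.
have ly := ln_le_sub1 y0.
rewrite [in ln _]sy lnXn// mulr2n.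
have Ky : 2 * K <= Num.sqrt s.
  rewrite -(@ler_pXn2r _ 2)// ?nnegrE; [|by rewrite mulr_ge0|exact: ltW].
  by rewrite -sy exprMn; apply: le_trans Ks; rewrite ler_wpM2r ?sqr_ge0//; lra.
have h1 : K * ln (Num.sqrt s) <= K * Num.sqrt s by rewrite ler_wpM2l//; lra.
have h2 : 2 * K * Num.sqrt s <= s by rewrite [leRHS]sy expr2 ler_pM2r.
lra.
Qed.

(** With [p = 1 + a] and [ln t = s + v]: if [v > 0] then
  [(ln t) ^ p = s ^ p (1 + v / s) ^ p <= s ^ p exp(p v / s)], and for [p / s <= 1 / 2] the
  exponential is at most [1 + (p / s) exp v], where [exp v = t exp(- s)]. *)
Lemma log_power_growth a lam s t : 0 < a -> 0 < lam -> 0 < s -> 2 * (1 + a) <= s -> 0 <= t ->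
  lam * logp t `^ (1 + a) <= lam * s `^ (1 + a) + (1 + a) * lam * s `^ a * expR (- s) * t.
Proof.
move=> a0 l0 s0 ps t0; set p := 1 + a in ps *.
have p0 : 0 < p by rewrite /p; lra.
have extra : 0 <= p * lam * s `^ a * expR (- s) * t.
  by rewrite !mulr_ge0 ?powR_ge0 ?expR_ge0// ltW.
have lp0 : 0 <= logp t by rewrite le_max lexx.
have [ts|ts] := leP (logp t) s.
  apply: (@le_trans _ _ (lam * s `^ p)); last by rewrite lerDl.
  by rewrite ler_pM2l// ge0_ler_powR ?nnegrE// ltW.
have lt : logp t = ln t.
  by move: ts; rewrite /logp; case: (leP 0 (ln t)) => // _ h; lra.
rewrite lt in ts *.
have tp : 0 < t by rewrite lt_neqAle t0 andbT eq_sym; apply: contraTneq ts => ->; rewrite ln0// -leNgt ltW.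
pose v := ln t - s; have v0 : 0 < v by rewrite subr_gt0.
have lte : ln t = s * (1 + v / s) by rewrite mulrDr mulr1 mulrCA mulfV ?gt_eqF// mulr1 /v addrC subrK.
have vs0 : 0 < v / s by rewrite divr_gt0.
have w0 : 0 < 1 + v / s by lra.
have ev : expR v = t * expR (- s) by rewrite /v expRD lnK ?posrE.
rewrite {1}lte powRM ?(ltW s0) ?(ltW w0)//.
pose y := p * (v / s); have y0 : 0 < y by rewrite mulr_gt0.
have h1 : (1 + v / s) `^ p <= expR y.
  rewrite /powR gt_eqF// ler_expR ler_pM2l//.
  by have := ln_le_sub1 w0; lra.
have h2 : expR y <= 1 + y * expR y.
  have := expR_ge1Dx (- y); rewrite expRN => h.
  have : (1 - y) * expR y <= 1 by rewrite -ler_pdivlMr ?expR_gt0// div1r.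
  by rewrite mulrBl mul1r lerBlDr.
have h3 : v <= expR (v / 2).
  have := expR_ge1Dx (v / 4) => h.
  have -> : expR (v / 2) = expR (v / 4) ^+ 2 by rewrite expr2 -expRD; congr expR; field.
  apply: (@le_trans _ _ ((1 + v / 4) ^+ 2)); last by rewrite ler_pXn2r// nnegrE; [lra|exact: expR_ge0].
  by have := sqr_ge0 (1 - v / 4); rewrite !expr2; lra.
have ps1 : p / s <= 2^-1 by rewrite ler_pdivrMr//; lra.
have h4 : expR y <= expR (v / 2).
  by rewrite ler_expR /y mulrCA ler_pM2l.
have h5 : y * expR y <= p / s * expR v.
  have -> : y * expR y = p / s * (v * expR y) by rewrite /y; ring.
  rewrite ler_pM2l ?divr_gt0//.
  have -> : expR v = expR (v / 2) * expR (v / 2) by rewrite -expRD; congr expR; field.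
  by apply: ler_pM => //; rewrite ?expR_ge0 ?ltW.
have sp : s `^ p = s * s `^ a.
  by rewrite /p powRD ?powRr1 ?(ltW s0)// gt_eqF//; apply/implyP.
have sa0 : 0 < s `^ a by rewrite powR_gt0.
apply: (@le_trans _ _ (lam * (s `^ p * (1 + p / s * expR v)))).
  rewrite ler_pM2l// ler_pM2l ?powR_gt0//; lra.
rewrite ev sp le_eqVlt; apply/orP; left; apply/eqP; field.
by rewrite gt_eqF.
Qed.

(** At the radius [rho = exp s] the slope [c] is of order [s ^ a / rho], so the linear term
  [2 c rho] is of lower order than [lam s ^ (1 + a)], and [lam' > lam] absorbs it. *)
Lemma log_majorant a lam lam' : 0 < a -> 0 < lam -> lam < lam' ->
  exists2 s1, 0 < s1 & forall s, s1 <= s -> exists c NR : R, [/\ 0 <= c <= 1,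
    forall t, 0 <= t -> lam * logp t `^ (1 + a) <= NR + c * t &
    NR + 2 * c * expR s <= lam' * s `^ (1 + a)].
Proof.
move=> a0 l0 ll; set p := 1 + a; have p0 : 0 < p by rewrite /p; lra.
have pl0 : 0 < p * lam by rewrite mulr_gt0.
pose A1 := 2 * p; pose A2 := 2 * p * lam / (lam' - lam); pose A3 := 2 * (p * lam).
pose A4 := 4 * (2 * a) ^+ 2.
have d0 : 0 < lam' - lam by rewrite subr_gt0.
have A10 : 0 < A1 by rewrite mulr_gt0.
have A20 : 0 < A2 by rewrite divr_gt0// -mulrA mulr_gt0.
have A30 : 0 < A3 by rewrite mulr_gt0.
have A40 : 0 <= A4 by rewrite mulr_ge0 ?sqr_ge0.
exists (A1 + A2 + A3 + A4) => [|s hs]; first by lra.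
have s0 : 0 < s by lra.
have sa0 : 0 < s `^ a by rewrite powR_gt0.
exists (p * lam * s `^ a * expR (- s)), (lam * s `^ p); split.
- apply/andP; split; first by rewrite !mulr_ge0 ?expR_ge0// ltW.
  rewrite expRN ler_pdivrMr ?expR_gt0// mul1r.
  have -> : p * lam * s `^ a = expR (ln (p * lam) + a * ln s).
    by rewrite expRD lnK ?posrE// /powR gt_eqF.
  rewrite ler_expR; have h1 := ln_le_sub1 pl0.
  have h2 : 2 * a * ln s <= s by apply: ln_small; rewrite -/A4; lra.
  rewrite /A3 in hs; lra.
- by move=> t t0; apply: log_power_growth => //; rewrite -/p -/A1; lra.
have sp : s `^ p = s * s `^ a.
  by rewrite /p powRD ?powRr1 ?(ltW s0)// gt_eqF//; apply/implyP.
have -> : 2 * (p * lam * s `^ a * expR (- s)) * expR s = 2 * p * lam * s `^ a.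
  by rewrite -!mulrA -expRD addNr expR0 mulr1.
rewrite sp; have h : 2 * p * lam <= (lam' - lam) * s.
  by rewrite [leRHS]mulrC -ler_pdivrMr// -/A2; lra.
have := ler_wpM2r (ltW sa0) h; lra.
Qed.

End asymptotics.

Section optimisation.
Variable R : realType.
Implicit Types a lam r x : R.

(** The minimum of [lam s ^ (1 + a) - s x] is reached where [lam (1 + a) s ^ a = x]. *)
Lemma legendre_optimum a lam x : 0 < a -> 0 < lam -> 0 <= x ->
  exists2 s, 0 <= s & lam * s `^ (1 + a) - s * x =
    - (a / (1 + a) * (lam * (1 + a)) `^ (- a^-1) * x `^ ((a + 1) / a)).
Proof.
move=> a0 l0 x0; set p := 1 + a; have p0 : 0 < p by rewrite /p; lra.
have lp0 : 0 < lam * p by rewrite mulr_gt0.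
pose B := (lam * p) `^ (- a^-1).
exists (B * x `^ a^-1); first by rewrite mulr_ge0 ?powR_ge0.
set s := B * _; have s0 : 0 <= s by rewrite mulr_ge0 ?powR_ge0.
have an0 : a != 0 by rewrite gt_eqF.
have sp : s `^ p = s * s `^ a.
  by rewrite /p powRD ?powRr1// (gt_eqF p0); apply/implyP.
have sa : s `^ a = (lam * p)^-1 * x.
  rewrite /s powRM ?powR_ge0// -!powRrM mulNr mulVf// powRr1//.
  by rewrite powR_inv1 // ltW.
have xq : x `^ ((a + 1) / a) = x * x `^ a^-1.
  rewrite mulrDl mulfV// mul1r powRD ?powRr1//; apply/implyP.
  by rewrite gt_eqF// ltr_wpDr// ltW// invr_gt0.
rewrite sp sa xq /s -/B.
have -> : a = p - 1 by rewrite /p addrAC subrr add0r.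
by field; rewrite !gt_eqF.
Qed.

(** The right-hand side of the conclusion is the constant of [legendre_optimum]. It is
  continuous in [lam'], and at [lam' = lam] the claim is the hypothesis raised to the
  power [(1 + a) / a]. After passing to logarithms, [G] is the available gap, half of which
  is spent. *)
Lemma rate_gap a lam r : 0 < a -> 0 < lam -> 0 < r ->
  r < a `^ (a / (1 + a)) / (1 + a) * lam `^ (- (1 + a)^-1) ->
  exists2 lam', lam < lam' &
    r `^ ((a + 1) / a) < a / (1 + a) * (lam' * (1 + a)) `^ (- a^-1).
Proof.
move=> a0 l0 r0; set p := 1 + a; have p0 : 0 < p by rewrite /p; lra.
have pow (x y : R) : 0 < x -> x `^ y = expR (y * ln x) by move=> x0; rewrite /powR gt_eqF.
rewrite !pow// -[X in _ / X * _](lnK (p0 : p \in Num.pos)) -expRN -!expRD -[X in X < _](lnK (r0 : r \in Num.pos)) ltr_expR => h.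
pose G := ln a - ln p - (ln lam + ln p) / a - p / a * ln r.
have G0 : 0 < G.
  have -> : G = (a / p * ln a - ln p + - p^-1 * ln lam - ln r) * (p / a).
    rewrite /G; have -> : a = p - 1 by rewrite /p addrAC subrr add0r.
    have h1 : p - 1 != 0 by rewrite /p addrAC subrr add0r gt_eqF.
    by field; rewrite h1 gt_eqF.
  by rewrite mulr_gt0 ?divr_gt0// subr_gt0.
pose k := expR (a * G / 2).
have k1 : 1 < k by rewrite expR_gt1 divr_gt0// mulr_gt0.
have k0 : 0 < k := expR_gt0 _.
exists (lam * k); first by rewrite ltr_pMr.
have -> : (a + 1) / a = p / a by rewrite addrC.
rewrite !pow ?mulr_gt0//.
have -> : a / p = expR (ln a - ln p) by rewrite expRB !lnK.
rewrite -expRD ltr_expR !lnM ?posrE ?mulr_gt0// /k expRK.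
have h2 : a != 0 by rewrite gt_eqF.
have -> : - a^-1 * (ln lam + a * G / 2 + ln p) = - ((ln lam + ln p) / a) - G / 2 by field.
have : p / a * ln r = ln a - ln p - (ln lam + ln p) / a - G by rewrite /G; ring.
by move=> ->; lra.
Qed.

Lemma fact_le_expn k m : (k <= m)%N -> (k`! <= m ^ k)%N.
Proof.
elim: k => [//|k IH] km; rewrite factS expnS.
by apply: leq_mul => //; exact/IH/ltnW.
Qed.

(** Here [alpha! <= m ^ (m d) = exp(d m ln m)], and [m ln m] is negligible with respect to
  the power [1 + 1 / a] of [m]. *)
Lemma midx_fact_le (d : nat) a kap : 0 < a -> 0 < kap -> exists2 K : R, 0 <= K &
  forall (al : 'I_d -> nat) m, (forall i, (al i <= m)%N) ->
  (midx_fact al)%:R <= expR (K + kap * m%:R `^ ((a + 1) / a)).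
Proof.
move=> a0 k0; pose D := d%:R * a / kap.
have D0 : 0 <= D by apply: divr_ge0; [apply: mulr_ge0 => //|]; exact: ltW.
pose M := (4 * D ^+ 2) `^ a; have M0 : 0 <= M := powR_ge0 _ _.
exists (d%:R * (M * M)); first by rewrite !mulr_ge0.
move=> al m alm; case: m => [|m] in alm *.
  have -> : midx_fact al = 1%N.
    by rewrite /midx_fact big1// => i _; move: (alm i); rewrite leqn0 => /eqP ->.
  rewrite -[leLHS]expR0 ler_expR addr_ge0 ?mulr_ge0 ?powR_ge0//; exact: ltW.
have x0 : 0 < m.+1%:R :> R by rewrite ltr0n.
set x := m.+1%:R in x0 *.
have h1 : (midx_fact al)%:R <= expR (d%:R * (x * ln x)).
  have -> : expR (d%:R * (x * ln x)) = ((m.+1 ^ m.+1) ^ d)%N%:R.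
    by rewrite !expRM_natl lnK// !natrX.
  rewrite ler_nat -[d in leqRHS]card_ord -prod_nat_const.
  apply: leq_prod => i _; apply: leq_trans (fact_le_expn (alm i)) _.
  by rewrite leq_pexp2l.
apply: (le_trans h1); rewrite ler_expR.
pose y := x `^ a^-1; have y0 : 0 < y by rewrite powR_gt0.
have xy : x = y `^ a by rewrite /y -powRrM mulVf ?gt_eqF// powRr1// ltW.
have -> : x `^ ((a + 1) / a) = x * y.
  rewrite mulrDl mulfV ?gt_eqF// mul1r powRD ?powRr1 ?ltW//; apply/implyP.
  by rewrite gt_eqF// ltr_wpDr// ltW// invr_gt0.
have [yD|yD] := leP (4 * D ^+ 2) y.
  have h2 := ln_small D0 y0 yD.
  have -> : d%:R * (x * ln x) = kap * (x * (D * ln y)).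
    by rewrite [in ln x]xy ln_powR /D; field; rewrite gt_eqF.
  have h3 : x * (D * ln y) <= x * y by rewrite ler_pM2l.
  have h4 : 0 <= d%:R * (M * M) by rewrite !mulr_ge0.
  have := ler_wpM2l (ltW k0) h3; lra.
have xM : x <= M.
  have z0 : 0 <= 4 * D ^+ 2 by rewrite mulr_ge0 ?sqr_ge0.
  by rewrite xy; exact: (ge0_ler_powR (ltW a0) (ltW y0) z0 (ltW yD)).
have lx : ln x <= M by have := ln_le_sub1 x0; lra.
have lx0 : 0 <= ln x by rewrite ln_ge0// ler1n.
have h5 : x * ln x <= M * M by apply: ler_pM => //; exact: ltW.
have h6 : 0 <= kap * (x * y) by rewrite !mulr_ge0//; exact: ltW.
have := ler_wpM2l (ler0n R d) h5; lra.
Qed.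

End optimisation.

(** * Decay of the Hermite coefficients *)

Section frame.
Variables (R : realType) (d : nat).

Lemma posdefmx_unit (S : 'M[R]_d) : posdefmx S -> S \in unitmx.
Proof.
case=> Ssym Spos; rewrite -row_free_unit; apply: inj_row_free => v vS.
apply/eqP; apply: contraT => v0.
have vT0 : v^T != 0 by rewrite -(inj_eq (@trmx_inj _ _ _)) trmxK trmx0.
by have := Spos _ vT0; rewrite -{1}Ssym -trmx_mul vS trmx0 /dotv big1 ?ltxx// => i _;
  rewrite [X in _ * X]mxE mulr0.
Qed.

Lemma dotv_basis (y : 'cV[R]_d) j : dotv y (basis_cV j) = y j ord0.
Proof.
rewrite /dotv (bigD1 j)//= big1 => [|i ij].
  by rewrite addr0 /basis_cV mxE !eqxx mulr1.
by rewrite /basis_cV mxE (negPf ij) mulr0.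
Qed.

Lemma dotv_frame (A : 'M[R]_d) (x : 'cV[R]_d) j : posdefmx A ->
  dotv (A *m x) (invmx (sqrtmx A) *m basis_cV j) = (sqrtmx A *m x) j ord0.
Proof.
move=> /sqrtmxP[Spd SS]; have Su := posdefmx_unit Spd; case: Spd => Ssym _.
by rewrite dotv_mulmx trmx_inv Ssym dotv_basis; set S := sqrtmx A in SS Su *;
  rewrite -SS -mulmxA mulKmx.
Qed.

Lemma dotv_dual_frame (A : 'M[R]_d) (eta : 'cV[R]_d) j : posdefmx A ->
  dotv (invmx A *m (sqrtmx A *m eta)) (sqrtmx A *m basis_cV j) = eta j ord0.
Proof.
move=> Apd; have [Spd SS] := sqrtmxP Apd; have Su := posdefmx_unit Spd.
have Au := posdefmx_unit Apd; case: Spd => Ssym _.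
rewrite dotv_mulmx Ssym dotv_basis; set S := sqrtmx A in SS Su *.
have -> : S *m (invmx A *m (S *m eta)) = eta; last by [].
apply: (can_inj (mulKmx Su)); rewrite mulmxA SS mulKVmx//.
Qed.

Lemma fourierE (f : 'cV[R]_d -> R[i]) xi :
  fourier f xi = real_complex R ((2 * pi) `^ (- (d%:R / 2))) *
    cint (lebesgue_cV R d) (fun x => f x * fphase x xi).
Proof.
congr (_ * _); apply: eq_cint => x; congr (_ * _).
by rewrite /fphase /cis /cexp /= expR0 !mul1r cosN sinN.
Qed.

End frame.

Section integrability.
Variables (R : realType) (d : nat) (S : 'M[R]_d).
Local Notation C := R[i].
Local Notation L := (lebesgue_cV R d).
Local Notation nc := (@Normc.normc R).

(** Each bound is Gaussian in one coordinate only. Their geometric mean, which is still a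
  bound, is a product of functions of one coordinate. *)
Lemma cintegrable_gauss_bounds (f : 'cV[R]_d -> C) (B : R) : (0 < d)%N -> posdefmx S ->
  cmeasurable f -> (forall j, {ae L, forall x, nc (f x) <=
     expR (B + `|(S *m x) j ord0| - 2^-1 * ((S *m x) j ord0) ^+ 2)}) -> cintegrable L f.
Proof.
move=> d0 Spd mf hf; have [c c0 cP] := ge0_integral_posdef Spd.
have dr0 : 0 < d%:R :> R by rewrite ltr0n.
have s0 : 0 < (2 * d%:R)^-1 :> R by rewrite invr_gt0 mulr_gt0.
have [M M0 hM] := expabs_integral d%:R^-1 s0.
pose phi (t : measurableTypeR R) := expR (d%:R^-1 * `|t| - (2 * d%:R)^-1 * t ^+ 2).
have mphi : measurable_fun setT phi by exact: measurable_expabs.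
have phi0 t : 0 <= phi t := expR_ge0 _.
have mP := measurable_prod_mulmx S (fun=> mphi).
have I := integral_prod_mulmx_le c0 cP (fun=> mphi) (fun=> phi0) (fun=> hM).
have P0 (x : 'cV[R]_d) : 0 <= \prod_i phi ((S *m x) i ord0) by rewrite prodr_ge0.
apply: (cintegrable_le (h := fun x => expR B * \prod_i phi ((S *m x) i ord0))) => //.
- exact: measurable_funM.
- by move=> x; rewrite mulr_ge0 ?expR_ge0.
- have hfa : {ae L, forall x, forall j, nc (f x) <=
      expR (B + `|(S *m x) j ord0| - 2^-1 * ((S *m x) j ord0) ^+ 2)}.
    by apply: filter_forall => j; exact: (hf j).
  apply: filterS hfa => x hx.
  have [->|fx0] := eqVneq (nc (f x)) 0; first by rewrite mulr_ge0 ?expR_ge0.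
  have fx : 0 < nc (f x) by rewrite lt_neqAle eq_sym fx0 nc_ge0.
  rewrite -[leLHS](lnK fx) -(big_morph (@expR R) (@expRD R) (@expR0 R)) -expRD ler_expR.
  rewrite -(ler_pM2l dr0) mulrDr mulr_sumr.
  have -> : d%:R * ln (nc (f x)) = \sum_(i < d) ln (nc (f x)).
    by rewrite sumr_const card_ord mulr_natl.
  have -> : d%:R * B = \sum_(i < d) B by rewrite sumr_const card_ord mulr_natl.
  rewrite -big_split; apply: ler_sum => i _ /=.
  have := hx i; rewrite -{1}[nc _](lnK fx) ler_expR => /le_trans; apply.
  rewrite le_eqVlt; apply/orP; left; apply/eqP; field.
  by rewrite gt_eqF.
exact: le_lt_trans (integral_scale_le (expR_ge0 _) mP P0 I) (ltry _).
Qed.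

End integrability.

(** The majorant is available for [s >= s1] only. Using [s' = max s s1] instead of the optimal
  [s] costs a constant factor, because [s' ^ (1 + a) <= s1 ^ (1 + a) + s ^ (1 + a)]. *)
Lemma decay_of_growth (R : realType) (a lam lam' K : R) :
  0 < a -> 0 < lam -> lam < lam' -> 0 <= K ->
  exists2 K' : R, 0 <= K' & forall (b : R) (m : nat),
    (forall c NR r : R, 0 <= c <= 1 -> 0 <= r ->
      (forall t, 0 <= t -> lam * logp t `^ (1 + a) <= NR + c * t) ->
      b * r ^+ m <= K * expR (NR + 2 * c * r)) ->
    b <= K' * expR (- (a / (1 + a) * (lam' * (1 + a)) `^ (- a^-1) * m%:R `^ ((a + 1) / a))).
Proof.
move=> a0 l0 ll K0; have [s1 s10 hs1] := log_majorant a0 l0 ll.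
have l'0 : 0 < lam' by exact: lt_trans ll.
exists (K * expR (lam' * s1 `^ (1 + a))); first by rewrite mulr_ge0 ?expR_ge0.
move=> b m hb; have [s s0 hs] := legendre_optimum a0 l'0 (ler0n R m).
rewrite -hs -mulrA -expRD.
pose s' := Num.max s1 s.
have s1s' : s1 <= s' by rewrite le_max lexx.
have ss' : s <= s' by rewrite le_max lexx orbT.
have [c [NR [hc hN hNR]]] := hs1 s' s1s'.
have := hb c NR (expR s') hc (expR_ge0 _) hN.
rewrite -expRM_natl -ler_pdivlMr ?expR_gt0// -expRN -[X in _ <= X -> _]mulrA -expRD => /le_trans; apply.
rewrite ler_wpM2l// ler_expR.
have h1 : s' `^ (1 + a) <= s1 `^ (1 + a) + s `^ (1 + a).
  have e (x : R) : 0 <= x `^ (1 + a) := powR_ge0 _ _.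
  by rewrite /s'; case: (leP s1 s) => _; rewrite ?lerDl ?lerDr e.
have h2 := ler_wpM2l (ltW l'0) h1.
have h3 : s * m%:R <= m%:R * s' by rewrite mulrC ler_wpM2l.
move: h2 h3 hNR; rewrite mulrDr; lra.
Qed.

Theorem theorem4p7 (R : realType) (d : nat) (A : 'M[R]_d) (a lambda : R)
    (f : 'cV[R]_d -> R[i])
    (v := fun j : 'I_d => invmx (sqrtmx A) *m basis_cV j)
    (w := fun j : 'I_d => sqrtmx A *m basis_cV j)
    (bound := fun t : R =>
       expR (- (2^-1 * t ^+ 2) + lambda * logp t `^ (1 + a))) :
  (1 <= d)%N -> posdefmx A -> 0 < a -> 0 < lambda -> L2 f ->
  (forall j : 'I_d,
    (exists C : R, 0 < C /\
      {ae lebesgue_cV R d, forall x : 'cV[R]_d,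
        Normc.normc (f x) <= C * bound `|dotv (A *m x) (v j)|}) /\
    (exists C : R, 0 < C /\
      {ae lebesgue_cV R d, forall xi : 'cV[R]_d,
        Normc.normc (fourier f xi) <=
          C * bound `|dotv (invmx A *m xi) (w j)|})) ->
  forall r : R,
    0 < r -> r < a `^ (a / (1 + a)) / (1 + a) * lambda `^ (- (1 + a)^-1) ->
    exists C : R, 0 < C /\ forall alpha : 'I_d -> nat,
      Normc.normc (hermite_coef A f alpha) <=
        C * expR (- (r * (midx_norm alpha)%:R / d%:R) `^ ((a + 1) / a)).
Proof.
move=> d0 Apd a0 l0 [mRe mIm _] hyp r r0 rlt.
have [Spd _] := sqrtmxP Apd; pose S := sqrtmx A.
pose N t := lambda * logp t `^ (1 + a) : R.
have mf : cmeasurable f by split.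
pose j0 : 'I_d := Ordinal d0.
have [lam' ll rT] := rate_gap a0 l0 r0 rlt.
set T := a / (1 + a) * _ in rT.
have hu j : exists2 C, 0 < C & {ae lebesgue_cV R d, forall x, Normc.normc (f x) <=
    C * expR (- (2^-1 * ((S *m x) j ord0) ^+ 2) + N `|(S *m x) j ord0|)}.
  have [[C [C0 hC]] _] := hyp j; exists C; first exact: C0.
  apply: filterS hC => x; rewrite /v (dotv_frame _ _ Apd) /bound.
  by rewrite (real_normK (num_real _)).
have hv j : exists2 C, 0 < C & {ae lebesgue_cV R d, forall eta : 'cV[R]_d,
    Normc.normc (cint (lebesgue_cV R d) (fun x => f x * fphase x (S *m eta))) <=
    C * expR (- (2^-1 * (eta j ord0) ^+ 2) + N `|eta j ord0|)}.
  have [_ [C [C0 hC]]] := hyp j.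
  pose k : R := (2 * pi) `^ (- (d%:R / 2)).
  have k0 : 0 < k by rewrite powR_gt0// mulr_gt0// pi_gt0.
  exists (k^-1 * C); first by rewrite mulr_gt0 ?invr_gt0.
  apply: filterS (ae_mulmx Spd hC) => eta; rewrite /w (dotv_dual_frame _ _ Apd) /bound.
  rewrite (real_normK (num_real _)) fourierE Normc.normcM nc_real (ger0_norm (ltW k0)).
  by move=> h; rewrite -mulrA [leRHS]mulrC (ler_pdivlMr _ _ k0) mulrC; exact: h.
have [c [NR [/andP[_ c1] hN _]]] : exists c NR : R, [/\ 0 <= c <= 1,
    forall t, 0 <= t -> N t <= NR + c * t & True].
  have [s1 _ hs1] := log_majorant a0 l0 ll.
  by have [c [NR [? ? _]]] := hs1 s1 (lexx _); exists c, NR.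
have /choice[Cu hCu] : forall j, exists C, 0 < C /\ {ae lebesgue_cV R d, forall x,
    Normc.normc (f x) <= C * expR (- (2^-1 * ((S *m x) j ord0) ^+ 2) + N `|(S *m x) j ord0|)}.
  by move=> j; have [C C0 hC] := hu j; exists C.
pose B := NR + \sum_j Cu j.
have hB j : {ae lebesgue_cV R d, forall x, Normc.normc (f x) <=
    expR (B + `|(S *m x) j ord0| - 2^-1 * ((S *m x) j ord0) ^+ 2)}.
  have [C0 hC] := hCu j; apply: filterS hC => x /le_trans; apply.
  have -> : forall t : R, expR (B + `|t| - 2^-1 * t ^+ 2) =
      expR (\sum_j Cu j) * expR (NR + `|t| - 2^-1 * t ^+ 2).
    by move=> t; rewrite -expRD; congr expR; rewrite /B; ring.
  apply: ler_pM; rewrite ?expR_ge0 ?(ltW C0)//.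
    apply: (@le_trans _ _ (\sum_j Cu j)); last first.
      by have := expR_ge1Dx (\sum_j Cu j); lra.
    rewrite (bigD1 j)//= lerDl sumr_ge0// => i _; exact/ltW/(hCu i).1.
  rewrite ler_expR; set t := (S *m x) j ord0.
  have h1 := hN _ (normr_ge0 t).
  have h2 : c * `|t| <= `|t| by rewrite ler_piMl.
  lra.
have fi := cintegrable_gauss_bounds d0 Spd mf hB.
pose Cf := expR (B + 2^-1); have Cf0 : 0 <= Cf := expR_ge0 _.
have fC : {ae lebesgue_cV R d, forall x, Normc.normc (f x) <= Cf}.
  apply: filterS (hB j0) => x /le_trans; apply; rewrite ler_expR.
  set t := (S *m x) j0 ord0; rewrite -(@real_normK _ t) ?num_real//.
  by have := sqr_ge0 (`|t| - 1); rewrite !expr2; lra.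
have /choice[K hK] : forall j, exists K, 0 <= K /\ forall al : 'I_d -> nat,
    Normc.normc (bargmann_coef S f al) <= K * expR (- (T * (al j)%:R `^ ((a + 1) / a))).
  move=> j; have [Cu' Cu0 hCu'] := hu j; have [Cv Cv0 hCv] := hv j.
  have [K1 K10 hK1] := bargmann_coef_le Spd fi Cf0 fC (ltW Cu0) (ltW Cv0) hCu' hCv.
  have [K2 K20 hK2] := decay_of_growth a0 l0 ll K10.
  exists K2; split=> // al; apply: hK2 => c' NR' r' hc' hr' hN'.
  exact: (hK1 c' NR' r' hc' hr' hN' al).
have gap : 0 < T - r `^ ((a + 1) / a) by rewrite subr_gt0.
have [K3 K30 hK3] := midx_fact_le d a0 gap.
(* the constant left in front of alpha! by hermite_coef_le *)
pose D := \det A `^ 4^-1 * pi `^ (- (d%:R / 4)) : R.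
have D0 : 0 <= D by rewrite mulr_ge0 ?powR_ge0.
have SK0 : 0 <= \sum_j K j by rewrite sumr_ge0// => j _; exact: (hK j).1.
exists (D * expR K3 * \sum_j K j + 1); split.
  by rewrite ltr_wpDl// mulr_ge0// mulr_ge0 ?expR_ge0.
move=> al; set q := (a + 1) / a in T rT hK gap hK3 *.
have q0 : 0 <= q by rewrite divr_ge0 ?ltW// addr_gt0.
have [j _ jmax] := arg_maxnP al (erefl : predT j0).
have alj i : (al i <= al j)%N by exact: jmax.
have h1 : (r * (midx_norm al)%:R / d%:R) `^ q <= r `^ q * (al j)%:R `^ q.
  rewrite -powRM ?(ltW r0)//; apply: ge0_ler_powR; rewrite ?nnegrE//.
  - by rewrite !mulr_ge0 ?invr_ge0// ltW.
  - by rewrite mulr_ge0// ltW.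
  rewrite -mulrA ler_pM2l// ler_pdivrMr ?ltr0n// -natrM ler_nat /midx_norm.
  apply: (@leq_trans (\sum_(i < d) al j)); first exact: leq_sum.
  by rewrite sum_nat_const card_ord mulnC.
apply: le_trans (hermite_coef_le al Apd mf Cf0 fC) _; rewrite -/D -/S.
apply: (@le_trans _ _ (D * expR K3 * (\sum_j K j) * expR (- (r `^ q * (al j)%:R `^ q)))).
  have h2 := hK3 al (al j) alj.
  have h3 : Normc.normc (bargmann_coef S f al) <= (\sum_j K j) * expR (- (T * (al j)%:R `^ q)).
    apply: le_trans ((hK j).2 al) _; rewrite ler_wpM2r ?expR_ge0// (bigD1 j)//= lerDl.
    by rewrite sumr_ge0// => i _; exact: (hK i).1.
  have h4 := ler_pM (ler0n R (midx_fact al)) (nc_ge0 _) h2 h3.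
  rewrite -[leLHS]mulrA; apply: le_trans (ler_wpM2l D0 h4) _.
  have e : expR (K3 + (T - r `^ q) * (al j)%:R `^ q) * expR (- (T * (al j)%:R `^ q)) =
      expR K3 * expR (- (r `^ q * (al j)%:R `^ q)).
    by rewrite -!expRD; congr expR; ring.
  by rewrite [X in D * X <= _]mulrCA e -[leRHS]mulrA -[leRHS]mulrA [X in _ <= D * X]mulrCA.
apply: ler_pM; rewrite ?expR_ge0//.
- by rewrite (mulr_ge0 (mulr_ge0 D0 (expR_ge0 _)) SK0).
- by rewrite lerDl.
- by rewrite ler_expR lerN2.
Qed.
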